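(* Let $p$ be an odd prime and let $L/\mathbb{Q}_p$ be a Galois extension with group isomorphic to $D_{2p}$ which is not totally ramified. Then: (1) if $E/\mathbb{Q}_p$ is a subextension of $L/\mathbb{Q}_p$ of degree $p$ and $H_1$ is its unique Hopf Galois structure, then $\mathcal{O}_E$ is free over $\mathfrak{A}_{H_1}$; (2) for every Hopf Galois structure $H$ on $L/\mathbb{Q}_p$, $\mathcal{O}_L$ is free over $\mathfrak{A}_H$.
   Context: A Hopf Galois structure on a finite separable extension $M/K$ is a $K$-Hopf algebra $H$ with a $K$-linear action on $M$ making $M$ an $H$-module algebra such that $M\otimes_K H\to\mathrm{End}_K(M)$ is bijective. For such $H$, the associated order is $\mathfrak{A}_H=\{h\in H: h\cdot\mathcal{O}_M\subseteq\mathcal{O}_M\}$. Each degree $p$ subextension $E/\mathbb{Q}_p$ of a $D_{2p}$-extension has exactly one Hopf Galois structure $H_1$. *)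

(* Defs.v *)
From HB Require Import structures.
From mathcomp Require Import all_boot all_order all_algebra all_fingroup all_solvable all_field.
Set Implicit Arguments. Unset Strict Implicit. Unset Printing Implicit Defensive.
Import Order.TTheory GRing.Theory Num.Theory.
Local Open Scope ring_scope.

Definition padic_abs (p : nat) (q : rat) : rat :=
  if q == 0 then 0
  else (p%:R ^+ logn p (absz (denq q))) / (p%:R ^+ logn p (absz (numq q))).

(* (K, abs) is (isometrically isomorphic to) Q_p: abs is a non-archimedean
   absolute value on K extending the p-adic one on Q, Q is dense in K and
   K is complete. *)
Definition is_Qp (p : nat) (K : fieldType) (abs : K -> rat) : Prop :=
  (forall x, 0 <= abs x) /\
  (forall x, abs x = 0 <-> x = 0) /\
  (forall x y, abs (x * y) = abs x * abs y) /\
  (forall x y, abs (x + y) <= Num.max (abs x) (abs y)) /\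
  (forall q : rat, abs (ratr q) = padic_abs p q) /\
  (forall (x : K) (e : rat), 0 < e -> exists q : rat, abs (x - ratr q) < e) /\
  (forall u : nat -> K,
        (forall e, 0 < e -> exists N, forall m n, (N <= m)%N -> (N <= n)%N ->
                                       abs (u m - u n) < e) ->
        exists l, forall e, 0 < e -> exists N, forall n, (N <= n)%N ->
                                       abs (u n - l) < e).

(* x lies in O_M: integral over O_K = {a | abs a <= 1} *)
Definition integral (K : fieldType) (abs : K -> rat) (M : fieldExtType K) (x : M)
  : Prop :=
  exists P : {poly K},
    [/\ P \is monic, (forall i, abs P`_i <= 1) & (map_poly (in_alg M) P).[x] = 0].

Definition in_maxideal (K : fieldType) (abs : K -> rat) (M : fieldExtType K) (y : M)
  : Prop :=
  integral abs y /\ ~ (y != 0 /\ integral abs y^-1).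

(* M/K is not totally ramified, i.e. the residue field extension is
   nontrivial (f > 1, equivalently e < [M:K]): some element of O_M is not
   congruent modulo m_M to any element of O_K. *)
Definition not_totally_ramified (K : fieldType) (abs : K -> rat)
  (M : fieldExtType K) : Prop :=
  exists x : M, integral abs x /\
    forall a : K, abs a <= 1 -> ~ in_maxideal abs (x - a%:A).

(* H has K-basis e_0..e_(n-1); an element of H is its coordinate function. *)
Record hopf_data (K : fieldType) (n : nat) := HopfData {
  hmul : 'I_n -> 'I_n -> 'I_n -> K;     (* e_i e_j = sum_k hmul i j k e_k *)
  hunit : 'I_n -> K;                    (* 1_H = sum_k hunit k e_k *)
  hcomul : 'I_n -> 'I_n -> 'I_n -> K;   (* Delta e_k = sum_ij hcomul k i j e_i (x) e_j *)
  hcounit : 'I_n -> K;                  (* eps e_k = hcounit k *)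
  hanti : 'I_n -> 'I_n -> K             (* S e_i = sum_j hanti i j e_j *)
}.

Section Hopf.
Variables (K : fieldType) (n : nat) (H : hopf_data K n).

Definition mulH (a b : 'I_n -> K) : 'I_n -> K :=
  fun k => \sum_i \sum_j a i * b j * hmul H i j k.
Definition comulH (a : 'I_n -> K) : 'I_n -> 'I_n -> K :=
  fun i j => \sum_k a k * hcomul H k i j.
Definition epsH (a : 'I_n -> K) : K := \sum_i a i * hcounit H i.

Definition hopf_axioms : Prop :=
      (forall a b c k, mulH (mulH a b) c k = mulH a (mulH b c) k) /\
      (forall a k, mulH (hunit H) a k = a k /\ mulH a (hunit H) k = a k) /\
      (forall a i j l, \sum_m comulH a m l * hcomul H m i j
                       = \sum_m comulH a i m * hcomul H m j l) /\
      (forall a j, \sum_i hcounit H i * comulH a i j = a j /\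
                   \sum_i comulH a j i * hcounit H i = a j) /\
      (forall a b i j, comulH (mulH a b) i j =
          \sum_i1 \sum_i2 \sum_j1 \sum_j2
             comulH a i1 j1 * comulH b i2 j2 * hmul H i1 i2 i * hmul H j1 j2 j) /\
      (forall i j, comulH (hunit H) i j = hunit H i * hunit H j) /\
      (forall a b, epsH (mulH a b) = epsH a * epsH b /\ epsH (hunit H) = 1) /\
      (forall a k,
          \sum_i \sum_j comulH a i j * (\sum_l hanti H i l * hmul H l j k)
            = epsH a * hunit H k /\
          \sum_i \sum_j comulH a i j * (\sum_l hanti H j l * hmul H i l k)
            = epsH a * hunit H k).

Variables (M : fieldExtType K) (act : 'I_n -> 'End(M)).

Definition actH (a : 'I_n -> K) (x : M) : M := \sum_i a i *: act i x.

Definition hopf_galois_structure : Prop :=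
  hopf_axioms /\
      (forall a b x, actH (mulH a b) x = actH a (actH b x)) /\
      (forall x, actH (hunit H) x = x) /\
      (forall a x y, actH a (x * y) = \sum_i \sum_j comulH a i j *: (act i x * act j y)) /\
      (forall a, actH a 1 = epsH a *: 1) /\
      (* M (x)_K H -> End_K(M), x (x) e_i |-> (y |-> x * (e_i . y)), is injective *)
      (forall c : 'I_(\dim {:M}) -> 'I_n -> K,
          (forall y, \sum_d \sum_i c d i *: (tnth (vbasis {:M}) d * act i y) = 0) ->
          forall d i, c d i = 0) /\
      (forall f : 'End(M), exists c : 'I_(\dim {:M}) -> 'I_n -> K,
          forall y, f y = \sum_d \sum_i c d i *: (tnth (vbasis {:M}) d * act i y)).

Variable abs : K -> rat.

Definition in_assoc_order (a : 'I_n -> K) : Prop :=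
  forall x : M, integral abs x -> integral abs (actH a x).

Definition free_over_assoc_order : Prop :=
  exists (r : nat) (xs : 'I_r -> M),
    [/\ forall j, integral abs (xs j),
        (forall y, integral abs y -> exists hs : 'I_r -> 'I_n -> K,
            (forall j, in_assoc_order (hs j)) /\ y = \sum_j actH (hs j) (xs j))
      & (forall hs : 'I_r -> 'I_n -> K, (forall j, in_assoc_order (hs j)) ->
            \sum_j actH (hs j) (xs j) = 0 -> forall j i, hs j i = 0)].

End Hopf.

(* Main.v *)
Require Import Defs.
From HB Require Import structures.
From mathcomp Require Import all_boot all_order all_algebra all_fingroup all_solvable all_field.
From mathcomp Require Import zify ring.
From Stdlib Require Import Classical.
Set Implicit Arguments. Unset Strict Implicit. Unset Printing Implicit Defensive.
Import Order.TTheory GRing.Theory Num.Theory.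
Local Open Scope ring_scope.

(** Since L is not totally ramified, the rotations are the inertia group and L
    contains an unramified quadratic extension of the base, generated by a unit s
    that the reflections send to -s.  Let v be the valuation of L, with v(p) = p.
    Expanding the trace of L over the fixed field of sigma in powers of sigma - 1
    and comparing valuations shows that sigma - 1 raises by exactly 1 every
    valuation prime to p, and hence so does w = s (sigma - sigma^-1): the
    powers of such an operator, applied to a uniformizer, run through all
    valuations modulo p.

    Independence of characters turns a Hopf Galois structure H into a matrix of
    coefficients, whose columns form a set on which the Galois group acts; this
    action is the lambda map of a skew brace, and H consists of the coefficient
    functions equivariant under it.  Computing the possible actions of the
    dihedral group of order 2p exhibits sigma - 1 or w as an element omega of H
    (w alone occurs in degree p), and in degree 2p a second element u, built
    from a twisted trace with values in H, which separates the two residue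
    classes.  The elements omega^i and omega^i u form a basis of H, and they
    carry one suitable integer to an integral basis of L, which is therefore
    free of rank one over its associated order. *)

(** * Valuations *)

(** Freeness reduces to termwise integrality. Base coefficients have valuation in pZ, while omega^i
    applied to a uniformizer has valuation 1 + i, so a combination of these vectors is integral only
    if every term is. A coefficient of omega^i then has valuation a multiple of p that is at least
    -(1 + i): nonnegative for i < p - 1, but possibly -p for i = p - 1. This last case is the
    obstacle. It disappears because omega raises valuation 0 by at least 2, so omega^(p-1) maps the
    integers of L into p times the integers. In degree p the operator must commute with the
    reflection fixing E, which sigma - 1 does not; the factor s in w corrects the sign. In degree 2p
    the vectors omega^i y and omega^i (u y) have equal valuation, so only residues in the quadratic
    residue extension tell them apart; the multiplier theta of the uniformizer ensures this. The
    exact valuation of u y rests on a twist m different from 1 modulo p, which cancellation in the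
    skew brace provides. No valuation on L is given: it is that of the norm, made ultrametric by
    Hensel's lemma, then halved. *)

Section Valuation.
Variables (F : fieldType) (v : F -> int).

(* [v] is only meaningful on nonzero elements: [vge k x] is the reading of
   "the valuation of x is at least k" for which 0 has infinite valuation. *)
Definition vge (k : int) (x : F) : bool := (x == 0) || (k <= v x).

Definition is_valuation : Prop :=
  (forall x y, x != 0 -> y != 0 -> v (x * y) = v x + v y) /\
  (forall k x y, vge k x -> vge k y -> vge k (x + y)).

Hypothesis v_val : is_valuation.

Lemma valM x y : x != 0 -> y != 0 -> v (x * y) = v x + v y.
Proof. by case: v_val => h _; apply: h. Qed.

Lemma vgeD k x y : vge k x -> vge k y -> vge k (x + y).
Proof. by case: v_val => _; apply. Qed.

Lemma vge_zero k : vge k 0.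
Proof. by rewrite /vge eqxx. Qed.

Lemma vgeE k x : x != 0 -> vge k x = (k <= v x).
Proof. by rewrite /vge => /negbTE ->. Qed.

Lemma vge_refl x : vge (v x) x.
Proof. by rewrite /vge lexx orbT. Qed.

Lemma vgeW j k x : j <= k -> vge k x -> vge j x.
Proof. by move=> jk /orP[/eqP->|kx]; rewrite /vge ?eqxx // (le_trans jk) ?orbT. Qed.

Lemma val1 : v 1 = 0.
Proof. by have /eqP := valM (oner_neq0 F) (oner_neq0 F); rewrite mulr1 -subr_eq subrr eq_sym => /eqP.
Qed.

Lemma valN1 : v (-1) = 0.
Proof.
have n0 : (-1 : F) != 0 by rewrite oppr_eq0 oner_neq0.
by have := valM n0 n0; rewrite mulrNN mulr1 val1; lia.
Qed.

Lemma valN x : v (- x) = v x.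
Proof.
have [->|x0] := eqVneq x 0; first by rewrite oppr0.
by rewrite -mulN1r valM ?oppr_eq0 ?oner_neq0 // valN1 add0r.
Qed.

Lemma vgeN k x : vge k (- x) = vge k x.
Proof. by rewrite /vge oppr_eq0 valN. Qed.

Lemma vgeB k x y : vge k x -> vge k y -> vge k (x - y).
Proof. by move=> hx hy; apply: vgeD; rewrite ?vgeN. Qed.

Lemma vgeBC k x y : vge k (x - y) = vge k (y - x).
Proof. by rewrite -vgeN opprB. Qed.

Lemma vgeDl k x y : vge k x -> vge k (x + y) = vge k y.
Proof.
move=> hx; apply/idP/idP => h; last exact: vgeD.
by rewrite (_ : y = x + y - x); [apply: vgeB | ring].
Qed.

Lemma vgeDr k x y : vge k y -> vge k (x + y) = vge k x.
Proof. by rewrite addrC; apply: vgeDl. Qed.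

Lemma vgeM j k x y : vge j x -> vge k y -> vge (j + k) (x * y).
Proof.
rewrite /vge mulf_eq0; case: (eqVneq x 0) => //= x0; case: (eqVneq y 0) => //= y0.
by rewrite valM //; apply: lerD.
Qed.

Lemma vgeMl k x y : vge 0 x -> vge k y -> vge k (x * y).
Proof. by move=> hx hy; rewrite -(add0r k) vgeM. Qed.

Lemma vgeMr k x y : vge k x -> vge 0 y -> vge k (x * y).
Proof. by move=> hx hy; rewrite mulrC vgeMl. Qed.

Lemma vge_one : vge 0 1.
Proof. by rewrite vgeE ?oner_neq0 // val1. Qed.

Lemma vgeX x n : vge 0 x -> vge 0 (x ^+ n).
Proof. by move=> hx; elim: n => [|n IH]; rewrite ?vge_one // exprS vgeMl. Qed.

Lemma vge_sum k (I : Type) (r : seq I) (P : pred I) (f : I -> F) :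
  (forall i, P i -> vge k (f i)) -> vge k (\sum_(i <- r | P i) f i).
Proof. by move=> h; elim/big_ind: _ => //; [apply: vge_zero | apply: vgeD]. Qed.

Lemma vge_prod (I : Type) (r : seq I) (P : pred I) (f : I -> F) :
  (forall i, P i -> vge 0 (f i)) -> vge 0 (\prod_(i <- r | P i) f i).
Proof. by move=> h; elim/big_ind: _ => //; [apply: vge_one | apply: vgeMl]. Qed.

Lemma vge_nat n : vge 0 n%:R.
Proof. by elim: n => [|n IH]; rewrite ?vge_zero // -addn1 natrD vgeD ?vge_one. Qed.

Lemma vge_int (n : int) : vge 0 n%:~R.
Proof. by case: n => n; rewrite ?NegzE ?mulrNz ?vgeN vge_nat. Qed.

Lemma valX x n : x != 0 -> v (x ^+ n) = v x *+ n.
Proof.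
move=> x0; elim: n => [|n IH]; first by rewrite val1.
by rewrite exprS valM ?expf_neq0 // IH mulrS.
Qed.

Lemma valV x : x != 0 -> v x^-1 = - v x.
Proof.
by move=> x0; have := valM x0 (invr_neq0 x0); rewrite divff // val1; lia.
Qed.

Lemma valXz x (n : int) : x != 0 -> v (x ^ n) = n * v x.
Proof.
move=> x0; case: n => n.
  by rewrite -exprnP valX // -mulr_natl; lia.
by rewrite NegzE -exprnN valV ?expf_neq0 // valX // -mulr_natl; lia.
Qed.

Lemma val_prod (I : Type) (r : seq I) (P : pred I) (f : I -> F) :
  (forall i, P i -> f i != 0) ->
  v (\prod_(i <- r | P i) f i) = \sum_(i <- r | P i) v (f i).
Proof.
move=> h; suff [] : (\prod_(i <- r | P i) f i != 0) /\
  v (\prod_(i <- r | P i) f i) = \sum_(i <- r | P i) v (f i) by [].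
elim/big_rec2: _ => [|i y z Pi [z0 <-]]; first by rewrite oner_neq0 val1.
by rewrite mulf_neq0 ?h // valM ?h.
Qed.

Lemma val_eq k x : vge k x -> ~~ vge (k + 1) x -> x != 0 /\ v x = k.
Proof. by rewrite /vge; case: eqVneq => //= _; lia. Qed.

Lemma vgeS x : x != 0 -> vge (v x + 1) x = false.
Proof. by move=> x0; rewrite vgeE //; lia. Qed.

Lemma val_dom x y : x != 0 -> vge (v x + 1) y -> x + y != 0 /\ v (x + y) = v x.
Proof.
move=> x0 hy; apply: val_eq.
  by apply: vgeD; [apply: vge_refl | apply: vgeW hy; lia].
by rewrite vgeDr // vgeS.
Qed.

Lemma vge_eq0 x : (forall k : nat, vge k%:Z x) -> x = 0.
Proof. by move=> h; apply/eqP; have := h `|v x|.+1; rewrite /vge; case: eqP => //=; lia. Qed.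

Lemma vgeZ k c x : c != 0 -> vge (v c + k) (c * x) = vge k x.
Proof.
move=> c0; rewrite /vge mulf_eq0 (negbTE c0) /=.
by case: (eqVneq x 0) => //= x0; rewrite valM //; lia.
Qed.

Lemma vge_unit k c x : c != 0 -> v c = 0 -> vge k (c * x) = vge k x.
Proof. by move=> c0 vc; rewrite -[in LHS](add0r k) -vc vgeZ. Qed.

Lemma vge1M x y : vge 0 x -> vge 0 y -> vge 1 (x * y) -> vge 1 x \/ vge 1 y.
Proof.
rewrite /vge mulf_eq0; case: (eqVneq x 0) => /= [_|x0]; first by left.
case: (eqVneq y 0) => /= [_|y0]; first by right.
by rewrite valM // => *; case: (leP 1 (v x)) => h; [left|right] => //; lia.
Qed.

Lemma vge1_prod (I : eqType) (r : seq I) (f : I -> F) :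
  (forall i, i \in r -> vge 0 (f i)) -> vge 1 (\prod_(i <- r) f i) ->
  exists2 i, i \in r & vge 1 (f i).
Proof.
elim: r => [|i r IH] h; first by rewrite big_nil vgeE ?oner_neq0 // val1.
rewrite big_cons => /vge1M[||hi|hr].
- by apply: h; rewrite mem_head.
- by rewrite big_seq; apply: vge_prod => j jr; apply: h; rewrite inE jr orbT.
- by exists i; rewrite ?mem_head.
- have [|j jr hj] := IH _ hr; last by exists j; rewrite // inE jr orbT.
  by move=> j jr; apply: h; rewrite inE jr orbT.
Qed.

Lemma vge1X x n : vge 0 x -> vge 1 (x ^+ n) -> vge 1 x.
Proof.
move=> hx; elim: n => [|n IH]; first by rewrite vgeE ?oner_neq0 // val1.
by rewrite exprS => /vge1M[] //; apply: vgeX.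
Qed.

Lemma vgeBM k x x' y y' : vge 0 x -> vge 0 y' ->
  vge k (x - x') -> vge k (y - y') -> vge k (x * y - x' * y').
Proof.
move=> hx hy hxx hyy.
rewrite (_ : _ - _ = x * (y - y') + (x - x') * y'); last by ring.
by apply: vgeD; [apply: vgeMl | apply: vgeMr].
Qed.

Lemma vgeB_trans k x y z : vge k (x - y) -> vge k (y - z) -> vge k (x - z).
Proof. by move=> h1 h2; rewrite (_ : x - z = (x - y) + (y - z)); [apply: vgeD | ring]. Qed.

Lemma vgeBX k x y n : vge 0 x -> vge 0 y -> vge k (x - y) -> vge k (x ^+ n - y ^+ n).
Proof.
move=> hx hy h; elim: n => [|n IH]; first by rewrite subrr vge_zero.
by rewrite !exprS; apply: vgeBM => //; apply: vgeX.
Qed.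

(** The nonzero term of least valuation strictly dominates the others, so it carries the valuation
    of the whole sum. *)
Lemma vge_sum_distinct (I : finType) (t : I -> F) k :
  (forall i j, t i != 0 -> t j != 0 -> v (t i) = v (t j) -> i = j) ->
  vge k (\sum_i t i) -> forall i, vge k (t i).
Proof.
move=> inj hs i; rewrite /vge; case: eqVneq => //= ti.
case: (@Order.TotalTheory.arg_minP _ _ _ i (fun j => t j != 0) (fun j => v (t j)) ti) => j tj jmin.
apply: le_trans (jmin i ti).
have [//|s0 vs] := @val_dom (t j) (\sum_(i | i != j) t i) tj.
  apply: vge_sum => l lj; rewrite /vge; case: eqVneq => //= tl.
  have := jmin l tl; have : v (t j) != v (t l); last by lia.
  by apply: contra lj => /eqP/inj->.
by rewrite -vs -vgeE //; move: hs; rewrite (bigD1 j).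
Qed.

End Valuation.

(** Bezout writes 1 as a combination of [n] and [p]; if [n] had positive valuation, so would 1. *)
Lemma val_natr (F : fieldType) (v : F -> int) (p n : nat) :
  is_valuation v -> prime p -> vge v 1 p%:R -> ~~ (p %| n)%N ->
  n%:R != 0 :> F /\ v n%:R = 0.
Proof.
move=> vP p_pr hp pn; have n0 : (0 < n)%N by case: n pn; rewrite ?dvdn0.
apply: (val_eq (vge_nat vP n)); apply/negP => hn.
have /eqP cop : coprime n p by rewrite coprime_sym prime_coprime.
case: (egcdnP p n0) => a b; rewrite cop => abE _.
have : vge v 1 ((a * n)%N%:R : F) by rewrite natrM vgeMl // vge_nat.
rewrite abE natrD natrM vgeDl ?vgeMl ?vge_nat // => h1.
by have := vgeS v (oner_neq0 F); rewrite val1 // add0r h1.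
Qed.

(** * The normalised additive valuation of the p-adic field *)

Section Qp.
Variables (p : nat) (K : fieldType) (abs : K -> rat).
Hypotheses (p_prime : prime p) (KQp : is_Qp p abs).

Let P : rat := p%:R.
Let P0 : P != 0. Proof. by rewrite pnatr_eq0 -lt0n prime_gt0. Qed.
Let P_gt1 : 1 < P. Proof. by rewrite ltr1n prime_gt1. Qed.

Let P_inj (a b : int) : P ^ (- a) = P ^ (- b) -> a = b.
Proof. by move/ieexprIz => h; apply: oppr_inj; apply: h; rewrite ?gt_eqF // ltr0n prime_gt0. Qed.

Lemma abs0 : abs 0 = 0.
Proof. by case: KQp => _ [h _]; apply/h. Qed.

Lemma abs_neq0 x : x != 0 -> abs x != 0.
Proof. by case: KQp => _ [h _] x0; apply: contra x0 => /eqP/h ->. Qed.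

Lemma absM x y : abs (x * y) = abs x * abs y.
Proof. by case: KQp => _ [_ [h _]]. Qed.

Lemma absD x y : abs (x + y) <= Num.max (abs x) (abs y).
Proof. by case: KQp => _ [_ [_ [h _]]]. Qed.

Lemma abs_ratr q : abs (ratr q) = padic_abs p q.
Proof. by case: KQp => _ [_ [_ [_ [h _]]]]. Qed.

Lemma abs_dense x e : 0 < e -> exists q : rat, abs (x - ratr q) < e.
Proof. by case: KQp => _ [_ [_ [_ [_ [h _]]]]]; apply: h. Qed.

Lemma abs_complete (u : nat -> K) :
  (forall e, 0 < e -> exists N, forall m n, (N <= m)%N -> (N <= n)%N ->
     abs (u m - u n) < e) ->
  exists l, forall e, 0 < e -> exists N, forall n, (N <= n)%N -> abs (u n - l) < e.
Proof. by case: KQp => _ [_ [_ [_ [_ [_ h]]]]]; apply: h. Qed.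

Lemma absN x : abs (- x) = abs x.
Proof.
rewrite -mulN1r absM -[RHS]mul1r; congr (_ * _).
have -> : -1 = ratr (-1)%:~R :> K by rewrite ratr_int.
by rewrite abs_ratr /padic_abs denq_int numq_int /= logn1 divr1.
Qed.

Lemma padic_absE q : q != 0 -> exists k : int, padic_abs p q = P ^ (- k).
Proof.
move=> q0; rewrite /padic_abs (negbTE q0).
set a := logn _ _; set b := logn _ _; exists (b%:Z - a%:Z).
by rewrite opprB expfzDr // -exprnP -exprnN.
Qed.

(** A rational closer to [x] than [abs x] has the same absolute value by the ultrametric inequality.
    The disjunct [x == 0] keeps the existential total, so that [xchoose] can extract [vK]. *)
Lemma abs_pow x : exists k : int, (x == 0) || (abs x == P ^ (- k)).
Proof.
case: (eqVneq x 0) => [_|x0]; first by exists 0.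
have x_gt0 : 0 < abs x.
  by rewrite lt_neqAle eq_sym abs_neq0 //=; case: KQp.
have [q xq] := abs_dense x x_gt0.
have eq_abs : abs (ratr q) = abs x.
  apply/eqP; rewrite eq_le; apply/andP; split.
    have := absD (ratr q - x) x; rewrite subrK; move/le_trans; apply.
    by rewrite ge_max lexx andbT -absN opprB ltW.
  have := absD (x - ratr q) (ratr q); rewrite subrK le_max.
  by case/orP => // /(lt_le_trans xq); rewrite ltxx.
have q0 : q != 0.
  by apply/eqP => q0; move: x_gt0; rewrite -eq_abs q0 (ratr_nat K 0) abs0 ltxx.
by have [k kE] := padic_absE q0; exists k; rewrite -eq_abs abs_ratr kE eqxx.
Qed.

Definition vK (x : K) : int := xchoose (abs_pow x).

Lemma abs_vK x : x != 0 -> abs x = P ^ (- vK x).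
Proof.
by move=> x0; case/orP: (xchooseP (abs_pow x)) => [/eqP xE|/eqP->//]; rewrite xE eqxx in x0.
Qed.

Lemma abs_vge k x : (abs x <= P ^ (- k)) = vge vK k x.
Proof.
rewrite /vge; case: (eqVneq x 0) => [->|x0]; first by rewrite abs0 exprz_ge0 // ler0n.
by rewrite abs_vK // ler_eXz2l // lerN2.
Qed.

Lemma abs_vge0 x : (abs x <= 1) = vge vK 0 x.
Proof. by rewrite -abs_vge oppr0. Qed.

Lemma abs_vge_lt k x : (abs x < P ^ (- k)) = vge vK (k + 1) x.
Proof.
rewrite /vge; case: (eqVneq x 0) => [->|x0]; first by rewrite abs0 exprz_gt0 // ltr0n prime_gt0.
by rewrite abs_vK // ltr_eXz2l // ltrN2; lia.
Qed.

Lemma vK_valuation : is_valuation vK.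
Proof.
split=> [x y x0 y0|k x y].
  have xy0 : x * y != 0 by rewrite mulf_neq0.
  by apply: P_inj; rewrite -abs_vK // absM opprD expfzDr // -!abs_vK.
rewrite -!abs_vge => hx hy; apply: le_trans (absD x y) _.
by rewrite ge_max hx hy.
Qed.

Lemma p_neq0 : p%:R != 0 :> K.
Proof.
have -> : p%:R = ratr P :> K by rewrite ratr_nat.
apply/eqP => h; have := abs_ratr P; rewrite h abs0 /padic_abs (negbTE P0).
by move/esym/eqP; apply/negP; rewrite mulf_neq0 ?invr_neq0 // expf_neq0.
Qed.

Lemma vK_p : vK p%:R = 1.
Proof.
apply: P_inj; rewrite -abs_vK ?p_neq0 //.
have -> : p%:R = ratr P :> K by rewrite ratr_nat.
rewrite abs_ratr /padic_abs (negbTE P0) /P.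
have -> : p%:R = (p%:Z)%:~R :> rat by [].
by rewrite denq_int numq_int absz1 logn1 div1r absz_nat logn_prime // eqxx.
Qed.

Let vP := vK_valuation.

Let vge_p : vge vK 1 p%:R.
Proof. by rewrite vgeE ?p_neq0 // vK_p. Qed.

(** Density supplies a rational in the open unit ball around [c]; its denominator is prime to [p]
    and gets inverted modulo [p]. *)
Lemma residue_nat c : vge vK 0 c -> exists n : nat, vge vK 1 (c - n%:R).
Proof.
move=> c0; suff [m mP] : exists m : int, vge vK 1 (c - m%:~R).
  exists `|(m %% p)%Z|%N; apply: (vgeB_trans vP) mP _.
  have p0 : p%:Z != 0 by move: (prime_gt0 p_prime); lia.
  rewrite pmulrn gez0_abs ?modz_ge0 // {1}(divz_eq m p) rmorphD rmorphM /=.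
  by rewrite addrK (vgeMl vP) ?vge_int.
have [q] := abs_dense c (ltr01).
rewrite -[1](expr0z P) -oppr0 abs_vge_lt add0r => qP.
have q_ge0 : vge vK 0 (ratr q).
  rewrite (_ : ratr q = c - (c - ratr q)); last by ring.
  by apply: (vgeB vP) => //; apply: vgeW qP.
have [q0|q0] := eqVneq q 0; first by exists 0; move: qP; rewrite q0 (ratr_nat K 0).
(* A denominator divisible by [p] would give the reduced fraction [q] an absolute value above 1. *)
have pd : ~~ (p %| `|denq q|)%N.
  apply/negP => pd; move: q_ge0; rewrite -abs_vge0 abs_ratr /padic_abs (negbTE q0).
  have pn : coprime p `|numq q|.
    rewrite prime_coprime //; apply/negP => pn.
    have := dvdn_gcd p `|numq q| `|denq q|; rewrite pd pn (eqP (coprime_num_den q)).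
    by rewrite dvdn1 => /eqP p1; have := prime_gt1 p_prime; rewrite p1.
  rewrite (logn_coprime pn) divr1 leNgt exprn_egt1 //.
  by rewrite lognE p_prime pd absz_gt0 denq_neq0.
have [d0 vd] := val_natr vP p_prime vge_p pd.
have /eqP cop : coprime `|denq q| p by rewrite coprime_sym prime_coprime.
have dpos : (0 < `|denq q|)%N by rewrite absz_gt0 denq_neq0.
case: (egcdnP p dpos) => a b; rewrite cop => abE _.
(* [a] inverts the denominator modulo [p]. *)
exists (numq q * a); apply: (vgeB_trans vP) qP _.
have dE : (denq q)%:~R = (`|denq q|)%N%:R :> K by rewrite pmulrn absz_denq.
have -> : ratr q - (numq q * a)%:~R = - ((numq q)%:~R * b%:R * p%:R * (`|denq q|)%N%:R^-1) :> K.
  have : (a * `|denq q|)%N%:R = (b * p + 1)%N%:R :> K by rewrite abE.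
  rewrite natrM natrD natrM rmorphM /= -pmulrn /ratr dE => e.
  apply: (mulIf d0); rewrite mulrBl mulfVK // mulNr mulfVK //.
  have e' : b%:R * p%:R = a%:R * (`|denq q|)%N%:R - 1 :> K by rewrite e addrK.
  by rewrite -[_ * b%:R * _]mulrA e'; ring.
rewrite (vgeN vP); apply: (vgeMr vP); last by rewrite vgeE ?invr_eq0 // (valV vP) // vd.
by apply: (vgeMl vP) => //; apply: (vgeMl vP); rewrite ?(vge_int vP) ?(vge_nat vP).
Qed.

(** Completeness in the form used by Hensel's iteration. In an ultrametric field, bounds on
    consecutive differences already give the Cauchy property, with the same bound for the distance
    to the limit. *)
Lemma vK_complete (u : nat -> K) :
  (forall n : nat, vge vK n (u n.+1 - u n)) ->
  exists l, forall n : nat, vge vK n (u n - l).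
Proof.
move=> uP.
have uC (m n : nat) : vge vK m (u (m + n)%N - u m).
  elim: n => [|n IH]; first by rewrite addn0 subrr vge_zero.
  by rewrite addnS; apply: (vgeB_trans vP) IH; apply: vgeW (uP _); lia.
have P_unbounded e : 0 < e -> exists N : nat, P ^ (- N%:Z) < e.
  move=> e0; exists (Num.bound e^-1); rewrite -exprnN invf_plt ?posrE ?exprn_gt0 ?ltr0n ?prime_gt0 //.
  apply: lt_le_trans (archi_boundP _) _; first by rewrite invr_ge0 ltW.
  by rewrite -natrX ler_nat ltnW // ltn_expl // prime_gt1.
have [|l lP] := @abs_complete u.
  move=> e /P_unbounded[N Ne]; exists N => m n Nm Nn; apply: le_lt_trans Ne.
  rewrite abs_vge -(subnKC Nm) -(subnKC Nn); apply: (vgeB_trans vP) (uC _ _) _.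
  by rewrite vgeBC.
exists l => n; have [|N NP] := lP (P ^ (- n%:Z)); first by rewrite exprz_gt0 // ltr0n prime_gt0.
have := NP (n + N)%N (leq_addl _ _); rewrite abs_vge_lt => h.
apply: (vgeB_trans vP (y := u (n + N)%N)); first by rewrite (vgeBC vP).
by apply: vgeW h; lia.
Qed.

End Qp.

(** * Hensel factorisation of a polynomial whose degree drops under reduction *)

Section Hensel.
Variables (K : fieldType) (v : K -> int).
Hypothesis vP : is_valuation v.

Definition pge (k : int) (f : {poly K}) : Prop := forall i, vge v k f`_i.

Lemma pgeD k f g : pge k f -> pge k g -> pge k (f + g).
Proof. by move=> hf hg i; rewrite coefD (vgeD vP). Qed.

Lemma pgeN k f : pge k f -> pge k (- f).
Proof. by move=> hf i; rewrite coefN (vgeN vP). Qed.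

Lemma pgeM j k f g : pge j f -> pge k g -> pge (j + k) (f * g).
Proof. by move=> hf hg i; rewrite coefM; apply: (vge_sum vP) => l _; apply: (vgeM vP). Qed.

Lemma pgeW j k f : j <= k -> pge k f -> pge j f.
Proof. by move=> jk hf i; apply: vgeW (hf i). Qed.

Lemma pge0 k : pge k 0.
Proof. by move=> i; rewrite coef0 vge_zero. Qed.

Lemma pgeC k c : vge v k c -> pge k c%:P.
Proof. by move=> hc i; rewrite coefC; case: eqP; rewrite ?vge_zero. Qed.

(** Long division by a monic polynomial never divides coefficients, hence keeps their valuation
    bound. *)
Lemma pge_divides_monic k g f : g \is monic -> pge 0 g -> pge k f ->
  exists q r, [/\ f = q * g + r, (size r < size g)%N, pge k q & pge k r].
Proof.
move=> gm g0; have [m] := ubnP (size f); elim: m f => // m IH f fm hf.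
have [fg|gf] := ltnP (size f) (size g).
  by exists 0, f; rewrite mul0r add0r; split=> //; apply: pge0.
set d := (size f - size g)%N.
set q0 := lead_coef f *: 'X^d.
have q0k : pge k q0.
  move=> i; rewrite coefZ coefXn; case: eqP; rewrite ?mulr0 ?mulr1 ?vge_zero // => _.
  exact: hf.
have g_neq0 : g != 0 by apply: monic_neq0.
have sg : (0 < size g)%N by rewrite size_poly_gt0.
have f_neq0 : f != 0.
  by rewrite -size_poly_gt0 (leq_trans _ gf) // size_poly_gt0.
have [||q [r [fE rg qk rk]]] := IH (f - q0 * g).
- have sq : size (q0 * g) = size f.
    by rewrite /q0 -scalerAl size_scale ?lead_coef_eq0 // mulrC size_mulXn // /d subnK.
  rewrite ltnS in fm; apply: leq_trans fm; rewrite -size_poly_gt0 in f_neq0.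
  rewrite -(prednK f_neq0) ltnS; apply/leq_sizeP => j.
  rewrite coefB leq_eqVlt => /predU1P[<-|fj].
    have := monicP gm; rewrite !lead_coefE /q0 -scalerAl coefZ [_ * g]mulrC => gl.
    rewrite coefMXn /d ltnNge lead_coefE.
    have -> : ((size f).-1 - (size f - size g) = (size g).-1)%N.
      by move: gf sg; clear; lia.
    rewrite (_ : (_ <= _)%N) /= ?gl ?mulr1 ?subrr //.
    by rewrite -ltnS prednK // ltn_subrL sg f_neq0.
  by rewrite (prednK f_neq0) in fj; rewrite !nth_default ?subrr ?sq.
- by apply: pgeD => //; apply: pgeN; rewrite -(addr0 k); apply: pgeM.
by exists (q0 + q), r; split=> //; [rewrite mulrDl -addrA -fE addrC subrK | apply: pgeD].
Qed.

Lemma pge_divpm k g f : g \is monic -> pge 0 g -> pge k f ->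
  pge k (f %/ g) /\ pge k (f %% g).
Proof.
move=> gm g0 hf; have [q [r [fE rg qk rk]]] := pge_divides_monic gm g0 hf.
have g_neq0 : g != 0 by apply: monic_neq0.
have -> : f %/ g = q by rewrite fE divpD mulpK // divp_small // addr0.
by have -> : f %% g = r by rewrite fE modpD modp_mull add0r modp_small.
Qed.

Hypothesis v_complete : forall u : nat -> K,
  (forall n : nat, vge v n (u n.+1 - u n)) -> exists l, forall n : nat, vge v n (u n - l).

Variables (f : {poly K}) (d : nat).
Hypotheses (d_gt0 : (0 < d)%N) (f0 : pge 0 f) (fd_neq0 : f`_d != 0) (fd : v f`_d = 0).
Hypothesis f_high : forall i, (d < i)%N -> vge v 1 f`_i.

Let a := f`_d.

(** Modulo the maximal ideal [f] is the constant [a] times a monic polynomial of degree [d]. A lift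
    of the latter is refined by adding the remainder divided by [a], because the cofactor is
    congruent to [a]. *)
Fixpoint hensel_seq (n : nat) : {poly K} :=
  if n is m.+1 then hensel_seq m + a^-1 *: (f %% hensel_seq m)
  else \poly_(i < d.+1) (f`_i / a).

Let va : vge v 0 a^-1.
Proof. by rewrite vgeE ?invr_eq0 // valV // fd. Qed.

Lemma hensel_step n (g := hensel_seq n) :
  [/\ g \is monic, size g = d.+1, pge 0 g, pge n.+1%:Z (f %% g) & pge 1 (f %/ g - a%:P)].
Proof.
rewrite {}/g; elim: n => [|n].
  set g := hensel_seq 0.
  have sg : size g = d.+1.
    by rewrite /g /= size_poly_eq // divff ?oner_neq0.
  have gm : g \is monic.
    by rewrite monicE lead_coefE sg /g /= coef_poly ltnSn divff.
  have g0 : pge 0 g.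
    move=> i; rewrite /g /= coef_poly; case: ifP => _; last exact: vge_zero.
    by rewrite (vgeMl vP).
  have fg : pge 1 (f - a *: g).
    move=> i; rewrite coefB coefZ /g /= coef_poly ltnS; case: leqP => id.
      by rewrite mulrC mulfVK // subrr vge_zero.
    by rewrite mulr0 subr0 f_high.
  have [h1 h2] := pge_divpm gm g0 fg.
  have g_neq0 := monic_neq0 gm.
  split => //.
    by move: h2; rewrite modpD modpN modpZl modpp scaler0 oppr0 addr0.
  by move: h1; rewrite divpD divpN divpZl divpp // alg_polyC.
set g := hensel_seq n => -[gm sg g0 hr hq].
set r := f %% g in hr; set q := f %/ g in hq.
set g' := hensel_seq n.+1.
have g'E : g' = g + a^-1 *: r by [].
have sr : (size (a^-1 *: r) < size g)%N.
  by apply: leq_ltn_trans (size_scale_leq _ _) _; rewrite ltn_modp monic_neq0.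
have r'0 : pge n.+1%:Z (a^-1 *: r).
  by move=> i; rewrite coefZ (vgeMl vP).
have sg' : size g' = d.+1 by rewrite g'E size_polyDl.
have g'm : g' \is monic by rewrite monicE g'E lead_coefDl // -monicE.
have g'0 : pge 0 g' by rewrite g'E; apply: pgeD => //; apply: pgeW r'0.
have g'_neq0 := monic_neq0 g'm.
(* Replacing [g] by [g + r/a] leaves an error [(q - a) r/a] up to sign, a product of two small
   factors: one more unit of precision. *)
set e := - (q - a%:P) * (a^-1 *: r).
have fE : f = q * g' + e.
  have rE : r = a%:P * (a^-1 *: r) by rewrite mul_polyC scalerA divff // scale1r.
  by rewrite {1}(divp_eq f g) -/q -/r g'E /e {1}rE; ring.
have he : pge n.+2%:Z e.
  by rewrite -[n.+2%:Z]/(1 + n.+1%:Z); apply: pgeM => //; apply: pgeN.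
have [h1 h2] := pge_divpm g'm g'0 he.
split => //.
  by rewrite fE modpD modp_mull add0r.
rewrite {1}fE divpD mulpK // addrAC; apply: pgeD => //.
by apply: pgeW h1; lia.
Qed.

(** The approximate factors converge coefficientwise; the remainder of [f] by their limit has
    arbitrarily large valuation, so it vanishes. *)
Lemma hensel_factor : exists2 g, g %| f & size g = d.+1.
Proof.
have [l lP] : exists l : 'I_d.+1 -> K, forall (i : 'I_d.+1) (n : nat), vge v n ((hensel_seq n)`_i - l i).
  apply: (fin_all_exists (P := fun (i : 'I_d.+1) (c : K) => forall n : nat, vge v n ((hensel_seq n)`_i - c))) => i.
  apply: (v_complete (u := fun n => (hensel_seq n)`_i)) => n.
  rewrite /= coefD addrC addKr coefZ (vgeMl vP) //.
  by have [_ _ _ h _] := hensel_step n; apply: vgeW (h i); lia.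
pose g : {poly K} := \poly_(i < d.+1) l (inord i).
have gP n : pge n%:Z (hensel_seq n - g).
  move=> i; rewrite coefB coef_poly; case: ltnP => id.
    by have := lP (inord i) n; rewrite inordK.
  have [_ sg _ _ _] := hensel_step n.
  by rewrite nth_default ?sg // subrr vge_zero.
have l1 : l ord_max = 1.
  apply/eqP; rewrite eq_sym -subr_eq0; apply/eqP/(vge_eq0 (v := v)) => n.
  have := lP ord_max n; have [gm sg _ _ _] := hensel_step n.
  by have := monicP gm; rewrite lead_coefE sg /= => ->.
have sg : size g = d.+1.
  by rewrite size_poly_eq // (_ : inord d = ord_max) ?l1 ?oner_neq0 //; apply/val_inj; rewrite /= inordK.
have gm : g \is monic.
  rewrite monicE lead_coefE sg coef_poly ltnSn (_ : inord d = ord_max) ?l1 //.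
  by apply/val_inj; rewrite /= inordK.
have g0 : pge 0 g.
  have [_ _ h _ _] := hensel_step 0.
  rewrite (_ : g = hensel_seq 0 - (hensel_seq 0 - g)); last by ring.
  by apply: pgeD => //; apply: pgeN; apply: gP.
exists g => //; apply/modp_eq0P/polyP => i; rewrite coef0.
apply: (vge_eq0 (v := v)) => n.
have [hm hs h0 hr hq] := hensel_step n.
set h := hensel_seq n in hm hs h0 hr hq; set q := f %/ h in hq.
have fE : f = q * g + (q * (h - g) + f %% h).
  by rewrite addrA -mulrDr addrCA subrr addr0 -divp_eq.
have q0 : pge 0 q.
  rewrite (_ : q = (q - a%:P) + a%:P); last by rewrite subrK.
  by apply: pgeD; [apply: pgeW hq | apply: pgeC; apply: f0].
have : pge n%:Z (q * (h - g) + f %% h).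
  apply: pgeD; last by apply: pgeW hr; lia.
  by rewrite -(add0r n%:Z); apply: pgeM => //; apply: gP.
case/(pge_divpm gm g0) => _ /(_ i).
suff -> : f %% g = (q * (h - g) + f %% h) %% g by [].
by rewrite [X in X %% g = _]fE modpD modp_mull add0r.
Qed.

End Hensel.

Lemma gal_full (K : fieldType) (L : splittingFieldType K) (g : gal_of {:L}) :
  g \in 'Gal({:L} / 1%AS)%g.
Proof. by rewrite gal_kHom ?sub1v // k1AHom. Qed.

(** * Extension of the valuation to a Galois extension through the norm *)

Section GaloisValuation.
Variables (K : fieldType) (vK : K -> int) (L : splittingFieldType K).
Hypotheses (vP : is_valuation vK)
  (vK_complete : forall u : nat -> K,
     (forall n : nat, vge vK n (u n.+1 - u n)) -> exists l, forall n : nat, vge vK n (u n - l))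
  (galL : galois 1%AS {:L}).

Local Notation G := (gal_of {:L}).
Local Notation inL := (in_alg L).

Lemma gal_alg (g : G) (c : K) : g c%:A = c%:A.
Proof. by rewrite linearZ /= rmorph1. Qed.

Lemma algX (c : K) n : (c ^+ n)%:A = c%:A ^+ n :> L.
Proof. exact: (rmorphXn inL). Qed.

Lemma gal_fixed_alg x : (forall g : G, g x = x) -> exists c : K, x = c%:A.
Proof.
move=> h; have : x \in 1%VS.
  rewrite -(elimT galois_fixedField galL).
  by apply/fixedFieldP; rewrite ?memvf.
by move/vlineP => [c ->]; exists c.
Qed.

(** Meaningful only on the image of [K], where it inverts the scalar embedding. *)
Definition toK (x : L) : K := coord [tuple of [:: (1 : L)]] ord0 x.

Lemma toKE (c : K) : toK c%:A = c.
Proof.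
rewrite /toK linearZ /= -[X in coord _ _ X]/([tuple of [:: (1 : L)]]`_(@ord0 0)) coord_free ?mulr1 //.
by rewrite seq1_free oner_neq0.
Qed.

Definition nrm (x : L) : K := toK (\prod_(g : G) g x).

Lemma gal_reindex (h : G) (f : L -> L) x :
  \prod_(g : G) f (h (g x)) = \prod_(g : G) f (g x).
Proof.
rewrite [RHS](reindex_inj (mulIg h)) /=; apply: eq_bigr => g _.
by rewrite galM ?memvf.
Qed.

Lemma nrmE x : (nrm x)%:A = \prod_(g : G) g x.
Proof.
have [c cE] : exists c : K, \prod_(g : G) g x = c%:A.
  by apply: gal_fixed_alg => h; rewrite rmorph_prod (gal_reindex h id).
by rewrite /nrm cE toKE.
Qed.

Lemma alg_inj (a b : K) : a%:A = b%:A :> L -> a = b.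
Proof. by move=> h; rewrite -[a]toKE h toKE. Qed.

Lemma nrmM x y : nrm (x * y) = nrm x * nrm y.
Proof.
apply: alg_inj; rewrite -scalerA -[_ *: _%:A]mulr_algl !nrmE -big_split /=.
by apply: eq_bigr => g _; rewrite rmorphM.
Qed.

Lemma nrm1 : nrm 1 = 1.
Proof. by apply: alg_inj; rewrite nrmE big1 ?scale1r // => g _; rewrite rmorph1. Qed.

Lemma nrm_eq0 x : (nrm x == 0) = (x == 0).
Proof.
rewrite -[LHS](inj_eq alg_inj) nrmE scale0r.
apply/prodf_eq0/eqP => [[g _]|->]; last by exists 1%g; rewrite // rmorph0.
by rewrite fmorph_eq0 => /eqP.
Qed.

Lemma nrm_alg (c : K) : nrm c%:A = c ^+ #|{: G}|.
Proof.
apply: alg_inj; rewrite nrmE algX -prodr_const.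
by apply: eq_big => [g|g _]; rewrite ?inE // gal_alg.
Qed.

Lemma nrm_gal (h : G) x : nrm (h x) = nrm x.
Proof.
apply: alg_inj; rewrite !nrmE [RHS](reindex_inj (mulgI h)) /=.
by apply: eq_bigr => g _; rewrite galM ?memvf.
Qed.

Lemma minPolyK x : exists m : {poly K}, map_poly inL m = minPoly 1%AS x.
Proof. by have /polyOver1P[m ->] := minPolyOver 1%AS x; exists m. Qed.

Let Q x := \prod_(g : G) ('X - (g x)%:P).

(** A nonconstant divisor of the product has some conjugate [g x] as a root, and [g] fixes its
    coefficients. *)
Lemma root_charpoly P x : P != 0 -> P \is a polyOver 1%AS -> P %| Q x ->
  (1 < size P)%N -> root P x.
Proof.
move=> P0 P1 PQ sP; have [m Pm] := dvdp_prod_XsubC PQ.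
case E : (mask m (index_enum G)) Pm => [|g s]; rewrite ?big_nil ?big_cons => Pm.
  by move: (eqp_size Pm) sP; rewrite size_poly1 => ->.
have : root P (g x) by rewrite (eqp_root Pm) rootM root_XsubC eqxx.
rewrite /root -[P in P.[g x]](fixedPoly_gal (sub1v {:L}) (gal_full g)) //.
by rewrite horner_map fmorph_eq0.
Qed.

(** Every nonconstant divisor over the base has [x] as a root, so the minimal polynomial can be
    split off repeatedly. *)
Lemma charpoly_minPoly x : exists k, Q x = minPoly 1%AS x ^+ k.+1.
Proof.
have Q1 : Q x \is a polyOver 1%AS.
  apply/polyOverP => i.
  have /vlineP : exists c : K, (Q x)`_i = c%:A.
    apply: gal_fixed_alg => h; rewrite -coef_map; congr (_ : {poly _})`_i.
    rewrite rmorph_prod /=.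
    under eq_bigr => g _ do rewrite rmorphB /= map_polyX map_polyC /=.
    rewrite [RHS](reindex_inj (mulIg h)) /=; apply: eq_bigr => g _.
    by rewrite galM ?memvf.
  by [].
suff gen : forall n (P : {poly L}), (size P <= n)%N -> P \is monic -> P \is a polyOver 1%AS -> P %| Q x ->
    exists k, P = minPoly 1%AS x ^+ k.
  have [|||[|k] kE] := gen (size (Q x)) (Q x) (leqnn _); rewrite ?monic_prod_XsubC //; last by exists k.
  have : (Q x).[x] = 0.
    rewrite horner_prod (bigD1 1%g) //= gal_id hornerXsubC subrr mul0r //.
  by rewrite kE expr0 hornerC => /eqP; rewrite oner_eq0.
elim=> [|n IH] P sP Pm P1 PQ.
  by move: sP; rewrite leqn0 size_poly_eq0 (negbTE (monic_neq0 Pm)).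
case: (leqP (size P) 1) => sP1.
  exists 0%N; rewrite expr0; have := size1_polyC sP1 => PE.
  by move: (monicP Pm); rewrite PE lead_coefC => ->.
have mP := minPoly_dvdp P1 (root_charpoly (monic_neq0 Pm) P1 PQ sP1).
have PE := divpK mP; set P' := P %/ _ in PE.
have mm := monic_minPoly 1%AS x.
have P'm : P' \is monic by rewrite -(monicMr _ mm) PE.
have [||||k kE] := IH P'; rewrite ?divp_polyOver ?minPolyOver //.
- have sm : (1 < size (minPoly 1%AS x))%N by rewrite size_minPoly.
  rewrite -ltnS; apply: leq_trans sP; rewrite -PE size_Mmonic ?monic_neq0 //.
  move: (monic_neq0 P'm) sm; rewrite -size_poly_gt0; move: (size P') (size (minPoly 1%AS x)) => a b. lia.
- by apply: dvdp_trans PQ; rewrite -PE dvdp_mulr.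
by exists k.+1; rewrite exprSr -kE PE.
Qed.

Lemma nrm_minPoly x m : map_poly inL m = minPoly 1%AS x ->
  exists k, forall c : K, nrm (c%:A - x) = m.[c] ^+ k.+1.
Proof.
move=> mE; have [k kE] := charpoly_minPoly x; exists k => c.
apply: alg_inj; rewrite algX -[m.[c]%:A]/(inL m.[c]) -horner_map /= mE.
rewrite nrmE -horner_exp -kE horner_prod; apply: eq_bigr => g _.
by rewrite rmorphB hornerXsubC /= gal_alg.
Qed.

(** Newton polygon argument: otherwise, scaling by the last coefficient of least valuation gives a
    polynomial whose reduction has degree strictly between 0 and the full degree, and Hensel factors
    it, against irreducibility. *)
Lemma minPoly_integral x m : map_poly inL m = minPoly 1%AS x ->
  vge vK 0 m`_0 -> pge vK 0 m.
Proof.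
move=> mE m0; have mm : m \is monic by rewrite -(map_monic inL) mE monic_minPoly.
have sm : (1 < size m)%N by rewrite -(size_map_poly inL) mE size_minPoly.
have m_neq0 := monic_neq0 mm.
case: (boolP [forall i : 'I_(size m), vge vK 0 m`_i]) => [/forallP h i|].
  by case: (ltnP i (size m)) => [il|?]; [apply: (h (Ordinal il)) | rewrite nth_default ?vge_zero].
rewrite negb_forall => /existsP[i0 i0P].
have mi0 : m`_i0 != 0 by apply: contra i0P => /eqP->; apply: vge_zero.
case: (@Order.TotalTheory.arg_minP _ _ _ i0 (fun j : 'I__ => m`_j != 0) (fun j : 'I__ => vK m`_j) mi0) => j mj jmin.
have kj : vK m`_j < 0.
  by apply: le_lt_trans (jmin _ mi0) _; move: i0P; rewrite /vge negb_or ltNge => /andP[].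
have jP : (m`_j != 0) && (vK m`_j == vK m`_j) by rewrite mj eqxx.
(* [d] is the largest index of least valuation: positive because the constant term is integral,
   below the degree because [m] is monic. *)
case: (@arg_maxnP _ j (fun i : 'I__ => (m`_i != 0) && (vK m`_i == vK m`_j)) (fun i : 'I__ => i : nat) jP) => d /andP[md /eqP vd] dmax.
have d0 : (0 < d)%N.
  rewrite lt0n; apply/eqP => dE; move: kj; rewrite -vd dE ltNge -(vgeE _ _ (x := m`_0)) ?m0 //.
  by rewrite -[0%N]dE.
have dm : (d.+1 < size m)%N.
  rewrite ltn_neqAle ltn_ord andbT; apply/eqP => dE.
  have md1 : m`_d = 1 by rewrite -(monicP mm) lead_coefE; congr (_`__); rewrite -[nat_of_ord d]/(d.+1.-1) dE.
  by move: kj; rewrite -vd md1 (val1 vP).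
have high k : (d < k)%N -> vge vK (vK m`_d + 1) m`_k.
  move=> dk; rewrite /vge; case: eqVneq => //= mk.
  have ks : (k < size m)%N by rewrite ltnNge; apply: contra mk => /leq_sizeP/(_ k (leqnn k))->.
  have := jmin (Ordinal ks) mk; rewrite vd /= le_eqVlt => /predU1P[vk|]; last by lia.
  have := dmax (Ordinal ks); rewrite /= mk -vk eqxx => /(_ isT).
  by rewrite leqNgt dk.
have all k : vge vK (vK m`_d) m`_k.
  rewrite /vge; case: eqVneq => //= mk.
  have ks : (k < size m)%N by rewrite ltnNge; apply: contra mk => /leq_sizeP/(_ k (leqnn k))->.
  by rewrite vd; apply: (jmin (Ordinal ks) mk).
have mdV : (m`_d)^-1 != 0 by rewrite invr_eq0.
have [|||||g gdvd sg] := @hensel_factor K vK vP vK_complete ((m`_d)^-1 *: m) d.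
- exact: d0.
- by move=> k; rewrite coefZ -(addNr (vK m`_d)) -(valV vP) // (vgeZ vP).
- by rewrite coefZ mulVf ?oner_neq0.
- by rewrite coefZ mulVf ?(val1 vP).
- move=> k dk; rewrite coefZ (_ : 1 = vK (m`_d)^-1 + (vK m`_d + 1)).
    by rewrite (vgeZ vP) // high.
  by rewrite (valV vP) //; ring.
have gm : g %| m by rewrite -(dvdpZr _ _ mdV).
have := @minPoly_irr K L 1%AS x (map_poly inL g).
rewrite -mE dvdp_map gm => /(_ _ isT)/orP[|/eqp_size|/eqp_size].
- by apply/polyOver1P; exists g.
- by rewrite !size_map_poly sg => e; rewrite e ltnn in dm.
- by rewrite size_map_poly sg size_poly1 => -[e]; rewrite e in d0.
Qed.

(** Not divided by the degree, which keeps it integer valued: on the base it is the group order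
    times [vK]. *)
Definition vL (x : L) : int := vK (nrm x).

Lemma vge_nrm0 x : vge vL 0 x = vge vK 0 (nrm x).
Proof. by rewrite /vge nrm_eq0. Qed.

Lemma vge_nrm_minPoly x m : map_poly inL m = minPoly 1%AS x ->
  vge vL 0 (- x) -> pge vK 0 m.
Proof.
rewrite vge_nrm0 => mE h; apply: (minPoly_integral mE); have [k kE] := nrm_minPoly mE.
move: h; have := kE 0; rewrite scale0r sub0r horner_coef0 => ->.
rewrite /vge expf_eq0 /=; case: eqVneq => //= m0.
rewrite (valX vP) // -mulr_natl; nia.
Qed.

Lemma vge_pgehorner m c : pge vK 0 m -> vge vK 0 c -> vge vK 0 m.[c].
Proof.
move=> hm hc; rewrite horner_coef; apply: (vge_sum vP) => i _.
by apply: (vgeMl vP) => //; apply: (vgeX vP).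
Qed.

(** The norm of [1 + x] is a power of the value at 1 of the minimal polynomial of [- x], whose
    coefficients are integral. This is the ultrametric inequality up to scaling. *)
Lemma vL_add1 x : vge vL 0 x -> vge vL 0 (1 + x).
Proof.
have [m mE] := minPolyK (- x) => x0.
have hm : pge vK 0 m by apply: (vge_nrm_minPoly mE); rewrite opprK.
have [k kE] := nrm_minPoly mE.
have := kE 1; rewrite scale1r opprK vge_nrm0 => ->.
apply: (vgeX vP); apply: vge_pgehorner => //; exact: vge_one.
Qed.

Lemma vL_valuation : is_valuation vL.
Proof.
have vM x y : x != 0 -> y != 0 -> vL (x * y) = vL x + vL y.
  by move=> x0 y0; rewrite /vL nrmM (valM vP) ?nrm_eq0.
split=> // k x y; have [->|x0] := eqVneq x 0; first by rewrite add0r.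
have [->|y0] := eqVneq y 0; first by rewrite addr0.
wlog xy : x y x0 y0 / vL x <= vL y.
  move=> h; case: (leP (vL x) (vL y)) => [|/ltW] xy; first exact: h.
  by rewrite addrC => hx hy; apply: h.
move=> hx hy; rewrite vgeE // in hx; rewrite vgeE // in hy.
have : vge vL 0 (1 + y / x).
  apply: vL_add1; rewrite vgeE ?mulf_neq0 ?invr_eq0 //.
  have := vM (y / x) x; rewrite mulfVK // mulf_neq0 ?invr_eq0 // => /(_ isT x0); lia.
have -> : x + y = x * (1 + y / x) by rewrite mulrDr mulr1 mulrC mulfVK.
rewrite /vge mulf_eq0 (negbTE x0) /=; case: eqVneq => //= n0 h.
by rewrite vM //; lia.
Qed.

Lemma vL_gal (g : G) x : vL (g x) = vL x.
Proof. by rewrite /vL nrm_gal. Qed.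

Lemma vL_alg (c : K) : c != 0 -> vL c%:A = vK c *+ #|{: G}|.
Proof. by move=> c0; rewrite /vL nrm_alg (valX vP). Qed.

Lemma vge_alg0 (c : K) : vge vL 0 c%:A = vge vK 0 c.
Proof.
rewrite vge_nrm0 nrm_alg /vge expf_eq0.
have g0 : (0 < #|{: G}|)%N by apply/card_gt0P; exists 1%g.
rewrite g0 /=; case: eqVneq => //= c0.
rewrite (valX vP) // -mulr_natl; nia.
Qed.

(** One way, the minimal polynomial is a witness; the other way, if [x] had negative valuation its
    top power would dominate a monic integral relation. *)
Lemma vL_integral (abs : K -> rat) x : (forall c, (abs c <= 1) = vge vK 0 c) ->
  integral abs x <-> vge vL 0 x.
Proof.
move=> abs_v; split; last first.
  move=> x0; have [m mE] := minPolyK x; exists m; split.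
  - by rewrite -(map_monic inL) mE monic_minPoly.
  - by move=> i; rewrite abs_v; apply: (vge_nrm_minPoly mE); rewrite (vgeN vL_valuation).
  - by rewrite mE; apply/rootP/root_minPoly.
case=> P [Pm Pi Px]; case: (boolP (vge vL 0 x)) => //; rewrite /vge negb_or -ltNge => /andP[x0 vx].
have vLP := vL_valuation.
move: Px; rewrite horner_coef size_map_poly.
have := monicP Pm; have := monic_neq0 Pm; rewrite -size_poly_gt0 lead_coefE.
case: (size P) => // n _ /= Pn.
rewrite big_ord_recr /= coef_map /= Pn scale1r mul1r addrC.
have xn0 : x ^+ n != 0 by rewrite expf_neq0.
have [|h _] := val_dom vLP (y := \sum_(i < n) (map_poly inL P)`_i * x ^+ i) xn0; last first.
  by move=> e; rewrite e eqxx in h.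
apply: (vge_sum vLP) => i _; rewrite coef_map; apply: (vgeMl vLP).
  by rewrite vge_alg0 -abs_v.
rewrite vgeE ?expf_neq0 // (valX vLP n x0) (valX vLP i x0).
rewrite -[vL x *+ n]mulr_natl -[vL x *+ i]mulr_natl !natz.
move: vx (ltn_ord i); move: (i : nat) (vL x) => j a; clear=> a0 /subnKC <-.
move: (n - j.+1)%N => k; have : k%:Z * a <= 0 by rewrite mulr_ge0_le0 // ltW.
rewrite PoszD -addn1 PoszD !mulrDl mul1r; move: (k%:Z * a) (j%:Z * a) => y z; lia.
Qed.

End GaloisValuation.

Lemma prod_nat_shift (R : comPzRingType) (F : nat -> R) n :
  F n = F 0%N -> \prod_(i < n) F i.+1 = \prod_(i < n) F i.
Proof.
case: n => [|n] Fn; first by rewrite !big_ord0.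
by rewrite [RHS]big_ord_recl [LHS]big_ord_recr /= Fn mulrC.
Qed.

Lemma sum_nat_shift (R : nmodType) (F : nat -> R) n :
  F n = F 0%N -> \sum_(i < n) F i.+1 = \sum_(i < n) F i.
Proof.
case: n => [|n] Fn; first by rewrite !big_ord0.
by rewrite [RHS]big_ord_recl [LHS]big_ord_recr /= Fn addrC.
Qed.

(** Both polynomials reduce to the product of all ['X - a] over ['F_p], so the coefficients of their
    integer difference are divisible by [p]. *)
Lemma prod_XsubC_Fp p : prime p -> exists D : {poly int},
  \prod_(i < p) ('X - (i%:Z)%:P) - ('X^p - 'X) = p%:Z *: D.
Proof.
move=> p_pr; set E := _ - _.
have E0 : map_poly (intr : int -> 'F_p) E = 0.
  rewrite /E !rmorphB /= rmorph_prod map_polyXn map_polyX.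
  have := finField_genPoly 'F_p; rewrite card_Fp // => ->; apply/eqP; rewrite subr_eq0; apply/eqP.
  rewrite -(big_mkord xpredT (fun i => map_poly (intr : int -> 'F_p) ('X - i%:Z%:P))).
  rewrite -[in X in index_iota _ X](Fp_cast p_pr) big_mkord; apply: eq_bigr => i _.
  by rewrite rmorphB /= map_polyX map_polyC /= -pmulrn natr_Zp.
exists (\poly_(i < size E) (E`_i %/ p)%Z); apply/polyP => i.
rewrite coefZ coef_poly; case: ltnP => iE; last by rewrite mulr0 nth_default.
rewrite mulrC divzK //; have pc : p \in [pchar 'F_p] by apply: pchar_Fp.
by rewrite (dvdz_pcharf pc) -coef_map /= E0 coef0.
Qed.

(** * Ramification in dihedral extensions *)

Section ResidueChar.
Variables (p : nat) (L : fieldType) (v : L -> int).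
Hypotheses (p_pr : prime p) (vP : is_valuation v) (hp : vge v 1 p%:R).

Lemma vge_dvdn n : (p %| n)%N -> vge v 1 (n%:R : L).
Proof. by case/dvdnP=> k ->; rewrite natrM (vgeMl vP) ?(vge_nat vP). Qed.

Lemma natr_congr m n : m = n %[mod p] -> vge v 1 (m%:R - n%:R : L).
Proof.
wlog mn : m n / (n <= m)%N => [h|].
  case: (leqP n m) => [|/ltnW] mn e; first exact: h.
  by rewrite (vgeBC vP); apply: h.
by move/eqP; rewrite eqn_mod_dvd // -natrB //; apply: vge_dvdn.
Qed.

Lemma frob_add x y : vge v 0 x -> vge v 0 y ->
  vge v 1 ((x + y) ^+ p - (x ^+ p + y ^+ p)).
Proof.
move=> hx hy; rewrite exprDn.
have := prime_gt0 p_pr; case E : p => [//|p'] _.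
rewrite big_ord_recl big_ord_recr /= bin0 binn subn0 subnn expr0 mulr1 mul1r !mulr1n.
rewrite (_ : _ - _ = \sum_(i < p') x ^+ (p'.+1 - i.+1) * y ^+ i.+1 *+ 'C(p'.+1, i.+1)); last by ring.
apply: (vge_sum vP) => i _; rewrite -mulr_natr; apply: (vgeMl vP).
  by apply: (vgeMl vP); apply: (vgeX vP).
by apply: vge_dvdn; rewrite -E prime_dvd_bin // E /= ltnS.
Qed.

Lemma frob_sum (I : finType) (f : I -> L) : (forall i, vge v 0 (f i)) ->
  vge v 1 ((\sum_i f i) ^+ p - \sum_i f i ^+ p).
Proof.
move=> hf; suff [] : vge v 0 (\sum_i f i) /\ vge v 1 ((\sum_i f i) ^+ p - \sum_i f i ^+ p) by [].
elim/big_rec2: _ => [|i y x _ [hx hxy]].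
  by rewrite expr0n gtn_eqF ?prime_gt0 // subrr !vge_zero.
split; first exact: (vgeD vP).
apply: (vgeB_trans vP (frob_add (hf i) hx)).
by rewrite (_ : _ - _ = x ^+ p - y); last by ring.
Qed.

Lemma natr_frob (n : nat) : vge v 1 (n%:R ^+ p - n%:R : L).
Proof. by rewrite -natrX; apply/natr_congr/fermat_little. Qed.

Lemma vge_congr0 x n : vge v 1 (x - n%:R) -> vge v 0 x.
Proof.
move=> h; rewrite -(subrK n%:R x) (vgeD vP) ?(vge_nat vP) //; exact: vgeW h.
Qed.

Lemma frob_congr x n : vge v 1 (x - n%:R) -> vge v 1 (x ^+ p - x).
Proof.
move=> h; have x0 := vge_congr0 h.
apply: (vgeB_trans vP (y := n%:R ^+ p)); first by apply: (vgeBX vP); rewrite ?(vge_nat vP).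
by apply: (vgeB_trans vP (natr_frob n)); rewrite (vgeBC vP).
Qed.

(** Up to multiples of [p], [a ^+ p - a] is the product of the [a - i] for [i < p]; one factor must
    lie in the maximal ideal. *)
Lemma frob_fixed_natr a : vge v 0 a -> vge v 1 (a ^+ p - a) ->
  exists n : nat, vge v 1 (a - n%:R).
Proof.
move=> a0 ap; have [D DE] := prod_XsubC_Fp p_pr.
have := congr1 (fun P => (map_poly (intr : int -> L) P).[a]) DE.
rewrite /= !rmorphB /= rmorph_prod map_polyXn map_polyX map_polyZ !hornerE horner_prod => e.
have : vge v 1 (\prod_(i < p) (a - (i : nat)%:R)).
  have -> : \prod_(i < p) (a - (i : nat)%:R) = p%:R * (map_poly (intr : int -> L) D).[a] + (a ^+ p - a).
    rewrite -[p%:R]/((p%:Z)%:~R : L) -e subrK; apply: eq_bigr => i _.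
    by rewrite rmorphB /= map_polyX map_polyC hornerXsubC.
  apply: (vgeD vP) => //; apply: (vgeMr vP) => //.
  rewrite horner_coef; apply: (vge_sum vP) => i _.
  by rewrite coef_map /= (vgeMl vP) ?(vge_int vP) ?(vgeX vP).
case/(vge1_prod vP) => [i _|i _ hi]; last by exists i.
by rewrite (vgeB vP) ?(vge_nat vP).
Qed.

Lemma natr_inv n : ~~ (p %| n)%N -> exists k : nat, vge v 1 (n%:R * k%:R - 1 : L).
Proof.
move=> pn; have n0 : (0 < n)%N by case: n pn; rewrite ?dvdn0.
have /eqP cop : coprime n p by rewrite coprime_sym prime_coprime.
case: (egcdnP p n0) => a b; rewrite cop => abE _; exists a.
by rewrite -natrM mulnC abE; apply: (natr_congr (n := 1)); rewrite modnMDl.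
Qed.

Lemma vge_natr_div x y (m n : nat) : ~~ (p %| n)%N -> vge v 0 x ->
  vge v 1 (y - m%:R) -> vge v 1 (x * n%:R - y) -> exists k : nat, vge v 1 (x - k%:R).
Proof.
move=> pn x0 ym xy; have [j jP] := natr_inv pn; exists (m * j)%N.
have xm : vge v 1 (x * n%:R - m%:R) by apply: (vgeB_trans vP) xy ym.
rewrite (_ : _ - _ = (x * n%:R - m%:R) * j%:R - x * (n%:R * j%:R - 1)); last by rewrite natrM; ring.
by apply: (vgeB vP); [apply: (vgeMr vP) => //; apply: (vge_nat vP) | apply: (vgeMl vP)].
Qed.

Lemma vgeB_prod (I : Type) (r : seq I) (f g : I -> L) :
  (forall i, vge v 0 (f i)) -> (forall i, vge v 0 (g i)) ->
  (forall i, vge v 1 (f i - g i)) -> vge v 1 (\prod_(i <- r) f i - \prod_(i <- r) g i).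
Proof.
move=> hf hg hfg; elim: r => [|i r IH]; first by rewrite !big_nil subrr vge_zero.
by rewrite !big_cons; apply: (vgeBM vP) => //; apply: (vge_prod vP).
Qed.

End ResidueChar.

Section MorphismValuation.
Variables (L : fieldType) (v : L -> int) (f : {rmorphism L -> L}).
Hypotheses (vP : is_valuation v) (vf : forall x, v (f x) = v x).

Lemma vge_mor k x : vge v k (f x) = vge v k x.
Proof. by rewrite /vge fmorph_eq0 vf. Qed.

Lemma vge_morB k x y : vge v k (f x - f y) = vge v k (x - y).
Proof. by rewrite -rmorphB vge_mor. Qed.

Lemma vge_iter k i x : vge v k (iter i f x) = vge v k x.
Proof. by elim: i => //= i IH; rewrite vge_mor. Qed.

Lemma iter_eq0 i x : (iter i f x == 0) = (x == 0).
Proof. by elim: i => //= i IH; rewrite fmorph_eq0. Qed.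

Lemma val_iter i x : v (iter i f x) = v x.
Proof. by elim: i => //= i IH; rewrite vf. Qed.

Lemma iter_mor_mul i x y : iter i f (x * y) = iter i f x * iter i f y.
Proof. by elim: i => //= i ->; rewrite rmorphM. Qed.

Lemma iter_mor_add i x y : iter i f (x + y) = iter i f x + iter i f y.
Proof. by elim: i => //= i ->; rewrite rmorphD. Qed.

Lemma iter_mor_sub i x y : iter i f (x - y) = iter i f x - iter i f y.
Proof. by elim: i => //= i ->; rewrite rmorphB. Qed.

Lemma vge_iterB k i x : vge v k (f x - x) -> vge v k (iter i f x - x).
Proof.
move=> h; elim: i => [|i IH]; first by rewrite subrr vge_zero.
by rewrite iterS; apply: (vgeB_trans vP) h; rewrite vge_morB.
Qed.

End MorphismValuation.

(** * The dihedral action on the residue field *)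

Section ResidueAction.
Variables (p : nat) (L : fieldType) (v : L -> int) (sigma : {rmorphism L -> L}).
Hypotheses (p_pr : prime p) (p_odd : odd p) (vP : is_valuation v) (hp : vge v 1 p%:R).
Hypothesis v_sigma : forall x, v (sigma x) = v x.
Hypothesis sigma_p : forall x, iter p sigma x = x.

Lemma iter_mulp l x : iter (l * p) sigma x = x.
Proof. by elim: l => // l IH; rewrite mulSn iterD IH sigma_p. Qed.

Section Reflection.
Variable tau : {rmorphism L -> L}.
Hypothesis v_tau : forall x, v (tau x) = v x.
Hypothesis tau2 : forall x, tau (tau x) = x.
Hypothesis sts : forall x, sigma (tau (sigma x)) = tau x.
Hypothesis fixed_residue : forall c, sigma c = c -> tau c = c -> vge v 0 c ->
  exists n : nat, vge v 1 (c - n%:R).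

Lemma sigma_tau_fixed c : sigma c = c -> sigma (tau c) = tau c.
Proof. by move=> h; rewrite -[in LHS]h sts. Qed.

Lemma tau_iter i x : (i <= p)%N -> tau (iter i sigma x) = iter (p - i) sigma (tau x).
Proof.
move=> ip.
have e : iter i sigma (tau (iter i sigma x)) = tau x.
  by elim: i {ip} => // i IH; rewrite [LHS]iterSr iterS sts IH.
by rewrite -e -iterD subnK // sigma_p.
Qed.

Lemma dvd2_lt : ~~ (p %| 2)%N.
Proof.
by apply/negP => /(dvdn_leq (isT : 0 < 2)%N); have := prime_gt1 p_pr; case: p p_odd => [|[|[]]].
Qed.

Lemma conj_prod_fixed x : sigma (\prod_(i < p) iter i sigma x) = \prod_(i < p) iter i sigma x.
Proof. by rewrite rmorph_prod -(prod_nat_shift (F := fun i => iter i sigma x)). Qed.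

(* If x is fixed by sigma and tau modulo the maximal ideal, then
   N(x) + tau N(x) is congruent to 2 x^p, where N(x) is the product of the
   conjugates of x under sigma. *)
Lemma residue_fixed x : vge v 0 x -> vge v 1 (sigma x - x) -> vge v 1 (tau x - x) ->
  exists n : nat, vge v 1 (x - n%:R).
Proof.
move=> x0 sx tx; pose a := \prod_(i < p) iter i sigma x.
have ax : vge v 1 (a - x ^+ p).
  rewrite -[in x ^+ p](card_ord p) -prodr_const; apply: (vgeB_prod vP) => i; rewrite ?vge_iter //.
  exact: (vge_iterB vP v_sigma).
have a0 : vge v 0 a by apply: (vge_prod vP) => i _; rewrite vge_iter.
have sa : sigma a = a by apply: conj_prod_fixed.
have [||| n nP] := fixed_residue (c := a + tau a).
- by rewrite rmorphD sa sigma_tau_fixed.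
- by rewrite rmorphD tau2 addrC.
- by apply: (vgeD vP); rewrite ?(vge_mor v_tau).
have ta : vge v 1 (tau a - x ^+ p).
  apply: (vgeB_trans vP (y := tau x ^+ p)); first by rewrite -rmorphXn (vge_morB v_tau).
  by apply: (vgeBX vP); rewrite ?(vge_mor v_tau).
have [m mP] : exists m : nat, vge v 1 (x ^+ p - m%:R).
  apply: (vge_natr_div p_pr vP hp dvd2_lt (vgeX vP p x0) nP).
  rewrite (_ : _ - _ = - ((a - x ^+ p) + (tau a - x ^+ p))); last by ring.
  by rewrite (vgeN vP); apply: (vgeD vP).
exists m; apply: (@vge1X _ _ vP _ p); first by rewrite (vgeB vP) ?(vge_nat vP).
have := frob_add p_pr vP hp (vgeB vP x0 (vge_nat vP m)) (vge_nat vP m).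
rewrite subrK => h.
rewrite (_ : (x - m%:R) ^+ p = (x ^+ p - m%:R) - (m%:R ^+ p - m%:R) -
   (x ^+ p - ((x - m%:R) ^+ p + m%:R ^+ p))); last by ring.
by apply: (vgeB vP) => //; apply: (vgeB vP) => //; apply: (natr_frob p_pr vP hp).
Qed.

(* The Frobenius image a^p is congruent to some conjugate sigma^i a; applying
   tau shows it is also congruent to sigma^(-i) a, which forces i = 0 unless
   sigma a is congruent to a. *)
Lemma residue_tau_fixed a : vge v 0 a -> tau a = a -> vge v 1 (sigma a - a).
Proof.
move=> a0 ta; pose Q := \prod_(i < p) ('X - (iter i sigma a)%:P).
have iter_ge i : vge v 0 (iter i sigma a) by rewrite vge_iter.
have Qint : pge v 0 Q.
  rewrite /Q; elim/big_rec: _ => [|i P _ hP]; first by apply: pgeC; apply: vge_one.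
  rewrite -[0 : int]addr0; apply: pgeM => //; apply: pgeD => //.
    by move=> j; rewrite coefX; case: eqP; rewrite ?vge_one ?vge_zero.
  by apply: pgeN => //; apply: pgeC.
have Qs j : sigma Q`_j = Q`_j.
  rewrite -coef_map rmorph_prod /=; congr (_ : {poly L})`_j.
  rewrite -[RHS](prod_nat_shift (F := fun i => 'X - (iter i sigma a)%:P)) ?sigma_p //.
  by apply: eq_bigr => i _; rewrite rmorphB /= map_polyX map_polyC.
have Qt j : tau Q`_j = Q`_j.
  rewrite -coef_map rmorph_prod /=; congr (_ : {poly L})`_j.
  rewrite [RHS](reindex_inj rev_ord_inj) /=.
  rewrite -[LHS](prod_nat_shift (F := fun i => map_poly tau ('X - (iter i sigma a)%:P))) ?sigma_p //.
  apply: eq_bigr => i _; rewrite rmorphB /= map_polyX map_polyC /=.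
  by rewrite -[sigma (iter i sigma a)]/(iter i.+1 sigma a) tau_iter ?ta // ltn_ord.
have Qres j : vge v 1 (Q`_j ^+ p - Q`_j).
  have [n nP] := fixed_residue (Qs j) (Qt j) (Qint j).
  exact: (frob_congr p_pr vP hp nP).
have Qa : Q.[a] = 0.
  rewrite /Q horner_prod; have p0 := prime_gt0 p_pr.
  by rewrite (bigD1 (Ordinal p0)) //= hornerXsubC subrr mul0r.
have Qap : vge v 1 Q.[a ^+ p].
  have h : vge v 1 (Q.[a] ^+ p - Q.[a ^+ p]).
    rewrite !horner_coef.
    have hi (i : 'I_(size Q)) : vge v 0 (Q`_i * a ^+ i) by rewrite (vgeMl vP) ?(vgeX vP) ?Qint.
    apply: (vgeB_trans vP (frob_sum p_pr vP hp hi)).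
    rewrite -sumrB; apply: (vge_sum vP) => i _.
    rewrite exprMn -exprM mulnC exprM -mulrBl (vgeMr vP) ?Qres // !(vgeX vP) //.
  by move: h; rewrite Qa expr0n gtn_eqF ?prime_gt0 // sub0r (vgeN vP).
move: Qap; rewrite /Q horner_prod => /(vge1_prod vP)[i _|i _].
  by rewrite hornerXsubC (vgeB vP) ?(vgeX vP).
rewrite hornerXsubC => ai.
have [i0|i0] := posnP i.
  have [n nP] : exists n : nat, vge v 1 (a - n%:R).
    by apply: (frob_fixed_natr p_pr vP) => //; move: ai; rewrite i0.
  apply: (vgeB_trans vP (y := n%:R)); last by rewrite (vgeBC vP).
  by rewrite -(rmorph_nat sigma) (vge_morB v_sigma).
have ip := ltn_ord i.
have ai' : vge v 1 (a ^+ p - iter (p - i) sigma a).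
  by rewrite -[in iter _ _ _]ta -tau_iter ?(ltnW ip) // -[in a ^+ p]ta -rmorphXn (vge_morB v_tau).
have sii : vge v 1 (iter (i + i) sigma a - a).
  have e : a = iter i sigma (iter (p - i) sigma a) by rewrite -iterD subnKC ?sigma_p // ltnW.
  rewrite iterD [X in _ - X]e -iter_mor_sub vge_iter //.
  by apply: (vgeB_trans vP) ai'; rewrite (vgeBC vP).
have np : ~~ (p %| i + i)%N.
  rewrite addnn -mul2n Euclid_dvdM // negb_or dvd2_lt.
  by apply/negP => /(dvdn_leq i0); rewrite leqNgt ip.
have n0 : (0 < i + i)%N by rewrite addn_gt0 i0.
have /eqP cop : coprime (i + i) p by rewrite coprime_sym prime_coprime.
case: (egcdnP p n0) => k l; rewrite cop => klE _.
have sk : vge v 1 (iter (k * (i + i)) sigma a - a).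
  elim: k {klE} => [|k IH]; first by rewrite mul0n subrr vge_zero.
  by rewrite mulSn iterD; apply: (vgeB_trans vP) sii; rewrite -iter_mor_sub vge_iter.
by move: sk; rewrite klE addn1 iterS iter_mulp.
Qed.

End Reflection.
Variable tau : {rmorphism L -> L}.
Hypothesis v_tau : forall x, v (tau x) = v x.
Hypothesis tau2 : forall x, tau (tau x) = x.
Hypothesis sts : forall x, sigma (tau (sigma x)) = tau x.
Hypothesis fixed_residue : forall c, sigma c = c -> tau c = c -> vge v 0 c ->
  exists n : nat, vge v 1 (c - n%:R).

Let tau' : {rmorphism L -> L} := (sigma \o tau).

Let v_tau' x : v (tau' x) = v x. Proof. by rewrite /= v_sigma v_tau. Qed.
Let tau'2 x : tau' (tau' x) = x. Proof. by rewrite /= sts tau2. Qed.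
Let sts' x : sigma (tau' (sigma x)) = tau' x. Proof. by rewrite /= sts. Qed.
Let fixed_residue' c : sigma c = c -> tau' c = c -> vge v 0 c ->
  exists n : nat, vge v 1 (c - n%:R).
Proof.
move=> sc tc; apply: fixed_residue => //.
by rewrite -sts sc; exact: tc.
Qed.

Let tau_sum_residue (r : {rmorphism L -> L}) :
  (forall x, v (r x) = v x) -> (forall x, r (r x) = x) ->
  (forall x, sigma (r (sigma x)) = r x) ->
  (forall c, sigma c = c -> r c = c -> vge v 0 c -> exists n : nat, vge v 1 (c - n%:R)) ->
  forall x, vge v 0 x -> (exists n : nat, vge v 1 (x + r x - n%:R)) /\
    exists n : nat, vge v 1 (x * r x - n%:R).
Proof.
move=> vr r2 srs res x x0.
have fixed c : vge v 0 c -> r c = c -> exists n : nat, vge v 1 (c - n%:R).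
  move=> c0 rc; apply: (residue_fixed vr) => //; last by rewrite rc subrr vge_zero.
  exact: (residue_tau_fixed vr srs res c0 rc).
split; apply: fixed.
- by apply: (vgeD vP); rewrite ?(vge_mor vr).
- by rewrite rmorphD r2 addrC.
- by apply: (vgeMl vP); rewrite ?(vge_mor vr).
- by rewrite rmorphM r2 mulrC.
Qed.

(* Modulo the maximal ideal, x + r x and x * r x are integers for the two
   reflections r = tau and r = sigma tau, so x is a root of two monic integral
   quadratics; either these coincide or x is itself an integer. *)
Let residue_dichotomy x : vge v 0 x ->
  (exists n : nat, vge v 1 (x - n%:R)) \/ vge v 1 (sigma (tau x) - tau x).
Proof.
move=> x0.
have [[c1 c1P] [n1 n1P]] := tau_sum_residue v_tau tau2 sts fixed_residue x0.
have [[c2 c2P] [n2 n2P]] := tau_sum_residue v_tau' tau'2 sts' fixed_residue' x0.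
rewrite /= in c2P n2P.
(* [p.-1] serves as -1 modulo [p], so that residues stay natural numbers. *)
have neg_natr (m n : nat) : vge v 1 ((m + p.-1 * n)%N%:R - (m%:R - n%:R)).
  have -> : (m + p.-1 * n)%N%:R - (m%:R - n%:R) = p%:R * n%:R :> L.
    have p1 : p.-1%:R = p%:R - 1 :> L by rewrite -{2}(prednK (prime_gt0 p_pr)) -natr1 addrK.
    by rewrite natrD natrM p1; ring.
  by apply: (vgeMr vP) => //; apply: (vge_nat vP).
have xc1 : vge v 1 (x * c1%:R - (x ^+ 2 + n1%:R)).
  rewrite (_ : _ - _ = (x * tau x - n1%:R) - x * (x + tau x - c1%:R)); last by ring.
  by apply: (vgeB vP) => //; apply: (vgeMl vP).
have xc2 : vge v 1 (x * c2%:R - (x ^+ 2 + n2%:R)).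
  rewrite (_ : _ - _ = (x * sigma (tau x) - n2%:R) - x * (x + sigma (tau x) - c2%:R)); last by ring.
  by apply: (vgeB vP) => //; apply: (vgeMl vP).
have [pn|pn] := boolP (p %| c1 + p.-1 * c2)%N; [right|left].
  rewrite (_ : _ - _ = (x + sigma (tau x) - c2%:R) - (x + tau x - c1%:R)
    + (((c1 + p.-1 * c2)%N%:R - (c1%:R - c2%:R)) - (c1 + p.-1 * c2)%N%:R)); last by ring.
  apply: (vgeD vP); first exact: (vgeB vP).
  by apply: (vgeB vP) => //; apply: (vge_dvdn vP hp).
apply: (vge_natr_div p_pr vP hp pn x0 (y := n1%:R - n2%:R) (m := (n1 + p.-1 * n2)%N)).
  by rewrite (vgeBC vP).
rewrite (_ : _ - _ = x * ((c1 + p.-1 * c2)%N%:R - (c1%:R - c2%:R)) +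
  ((x * c1%:R - (x ^+ 2 + n1%:R)) - (x * c2%:R - (x ^+ 2 + n2%:R)))); last by ring.
by apply: (vgeD vP); [apply: (vgeMl vP) | apply: (vgeB vP)].
Qed.

(** The dichotomy is applied to [tau x]: either [tau x], hence [x], is an integer modulo the maximal
    ideal, or the congruence follows because [tau] is an involution. Rotations thus lie in the
    inertia group. *)
Lemma sigma_residue x : vge v 0 x -> vge v 1 (sigma x - x).
Proof.
have natr_fixed y : (exists n : nat, vge v 1 (y - n%:R)) -> vge v 1 (sigma y - y).
  case=> n nP; apply: (vgeB_trans vP (y := n%:R)); last by rewrite (vgeBC vP).
  by rewrite -(rmorph_nat sigma) (vge_morB v_sigma).
move=> x0; have tx0 : vge v 0 (tau x) by rewrite (vge_mor v_tau).
have [[n nP]|] := residue_dichotomy tx0; last by rewrite tau2.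
by apply: natr_fixed; exists n; rewrite -(vge_morB v_tau) rmorph_nat.
Qed.

Lemma residue_integer x : vge v 0 x -> vge v 1 (tau x - x) ->
  exists n : nat, vge v 1 (x - n%:R).
Proof. by move=> x0 tx; exact: (residue_fixed v_tau tau2 sts fixed_residue x0 (sigma_residue x0) tx). Qed.

Hypothesis residue_ext : exists2 x, vge v 0 x & forall n : nat, ~~ vge v 1 (x - n%:R).

(** For a residue class [x] outside the prime field, [tau x - x] is a unit negated by [tau]. Its
    product over the rotations is fixed by [sigma], and the sign survives because [p] is odd. *)
Lemma anti_invariant_unit : exists s, [/\ s != 0, v s = 0, sigma s = s & tau s = - s].
Proof.
case: residue_ext => x x0 xn; pose y := tau x - x.
have y0 : vge v 0 y by apply: (vgeB vP); rewrite ?(vge_mor v_tau).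
have [y_neq0 vy] : y != 0 /\ v y = 0.
  apply: (val_eq y0); apply/negP => y1.
  by have [n nP] := residue_integer x0 y1; have := xn n; rewrite nP.
exists (\prod_(i < p) iter i sigma y); split.
- by apply/prodf_neq0 => i _; rewrite iter_eq0.
- rewrite (val_prod vP) => [|i _]; last by rewrite iter_eq0.
  by rewrite big1 // => i _; rewrite val_iter.
- exact: conj_prod_fixed.
rewrite rmorph_prod [LHS](reindex_inj rev_ord_inj) /=.
have ty : tau y = - y by rewrite /y rmorphB tau2 opprB.
have iterN i z : iter i sigma (- z) = - iter i sigma z by elim: i => //= i ->; rewrite rmorphN.
under eq_bigr => i _ do rewrite tau_iter ?leq_subr // ty iterN subKn ?ltn_ord //.
rewrite prodrN card_ord -signr_odd p_odd expr1 mulN1r; congr (- _).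
by apply: (prod_nat_shift (F := fun i => iter i sigma y)); rewrite sigma_p.
Qed.


End ResidueAction.

(** * Decomposition over the field fixed by a reflection *)

Section TauPart.
Variables (p : nat) (L : fieldType) (v : L -> int) (tau : {rmorphism L -> L}) (s : L).
Hypotheses (p_pr : prime p) (p_odd : odd p) (vP : is_valuation v) (hp : vge v 1 p%:R).
Hypothesis v_tau : forall x, v (tau x) = v x.
Hypothesis tau2 : forall x, tau (tau x) = x.
Hypotheses (s_neq0 : s != 0) (v_s : v s = 0) (tau_s : tau s = - s).

Lemma two_unit : 2%:R != 0 :> L /\ v 2%:R = 0.
Proof. exact: val_natr vP p_pr hp (dvd2_lt p_pr p_odd). Qed.

Lemma vge_s k x : vge v k (s * x) = vge v k x.
Proof. exact: vge_unit. Qed.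

Lemma vge_2 k x : vge v k (2%:R * x) = vge v k x.
Proof. by case: two_unit => *; apply: vge_unit. Qed.

Lemma tau_decomp x : exists a b, [/\ tau a = a, tau b = b & x = a + s * b].
Proof.
have [n2 _] := two_unit.
exists (2%:R^-1 * (x + tau x)), (s^-1 * (2%:R^-1 * (x - tau x))); split.
- by rewrite rmorphM rmorphD tau2 fmorphV rmorph_nat [tau x + x]addrC.
- by rewrite !rmorphM rmorphB tau2 !fmorphV rmorph_nat tau_s invrN; ring.
by rewrite mulVKf // -mulrDr (_ : _ + _ = 2%:R * x) ?mulKf //; ring.
Qed.

(** Applying [tau] flips the sign of [s * b], and 2 and [s] are units: [1, s] is an integral basis
    over the field fixed by [tau]. *)
Lemma vge_tau_decomp k a b : tau a = a -> tau b = b ->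
  vge v k (a + s * b) = vge v k a && vge v k b.
Proof.
move=> ta tb; apply/idP/andP => [h|[ha hb]]; last by rewrite (vgeD vP) ?vge_s.
have h' : vge v k (a - s * b).
  by rewrite -(vge_mor v_tau) rmorphB rmorphM ta tb tau_s mulNr opprK.
split.
  rewrite -vge_2 (_ : 2%:R * a = (a + s * b) + (a - s * b)); last by ring.
  exact: (vgeD vP).
rewrite -vge_s -vge_2 (_ : 2%:R * (s * b) = (a + s * b) - (a - s * b)); last by ring.
exact: (vgeB vP).
Qed.

(** One of the two components carries the valuation. The field fixed by [tau] thus takes all values
    of [v]: the quadratic step is unramified. *)
Lemma tau_part x : x != 0 -> exists a, [/\ tau a = a, a != 0 & v a = v x].
Proof.
move=> x0; have [a [b [ta tb xE]]] := tau_decomp x.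
have : vge v (v x) x by apply: vge_refl.
have : ~~ vge v (v x + 1) x by rewrite vgeS.
rewrite {2 4}xE !vge_tau_decomp // negb_and => /orP[] hn /andP[ha hb].
  by have [??] := val_eq ha hn; exists a.
by have [??] := val_eq hb hn; exists b.
Qed.

End TauPart.

Section EvenValuation.
Variables (p : nat) (L : fieldType) (v : L -> int) (sigma tau : {rmorphism L -> L}) (s : L).
Hypotheses (p_pr : prime p) (p_odd : odd p) (vP : is_valuation v) (hp : vge v 1 p%:R).
Hypothesis v_sigma : forall x, v (sigma x) = v x.
Hypothesis sigma_p : forall x, iter p sigma x = x.
Hypothesis v_tau : forall x, v (tau x) = v x.
Hypothesis tau2 : forall x, tau (tau x) = x.
Hypothesis sts : forall x, sigma (tau (sigma x)) = tau x.
Hypotheses (s_neq0 : s != 0) (v_s : v s = 0) (tau_s : tau s = - s).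
Hypothesis fixed_val : forall c, sigma c = c -> tau c = c -> c != 0 ->
  exists k : int, v c = (2 * p)%N%:Z * k.

Lemma conj_prod_tau x : tau (\prod_(i < p) iter i sigma x) = \prod_(i < p) iter i sigma (tau x).
Proof.
rewrite rmorph_prod [LHS](reindex_inj rev_ord_inj) /=.
under eq_bigr => i _ do rewrite (tau_iter sigma_p sts) ?leq_subr // subKn ?ltn_ord //.
by apply: (prod_nat_shift (F := fun i => iter i sigma (tau x))); rewrite sigma_p.
Qed.

(** A [tau]-fixed element of the same valuation has its product over the rotations in the base; this
    multiplies the valuation by [p], whereas values on the base are multiples of [2p]. *)
Lemma val_even x : x != 0 -> exists k : int, v x = 2 * k.
Proof.
move=> /(tau_part p_pr p_odd vP hp v_tau tau2 s_neq0 v_s tau_s)[a [ta a0 <-]].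
have [|||k kE] := fixed_val (c := \prod_(i < p) iter i sigma a).
- exact: conj_prod_fixed.
- by rewrite conj_prod_tau ta.
- by apply/prodf_neq0 => i _; rewrite iter_eq0.
exists k; move: kE; rewrite (val_prod vP) => [|i _]; last by rewrite iter_eq0.
under eq_bigr => i _ do rewrite val_iter //.
rewrite sumr_const card_ord PoszM -[v a *+ p]mulr_natl natz => h.
have p0 : p%:Z != 0 by move: (prime_gt0 p_pr); lia.
by apply: (mulfI p0); rewrite h; ring.
Qed.

(** Intended for the norm valuation, where [p] has value [2p]; halving gives it the value [p]. *)
Definition half_val (x : L) : int := (v x %/ 2)%Z.

Lemma half_valE x : x != 0 -> v x = 2 * half_val x.
Proof. by move=> /val_even[k kE]; rewrite /half_val kE mulKz. Qed.

Lemma vge_half k x : vge half_val k x = vge v (2 * k) x.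
Proof. by rewrite /vge; case: eqVneq => //= x0; rewrite half_valE //; lia. Qed.

Lemma vge_half1 x : vge half_val 1 x = vge v 1 x.
Proof. by rewrite /vge; case: eqVneq => //= x0; rewrite half_valE //; lia. Qed.

Lemma half_valuation : is_valuation half_val.
Proof.
split=> [x y x0 y0|k x y]; last by rewrite !vge_half; apply: (vgeD vP).
have := valM vP x0 y0; rewrite !half_valE ?mulf_neq0 //; lia.
Qed.

End EvenValuation.

Lemma residue_multiple (p : nat) (a b : int) : prime p -> ~~ (p %| a)%Z ->
  exists k : nat, (p %| b - k%:Z * a)%Z.
Proof.
move=> p_pr pa; have [u [w uw]] := Bezoutz p a.
have cop : gcdz p a = 1.
  by apply/eqP; rewrite -/(coprimez p a) coprimezE prime_coprime // -dvdzE.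
have p0 : p%:Z != 0 by move: (prime_gt0 p_pr); lia.
exists `|(b * w %% p)%Z|%N; rewrite gez0_abs ?modz_ge0 //.
have -> : b - (b * w %% p)%Z * a = (b * u + (b * w %/ p)%Z * a) * p.
  have e := divz_eq (b * w) p; set q := (_ %/ _)%Z in e *; set r := (_ %% _)%Z in e *.
  have rE : r = b * w - q * p by rewrite e addrC addKr.
  by rewrite rE -{1}[b]mulr1 -cop -uw; ring.
exact: dvdz_mull.
Qed.

Section DihedralValuation.
Variables (p : nat) (L : fieldType) (v : L -> int) (sigma tau : {rmorphism L -> L}) (s : L).

(* A valued field with an action of the dihedral group of order 2p whose
   rotations form the inertia group, with ramification index p: the element s
   generates the unramified quadratic subextension. *)
Record dihedral_valuation : Prop := DihedralValuation {
  dv_prime : prime p;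
  dv_odd : odd p;
  dv_val : is_valuation v;
  dv_p_neq0 : p%:R != 0 :> L;
  dv_p : v p%:R = p;
  dv_sigma : forall x, v (sigma x) = v x;
  dv_sigma_p : forall x, iter p sigma x = x;
  dv_sigma_neq1 : exists x, sigma x != x;
  dv_tau : forall x, v (tau x) = v x;
  dv_tau2 : forall x, tau (tau x) = x;
  dv_sts : forall x, sigma (tau (sigma x)) = tau x;
  dv_s_neq0 : s != 0;
  dv_s : v s = 0;
  dv_tau_s : tau s = - s;
  dv_sigma_s : sigma s = s;
  dv_sigma_res : forall x, vge v 0 x -> vge v 1 (sigma x - x);
  dv_res_integer : forall x, vge v 0 x -> vge v 1 (tau x - x) ->
    exists n : nat, vge v 1 (x - n%:R)
}.

End DihedralValuation.

(** * First bounds for rotations and the expansion of twisted sums *)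

Section Ramification.
Variables (p : nat) (L : fieldType) (v : L -> int) (sigma tau : {rmorphism L -> L}) (s : L).
Hypothesis D : dihedral_valuation p v sigma tau s.

Let p_pr : prime p := dv_prime D.
Let p_odd : odd p := dv_odd D.
Let vP : is_valuation v := dv_val D.
Let p_neq0 : p%:R != 0 :> L := dv_p_neq0 D.
Let v_p : v p%:R = p := dv_p D.
Let v_sigma : forall x, v (sigma x) = v x := dv_sigma D.
Let sigma_p : forall x, iter p sigma x = x := dv_sigma_p D.
Let v_tau : forall x, v (tau x) = v x := dv_tau D.
Let tau2 : forall x, tau (tau x) = x := dv_tau2 D.
Let s_neq0 : s != 0 := dv_s_neq0 D.
Let v_s : v s = 0 := dv_s D.
Let tau_s : tau s = - s := dv_tau_s D.
Let sigma_s : sigma s = s := dv_sigma_s D.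
Let sigma_res := dv_sigma_res D.
Let res_integer := dv_res_integer D.

Local Notation delta := (fun x => sigma x - x).

Lemma p_gt2 : (2 < p)%N.
Proof. by have := prime_gt1 p_pr; case: p p_odd => [|[|[|]]]. Qed.

Lemma vge_p1 : vge v 1 p%:R.
Proof. by rewrite vgeE ?v_p //; move: p_gt2; lia. Qed.

Let hp := vge_p1.

Lemma vge_p k x : vge v (p%:Z + k) (p%:R * x) = vge v k x.
Proof. by rewrite -{1}v_p vgeZ. Qed.

(* sigma x / x is a unit of norm 1 congruent to its conjugates, so its p-th
   power, hence itself, is congruent to 1. *)
Lemma delta_ge k x : vge v k x -> vge v (k + 1) (sigma x - x).
Proof.
move=> kx; have [->|x0] := eqVneq x 0; first by rewrite rmorph0 subrr vge_zero.
pose z := sigma x / x.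
have sx0 : sigma x != 0 by rewrite fmorph_eq0.
have z0 : z != 0 by rewrite mulf_neq0 ?invr_eq0.
have vz : v z = 0 by rewrite (valM vP) ?invr_eq0 // (valV vP) // v_sigma subrr.
have z_ge : vge v 0 z by rewrite vgeE // vz.
have nz : \prod_(i < p) iter i sigma z = 1.
  have x_neq0 : \prod_(i < p) iter i sigma x != 0.
    by apply/prodf_neq0 => i _; rewrite iter_eq0.
  apply: (mulfI x_neq0); rewrite -big_split mulr1 /=.
  rewrite -[RHS](prod_nat_shift (F := fun i => iter i sigma x)) ?sigma_p //.
  by apply: eq_bigr => i _; rewrite -iter_mor_mul /z mulrCA divff // mulr1 -iterSr.
have zp : vge v 1 (z ^+ p - 1).
  rewrite -nz -[in z ^+ p](card_ord p) -prodr_const (vgeBC vP).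
  apply: (vgeB_prod vP) => i; rewrite ?vge_iter //.
  by apply: (vge_iterB vP v_sigma); apply: sigma_res.
have z1 : vge v 1 (z - 1).
  apply: (@vge1X _ _ vP _ p); first by rewrite (vgeB vP) ?vge_one.
  have := frob_add p_pr vP hp (vgeB vP z_ge (vge_one vP)) (vge_one vP).
  rewrite subrK expr1n => h.
  rewrite (_ : (z - 1) ^+ p = (z ^+ p - 1) - (z ^+ p - ((z - 1) ^+ p + 1))); last by ring.
  exact: (vgeB vP).
rewrite (_ : sigma x - x = x * (z - 1)); first exact: (vgeM vP).
by rewrite mulrBr mulr1 /z mulrCA divff // mulr1.
Qed.

Lemma residue_decomp x : vge v 0 x -> exists n m : nat, vge v 1 (x - (n%:R + m%:R * s)).
Proof.
move=> x0.
have [a [b [ta tb xE]]] := tau_decomp p_pr p_odd vP hp tau2 s_neq0 tau_s x.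
move: x0; rewrite xE (vge_tau_decomp p_pr p_odd vP hp v_tau s_neq0 v_s tau_s) // => /andP[a0 b0].
have [|n nP] := res_integer a0; first by rewrite ta subrr vge_zero.
have [|m mP] := res_integer b0; first by rewrite tb subrr vge_zero.
exists n, m; rewrite (_ : _ - _ = (a - n%:R) + s * (b - m%:R)); last by ring.
by apply: (vgeD vP) => //; rewrite (vge_unit vP).
Qed.

Lemma sigma_pz (j : int) : sigma (p%:R ^ j) = p%:R ^ j.
Proof. by rewrite fmorphXz rmorph_nat. Qed.

(** Dividing by a power of [p] leaves a unit congruent to some [n + m s], an element fixed by
    [sigma]; their difference has valuation at least 1 and is raised once more. *)
Lemma delta_ge2 x : x != 0 -> (p %| v x)%Z -> vge v (v x + 2) (sigma x - x).
Proof.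
move=> x0 /dvdzP[j vx].
have pj0 (k : int) : p%:R ^ k != 0 :> L by rewrite expfz_eq0 negb_and p_neq0 orbT.
pose u := p%:R ^ (- j) * x.
have xu : x = p%:R ^ j * u by rewrite /u mulrA -expfzDr // subrr mul1r.
have vu : v u = 0 by rewrite (valM vP) ?pj0 // (valXz vP) // v_p vx mulNr addNr.
have u0 : u != 0 by rewrite mulf_neq0 ?pj0.
have [|n [m nm]] := residue_decomp (x := u); first by rewrite vgeE // vu.
have := delta_ge nm.
clearbody u; rewrite !rmorphB rmorphD rmorphM !rmorph_nat sigma_s.
rewrite (_ : _ - _ = sigma u - u); last by ring.
move=> h; rewrite {2 3}xu rmorphM sigma_pz -mulrBr.
have -> : v x = v (p%:R ^ j) + 0 by rewrite addr0 (valXz vP) // v_p vx.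
by rewrite -addrA (vgeZ vP) ?pj0.
Qed.

Variable m : nat.
Local Notation rho := (iter m sigma).

(** The [k]-th power of [sigma (x) rho - 1] on the tensor square, followed by multiplication; the
    recursion splits the operator as [(sigma - 1) (x) rho + 1 (x) (rho - 1)]. *)
Fixpoint dconv (k : nat) (c x : L) : L :=
  if k is k'.+1 then dconv k' (sigma c - c) (rho x) + dconv k' c (rho x - x) else c * x.

Lemma dconvDl k c c' x : dconv k (c + c') x = dconv k c x + dconv k c' x.
Proof.
elim: k c c' x => [|k IH] c c' x /=; first by rewrite mulrDl.
by rewrite rmorphD opprD addrACA !IH addrACA.
Qed.

Lemma dconvDr k c x x' : dconv k c (x + x') = dconv k c x + dconv k c x'.
Proof.
elim: k c x x' => [|k IH] c x x' /=; first by rewrite mulrDr.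
by rewrite iter_mor_add opprD (addrACA (rho x)) !IH addrACA.
Qed.

Lemma dconv_shift k c x : dconv k (sigma c) (rho x) = dconv k c x + dconv k.+1 c x.
Proof.
have e1 : dconv k (sigma c) (rho x) = dconv k (sigma c - c) (rho x) + dconv k c (rho x).
  by rewrite -dconvDl subrK.
have e2 : dconv k c (rho x) = dconv k c x + dconv k c (rho x - x).
  by rewrite -dconvDr addrC subrK.
by rewrite e1 e2 /=; ring.
Qed.

Definition twisted_sum (n : nat) (c x : L) : L := \sum_(i < n) iter i sigma c * iter i rho x.

(** With [T] for [sigma (x) rho], this is the expansion of [1 + T + ... + T^(n-1)] in powers of
    [T - 1]. For [n = p] all binomials but the last are divisible by [p]. *)
Lemma twisted_sumE n c x :
  twisted_sum n c x = \sum_(k < n) 'C(n, k.+1)%:R * dconv k c x.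
Proof.
elim: n c x => [|n IH] c x; first by rewrite /twisted_sum !big_ord0.
have -> : twisted_sum n.+1 c x = c * x + twisted_sum n (sigma c) (rho x).
  rewrite /twisted_sum big_ord_recl; congr (_ + _); apply: eq_bigr => i _.
  by rewrite lift0 !iterSr.
rewrite IH.
under eq_bigr => k _ do rewrite dconv_shift mulrDr.
under [RHS]eq_bigr => k _ do rewrite binS natrD mulrDl.
rewrite !big_split /= [X in _ = X + _]big_ord_recr /= bin_small // mul0r addr0.
by rewrite [X in _ = _ + X]big_ord_recl /= bin0 mul1r addrCA.
Qed.

Lemma rho_ge k x : vge v k x -> vge v (k + 1) (rho x - x).
Proof. by move=> kx; apply: (vge_iterB vP v_sigma); apply: delta_ge. Qed.

Lemma dconv_ge k a b c x : vge v a c -> vge v b x -> vge v (a + b + k%:Z) (dconv k c x).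
Proof.
elim: k a b c x => [|k IH] a b c x ha hb /=; first by rewrite addr0 (vgeM vP).
have -> : a + b + k.+1%:Z = (a + 1) + b + k%:Z by rewrite -addn1 PoszD; ring.
apply: (vgeD vP); first by apply: IH; rewrite ?vge_iter // delta_ge.
by rewrite (_ : _ + _ + _ = a + (b + 1) + k%:Z); [apply: IH; rewrite // rho_ge | ring].
Qed.

Lemma binp_ge k e x : (k.+1 < p)%N -> vge v e x -> vge v (p%:Z + e) ('C(p, k.+1)%:R * x).
Proof.
move=> kp ex; have /dvdnP[j ->] : (p %| 'C(p, k.+1))%N by rewrite prime_dvd_bin.
by rewrite mulnC natrM -mulrA vge_p (vgeMl vP) ?(vge_nat vP).
Qed.

(** The term [k = p - 1] gains [p - 1] from the differences; every other term gains [p] from its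
    binomial coefficient. *)
Lemma twisted_sum_ge a b c x : vge v a c -> vge v b x ->
  vge v (a + b + p.-1%:Z) (twisted_sum p c x).
Proof.
move=> ha hb; rewrite twisted_sumE; apply: (vge_sum vP) => k _.
have := ltn_ord k; rewrite leq_eqVlt => /predU1P[kp|kp].
  have kE : p.-1 = k by rewrite -[nat_of_ord k]/(k.+1.-1) kp.
  by rewrite kp binn mul1r kE dconv_ge.
apply: vgeW (binp_ge kp (dconv_ge k ha hb)); move: (prime_gt0 p_pr); lia.
Qed.

End Ramification.

(** * The ramification break and exactly raising operators *)

Section Breaks.
Variables (p : nat) (L : fieldType) (v : L -> int) (sigma tau : {rmorphism L -> L}) (s : L).
Hypothesis D : dihedral_valuation p v sigma tau s.

Let p_pr : prime p := dv_prime D.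
Let p_odd : odd p := dv_odd D.
Let vP : is_valuation v := dv_val D.
Let p_neq0 : p%:R != 0 :> L := dv_p_neq0 D.
Let v_p : v p%:R = p := dv_p D.
Let v_sigma : forall x, v (sigma x) = v x := dv_sigma D.
Let sigma_p : forall x, iter p sigma x = x := dv_sigma_p D.
Let p2 : (2 < p)%N := p_gt2 D.

Local Notation delta := (fun x => sigma x - x).

Lemma iter_delta_ge (w : L -> L) i k x : (forall k x, vge v k x -> vge v (k + 1) (w x)) ->
  vge v k x -> vge v (k + i%:Z) (iter i w x).
Proof.
move=> hw; elim: i k x => [|i IH] k x kx; first by rewrite addr0.
by rewrite iterSr (_ : k + i.+1%:Z = (k + 1) + i%:Z); [apply: IH; apply: hw | lia].
Qed.

Lemma dconv0 k c x : dconv sigma 0 k c x = iter k delta c * x.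
Proof. by elim: k c x => //= k IH c x; rewrite !IH subrr mulr0 addr0 -iterSr. Qed.

Lemma trace_delta c : \sum_(i < p) iter i sigma c = \sum_(k < p) 'C(p, k.+1)%:R * iter k delta c.
Proof.
have := twisted_sumE sigma 0 p c 1.
under [X in _ = X]eq_bigr => k _ do rewrite dconv0 mulr1.
move=> <-; apply: eq_bigr => i _.
by rewrite (_ : iter i _ 1 = 1) ?mulr1 //; elim: (i : nat) => //= j ->.
Qed.

Lemma pred_p : exists2 q, p = q.+2 & (0 < q)%N.
Proof. by case: p p2 => [|[|q]] // h; exists q. Qed.

(* If sigma raised all valuations by at least 2, then for z = delta x0 the
   vanishing of the trace of z would leave p z as the only term of least
   valuation. *)
Lemma exists_exact_raise : exists2 x, x != 0 & ~~ vge v (v x + 2) (sigma x - x).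
Proof.
apply: NNPP => none.
have raise2 k x : vge v k x -> vge v (k + 2) (sigma x - x).
  have [->|x0] := eqVneq x 0; first by move=> _; rewrite rmorph0 subrr vge_zero.
  rewrite vgeE // => kx; apply: (vgeW (k := v x + 2)); first by lia.
  by apply/negPn/negP => h; apply: none; exists x.
have [x xN] := dv_sigma_neq1 D; pose z := sigma x - x.
have z0 : z != 0 by rewrite subr_eq0.
have [q pE q0] := pred_p.
have iter2 i : vge v (v z + (2 * i)%N%:Z) (iter i delta z).
  elim: i => [|i IH]; first by rewrite muln0 addr0 vge_refl.
  by rewrite iterS (_ : _ + _ = v z + (2 * i)%N%:Z + 2); [apply: raise2 | lia].
have tr0 : \sum_(i < p) iter i sigma z = 0.
  under eq_bigr => i _ do rewrite iter_mor_sub -iterSr.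
  by rewrite sumrB (sum_nat_shift (F := fun i => iter i sigma x)) ?subrr ?sigma_p.
have recl (F : nat -> L) : \sum_(k < p) F k = F 0%N + \sum_(k < q.+1) F k.+1.
  by rewrite pE big_ord_recl.
move: tr0; rewrite trace_delta (recl (fun k => 'C(p, k.+1)%:R * iter k delta z)) /= bin1.
have pz0 : p%:R * z != 0 by rewrite mulf_neq0.
have vpz : v (p%:R * z) = p%:Z + v z by rewrite (valM vP) // v_p.
have [|h _] := val_dom vP (y := \sum_(k < q.+1) 'C(p, k.+2)%:R * iter k.+1 delta z) pz0.
  apply: (vge_sum vP) => i _; rewrite vpz; have hi := iter2 i.+1.
  have := ltn_ord i; rewrite ltnS leq_eqVlt => /predU1P[iq|iq].
    have -> : i.+2 = p by rewrite pE iq.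
    by rewrite binn mul1r; apply: vgeW hi; rewrite pE iq; lia.
  apply: (@vgeW _ _ _ (p%:Z + (v z + 2))); first by lia.
  by apply: (binp_ge D); [rewrite pE !ltnS | apply: vgeW hi; lia].
by move=> e; rewrite e eqxx in h.
Qed.

Lemma mul_raise2 x y : x != 0 -> y != 0 ->
  vge v (v x + 2) (sigma x - x) -> vge v (v y + 2) (sigma y - y) ->
  vge v (v (x * y) + 2) (sigma (x * y) - x * y).
Proof.
move=> x0 y0 hx hy; rewrite (valM vP) // rmorphM.
rewrite (_ : _ - _ = sigma x * (sigma y - y) + y * (sigma x - x)); last by ring.
apply: (vgeD vP).
  by rewrite -addrA; apply: (vgeM vP) => //; rewrite -(v_sigma x) vge_refl.
by rewrite addrAC addrC; apply: (vgeM vP); rewrite ?vge_refl.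
Qed.

(** Elements raised by at least 2 are closed under products and include all those of valuation
    divisible by [p]. If one of valuation prime to [p] were among them, its powers would bring in
    every [y], against [exists_exact_raise]. *)
Lemma exact_raise x : x != 0 -> ~~ (p %| v x)%Z -> ~~ vge v (v x + 2) (sigma x - x).
Proof.
move=> x0 px; apply/negP => hx; have [y y0 /negP[]] := exists_exact_raise.
have [k kP] := residue_multiple (v y) p_pr px.
have xk0 : x ^+ k != 0 by rewrite expf_neq0.
have hxk : vge v (v (x ^+ k) + 2) (sigma (x ^+ k) - x ^+ k).
  elim: k {kP xk0} => [|k IH]; first by rewrite rmorph1 subrr vge_zero.
  by rewrite exprS; apply: mul_raise2 => //; rewrite expf_neq0.
have w0 : y / x ^+ k != 0 by rewrite mulf_neq0 ?invr_eq0.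
have -> : y = x ^+ k * (y / x ^+ k) by rewrite mulrC mulfVK.
apply: mul_raise2 => //; apply: (delta_ge2 D) => //.
by rewrite (valM vP) ?invr_eq0 // (valV vP) // (valX vP) // -[v x *+ k]mulr_natl natz.
Qed.

(** An element raised by exactly 1 has valuation prime to [p]; combining its powers with those of
    [p] reaches valuation 1, and [tau_part] makes the result fixed by [tau]. *)
Lemma exists_uniformizer : exists y, [/\ y != 0, v y = 1 & tau y = y].
Proof.
have [x x0 hx] := exists_exact_raise.
have px : ~~ (p %| v x)%Z.
  by apply/negP => px; move/negP: hx; apply; apply: (delta_ge2 D).
have [k /dvdzP[j jE]] := residue_multiple 1 p_pr px.
have pj0 : p%:R ^ j != 0 :> L by rewrite expfz_eq0 negb_and p_neq0 orbT.
pose y := p%:R ^ j * x ^+ k.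
have y0 : y != 0 by rewrite mulf_neq0 ?expf_neq0.
have vy : v y = 1.
  rewrite (valM vP) ?expf_neq0 // (valXz vP) // (valX vP) // -[v x *+ k]mulr_natl natz v_p -jE; ring.
have [a [ta a0 va]] := tau_part p_pr p_odd vP (vge_p1 D) (dv_tau D) (dv_tau2 D)
  (dv_s_neq0 D) (dv_s D) (dv_tau_s D) y0.
by exists a; rewrite va vy.
Qed.

(* The operators sigma - 1 and s (sigma - sigma^-1) both have this property;
   it is all that is needed to compute associated orders. *)
Record exact_raising (w : L -> L) : Prop := ExactRaising {
  er_zmod : forall x y, w (x - y) = w x - w y;
  er_s : forall x, w (s * x) = s * w x;
  er_natr : forall (n : nat) x, w (n%:R * x) = n%:R * w x;
  er_ge : forall k x, vge v k x -> vge v (k + 1) (w x);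
  er_ge2 : forall x, x != 0 -> (p %| v x)%Z -> vge v (v x + 2) (w x);
  er_exact : forall x, x != 0 -> ~~ (p %| v x)%Z -> ~~ vge v (v x + 2) (w x)
}.

Lemma exact_raising_delta : exact_raising delta.
Proof.
split=> [x y|x|n x|k x|x|x] /=.
- by rewrite rmorphB; ring.
- by rewrite rmorphM (dv_sigma_s D) mulrBr.
- by rewrite rmorphM rmorph_nat mulrBr.
- exact: (delta_ge D).
- exact: (delta_ge2 D).
- exact: exact_raise.
Qed.

(** On [sigma^-1 x] the difference acts as [sigma^2 - 1 = 2 (sigma - 1) + (sigma - 1)^2]. As 2 and
    [s] are units and the square raises by at least 2, the term [sigma - 1] decides. *)
Lemma exact_raising_skew (sigma' : {rmorphism L -> L}) : (forall x, sigma (sigma' x) = x) ->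
  exact_raising (fun x => s * (sigma x - sigma' x)).
Proof.
move=> sK.
have v_sigma' x : v (sigma' x) = v x by rewrite -v_sigma sK.
have s's : sigma' s = s by apply: (fmorph_inj sigma); rewrite sK (dv_sigma_s D).
have e x : sigma x - sigma' x = 2%:R * (sigma (sigma' x) - sigma' x) +
    (sigma (sigma (sigma' x) - sigma' x) - (sigma (sigma' x) - sigma' x)).
  by rewrite rmorphB; rewrite !sK; ring.
have vge_s' k x : vge v k (s * x) = vge v k x by apply: (vge_s vP (dv_s_neq0 D) (dv_s D)).
have vge_2' k x : vge v k (2%:R * x) = vge v k x by apply: (vge_2 p_pr p_odd vP (vge_p1 D)).
split=> [x y|x|n x|k x|x x0 px|x x0 px].
- by rewrite !rmorphB; ring.
- by rewrite !rmorphM (dv_sigma_s D) s's; ring.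
- by rewrite !rmorphM !rmorph_nat; ring.
- move=> kx; rewrite vge_s' e.
  have h : vge v (k + 1) (sigma (sigma' x) - sigma' x).
    by apply: (delta_ge D); rewrite (vge_mor v_sigma').
  by apply: (vgeD vP); rewrite ?vge_2' //; apply: vgeW (delta_ge D h); lia.
- have h : vge v (v x + 2) (sigma (sigma' x) - sigma' x).
    by rewrite -v_sigma'; apply: (delta_ge2 D); rewrite ?fmorph_eq0 ?v_sigma'.
  rewrite vge_s' e; apply: (vgeD vP); rewrite ?vge_2' //.
  by apply: vgeW (delta_ge D h); lia.
rewrite vge_s' e (vgeDr vP).
  by rewrite vge_2' -v_sigma'; apply: exact_raise; rewrite ?fmorph_eq0 ?v_sigma'.
rewrite (_ : v x + 2 = v x + 1 + 1); last by lia.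
by apply: (delta_ge D); apply: (delta_ge D); rewrite (vge_mor v_sigma') vge_refl.
Qed.

Section Iterates.
Variable w : L -> L.
Hypothesis hw : exact_raising w.

Lemma er0 : w 0 = 0.
Proof. by rewrite -[X in w X](subrr 0) (er_zmod hw) subrr. Qed.

Lemma erN x : w (- x) = - w x.
Proof. by rewrite -[- x]sub0r (er_zmod hw) er0 sub0r. Qed.

Lemma erD x y : w (x + y) = w x + w y.
Proof. by rewrite -[y in LHS]opprK (er_zmod hw) erN opprK. Qed.

Lemma er_iterD i x y : iter i w (x + y) = iter i w x + iter i w y.
Proof. by elim: i => //= i ->; rewrite erD. Qed.

Lemma er_iterB i x y : iter i w (x - y) = iter i w x - iter i w y.
Proof. by elim: i => //= i ->; rewrite (er_zmod hw). Qed.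

Lemma er_iter_s i x : iter i w (s * x) = s * iter i w x.
Proof. by elim: i => //= i ->; rewrite (er_s hw). Qed.

Lemma er_iter_natr i (n : nat) x : iter i w (n%:R * x) = n%:R * iter i w x.
Proof. by elim: i => //= i ->; rewrite (er_natr hw). Qed.

Lemma er_iter_ge i k x : vge v k x -> vge v (k + i%:Z) (iter i w x).
Proof. exact: iter_delta_ge (er_ge hw). Qed.

Lemma er_iter_ge0 i x : vge v 0 x -> vge v 0 (iter i w x).
Proof. by move=> hx; apply: vgeW (er_iter_ge i hx); lia. Qed.

(** The valuations met before step [i] are [1, ..., i], all prime to [p] since [i < p]. *)
Lemma er_iter_exact y i : y != 0 -> v y = 1 -> (i < p)%N ->
  iter i w y != 0 /\ v (iter i w y) = 1 + i%:Z.
Proof.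
move=> y0 vy; elim: i => [|i IH] ip; first by rewrite addr0.
have [h0 hv] := IH (ltnW ip); rewrite iterS.
have pi : ~~ (p %| v (iter i w y))%Z.
  by rewrite hv -PoszD add1n dvdzE /= gtnNdvd.
have := er_exact hw h0 pi; have := er_ge hw (vge_refl v (iter i w y)).
rewrite hv => h1 h2; have [|w0 wv] := @val_eq _ v (1 + i%:Z + 1) (w (iter i w y)) h1.
  by rewrite (_ : 1 + i%:Z + 1 + 1 = 1 + i%:Z + 2) //; lia.
by split=> //; rewrite wv; lia.
Qed.

(* At valuation 0 the first application of w raises by 2. *)
Lemma er_iter_top z : vge v 0 z -> vge v p (iter p.-1 w z).
Proof.
have [q pE q0] := pred_p; rewrite {2}pE /= -iterS iterSr => z0.
have h : vge v 2 (w z).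
  have [->|zN] := eqVneq z 0; first by rewrite er0 vge_zero.
  move: z0; rewrite vgeE // le_eqVlt => /predU1P[vz|vz].
    by rewrite -[2]add0r [X in vge _ (X + _)]vz; apply: er_ge2; rewrite // -vz dvdz0.
  by apply: (vgeW _ (er_ge hw (vge_refl v z))); lia.
by apply: vgeW (er_iter_ge q h); rewrite pE; lia.
Qed.

End Iterates.

End Breaks.

(** * Exact valuation of twisted traces *)

Section TwistedSum.
Variables (p : nat) (L : fieldType) (v : L -> int) (sigma tau : {rmorphism L -> L}) (s : L).
Hypothesis D : dihedral_valuation p v sigma tau s.

Let p_pr : prime p := dv_prime D.
Let p_odd : odd p := dv_odd D.
Let vP : is_valuation v := dv_val D.
Let p_neq0 : p%:R != 0 :> L := dv_p_neq0 D.
Let v_p : v p%:R = p := dv_p D.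
Let v_sigma : forall x, v (sigma x) = v x := dv_sigma D.
Let sigma_p : forall x, iter p sigma x = x := dv_sigma_p D.

Local Notation delta := (fun x => sigma x - x).

Lemma iter_sigma_mod a b x : a = b %[mod p] -> iter a sigma x = iter b sigma x.
Proof.
move=> ab; rewrite (divn_eq a p) (divn_eq b p) ab addnC iterD [X in _ = iter X _ _]addnC iterD.
by rewrite !(iter_mulp sigma_p).
Qed.

(** In the expansion by differences the term [k = p - 1] has valuation exactly [p]; the binomial
    factor puts the others at [p + 1] or above. *)
Lemma sigma_trace_exact y : y != 0 -> v y = 1 ->
  ~~ vge v (p%:Z + 1) (\sum_(i < p) iter i sigma y).
Proof.
move=> y0 vy; have p0 := prime_gt0 p_pr; rewrite trace_delta.
have pp : (p.-1 < p)%N by rewrite prednK.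
rewrite (bigD1 (Ordinal pp)) //= prednK // binn mul1r (vgeDr vP).
  have [h0 hv] := er_iter_exact D (exact_raising_delta D) y0 vy pp.
  by rewrite vgeE // hv; lia.
apply: (vge_sum vP) => i ip.
have ip' : (i.+1 < p)%N.
  by rewrite ltn_neqAle ltn_ord andbT; apply: contra ip => /eqP h; apply/eqP/val_inj; rewrite /= -[nat_of_ord i]/(i.+1.-1) h.
apply: (binp_ge D ip'); have yv := vge_refl v y; rewrite vy in yv.
by apply: vgeW (er_iter_ge D (exact_raising_delta D) i yv); lia.
Qed.

Variable m : nat.
Local Notation rho := (iter m sigma).
Local Notation B := (twisted_sum sigma m p).

Lemma iter_rho i x : iter i rho x = iter (i * m) sigma x.
Proof. by elim: i x => // i IH x; rewrite mulSn iterS IH iterD. Qed.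

Lemma twisted_sum_shift c x : B (sigma c) (rho x) = B c x.
Proof.
rewrite /twisted_sum -(sum_nat_shift (F := fun i => iter i sigma c * iter i rho x)).
  by apply: eq_bigr => i _; rewrite !iterSr.
by rewrite sigma_p iter_rho mulnC (iter_mulp sigma_p).
Qed.

Lemma twisted_sum_shiftn j c x : B (iter j sigma c) (iter j rho x) = B c x.
Proof. by elim: j => // j IH; rewrite !iterS twisted_sum_shift. Qed.

Lemma iter_sigmaC i j x : iter i sigma (iter j sigma x) = iter j sigma (iter i sigma x).
Proof. by rewrite -!iterD addnC. Qed.

Lemma sigma_twisted_sum j c x : iter j sigma (B c x) = B (iter j sigma c) (iter j sigma x).
Proof.
rewrite /twisted_sum.
have -> : iter j sigma (\sum_(i < p) iter i sigma c * iter i rho x) =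
    \sum_(i < p) iter j sigma (iter i sigma c * iter i rho x).
  by elim: j => //= j ->; rewrite rmorph_sum.
by apply: eq_bigr => i _; rewrite iter_mor_mul !iter_rho !(iter_sigmaC j).
Qed.

Lemma twisted_sumBr c x y : B c (x - y) = B c x - B c y.
Proof.
rewrite /twisted_sum -sumrB; apply: eq_bigr => i _.
by rewrite !iter_rho iter_mor_sub mulrBr.
Qed.

Hypothesis m_neq1 : m != 1 %[mod p].

(** [n] is the inverse of [1 - m] modulo [p], available because [m] is not 1; [p.-1] again stands
    for -1. *)
Let twist_inverse : exists n, (n * m + 1 = n %[mod p])%N.
Proof.
have p0 := prime_gt0 p_pr.
have pa : ~~ (p %| m + p.-1)%N.
  apply: contra m_neq1; rewrite /dvdn -(eqn_modDr p.-1) add1n prednK //.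
  by move/eqP->; rewrite modnn.
have a0 : (0 < m + p.-1)%N by case: (m + p.-1)%N pa; rewrite ?dvdn0.
have /eqP cop : coprime (m + p.-1) p by rewrite coprime_sym prime_coprime.
case: (egcdnP p a0) => k l; rewrite cop => klE _; exists (k * p.-1)%N.
apply/eqP; rewrite -(eqn_modDr (k * p.-1 * p.-1)).
have -> : (k * p.-1 * m + 1 + k * p.-1 * p.-1 = (p.-1 * l + 1) * p)%N.
  transitivity (p.-1 * (k * (m + p.-1)) + 1)%N; first by ring.
  by rewrite klE mulnDr mulnDl muln1 mul1n mulnA -addnA addn1 prednK.
have -> : (k * p.-1 + k * p.-1 * p.-1 = k * p.-1 * p)%N.
  by rewrite -{1}[(k * p.-1)%N]muln1 -mulnDr add1n prednK.
by rewrite !modnMl.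
Qed.

(* Applying (sigma^n - 1) to the sum, with n (1 - m) = 1 modulo p, amounts to
   applying delta to the second argument; doing so p - 1 times leaves a trace. *)
Lemma twisted_sum_exact y y' : y != 0 -> v y = 1 -> y' != 0 -> v y' = 1 ->
  B y y' != 0 /\ v (B y y') = p%:Z + 1.
Proof.
move=> y0 vy y'0 vy'; have p0 := prime_gt0 p_pr.
have yge : vge v 1 y by rewrite vgeE // vy.
have y'ge : vge v 1 y' by rewrite vgeE // vy'.
have e2 : 1 + 1 + p.-1%:Z = p%:Z + 1 by move: p0; clear; lia.
apply: (val_eq (v := v)).
  by rewrite -e2; apply: (twisted_sum_ge D m yge y'ge).
apply/negP => Bge; have [n nP] := twist_inverse.
pose DD := fun x => iter n sigma x - x.
have DDB x : DD (B y x) = B y (sigma x - x).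
  rewrite /DD sigma_twisted_sum twisted_sumBr; congr (_ - _).
  rewrite -(twisted_sum_shiftn n y (sigma x)) iter_rho -iterSr -addn1.
  by rewrite (iter_sigma_mod _ nP).
have DDi i : iter i DD (B y y') = B y (iter i delta y').
  by elim: i => // j IH; rewrite iterS IH DDB iterS.
have DDge k x : vge v k x -> vge v (k + 1) (DD x).
  by move=> kx; apply: (vge_iterB vP v_sigma); apply: (delta_ge D).
have := iter_delta_ge D p.-1 DDge Bge; rewrite DDi.
have pp : (p.-1 < p)%N by rewrite prednK.
have [d0 dv] := er_iter_exact D (exact_raising_delta D) y'0 vy' pp.
set d := iter p.-1 delta y' in d0 dv *.
(* [d] has valuation [p], so [w] is a unit. A representative [f] of its residue fixed by [sigma]
   factors out of the sum and leaves the plain trace of [y]; the error [w - f] contributes valuation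
   at least [p + 1]. *)
pose w := d / p%:R.
have w0 : w != 0 by rewrite mulf_neq0 ?invr_eq0.
have dE : d = p%:R * w by rewrite mulrC mulfVK.
have vw : v w = 0 by rewrite (valM vP) ?invr_eq0 // (valV vP) // v_p dv -PoszD add1n prednK // subrr.
have wge : vge v 0 w by rewrite vgeE // vw.
have [a [b abP]] := residue_decomp D wge; set f := a%:R + b%:R * s in abP.
have sf : sigma f = f by rewrite rmorphD rmorphM !rmorph_nat (dv_sigma_s D).
have fw : f = w + (f - w) by rewrite addrC subrK.
have [f0 vf] : f != 0 /\ v f = 0.
  by rewrite fw -vw; apply: (val_dom vP) => //; rewrite vw add0r (vgeBC vP).
have Bp x : B y (p%:R * x) = p%:R * B y x.
  rewrite /twisted_sum mulr_sumr; apply: eq_bigr => i _.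
  rewrite !iter_rho iter_mor_mul mulrCA; congr (_ * _).
  by elim: (i * m)%N => //= j ->; rewrite rmorph_nat.
have Bf : B y f = f * \sum_(i < p) iter i sigma y.
  rewrite /twisted_sum mulr_sumr; apply: eq_bigr => k _; rewrite mulrC; congr (_ * _).
  by rewrite iter_rho; elim: (k * m)%N => //= j ->.
have hB : vge v (p%:Z + 1) (B y (w - f)).
  by rewrite -e2; apply: (twisted_sum_ge D m yge abP).
rewrite dE Bp.
have -> : B y w = B y (w - f) + B y f by rewrite twisted_sumBr subrK.
rewrite (_ : p%:Z + 1 + 1 + p.-1%:Z = p%:Z + (p%:Z + 1)); last by rewrite -[in RHS]e2 !addrA.
rewrite (vge_p D) (vgeDl vP _ hB) Bf (vge_unit vP) //.
by apply/negP/sigma_trace_exact.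
Qed.

End TwistedSum.

(** * Integral bases built from a raising operator *)

Section Generator.
Variables (p : nat) (L : fieldType) (v : L -> int) (sigma tau : {rmorphism L -> L}) (s : L).
Hypothesis D : dihedral_valuation p v sigma tau s.

Let p_pr : prime p := dv_prime D.
Let p_odd : odd p := dv_odd D.
Let vP : is_valuation v := dv_val D.
Let v_s : v s = 0 := dv_s D.
Let tau_s : tau s = - s := dv_tau_s D.
Let hp := vge_p1 D.

(** Isolates what the freeness argument needs from scalars of [K], so that bases can be studied
    inside [L] alone. *)
Definition base_like (c : L) : Prop := tau c = c /\ (c == 0 \/ (p %| v c)%Z).

Lemma distinct_classes k (t : 'I_p -> L) :
  (forall i, t i != 0 -> (p %| v (t i) - (1 + i%:Z))%Z) ->
  vge v k (\sum_i t i) -> forall i, vge v k (t i).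
Proof.
move=> ht; apply: (vge_sum_distinct vP) => i j ti tj e.
have := rpredB (ht _ ti) (ht _ tj); rewrite e.
rewrite (_ : _ - _ = j%:Z - i%:Z); last by ring.
rewrite -[_ \in _]/(p %| _)%Z.
rewrite -eqz_mod_dvd !modz_small ?ltz_nat ?ltn_ord // => /eqP[] h.
by apply/val_inj.
Qed.

Variables (w : L -> L) (y : L).
Hypotheses (hw : exact_raising p v s w) (y0 : y != 0) (vy : v y = 1).

(** Coefficients have valuation divisible by [p] and [iter i w y] has valuation [1 + i], so the
    terms occupy distinct classes modulo [p]. *)
Lemma raising_basis k (a : 'I_p -> L) : (forall i, base_like (a i)) ->
  vge v k (\sum_i a i * iter i w y) -> forall i : 'I_p, vge v (k - (1 + i%:Z)) (a i).
Proof.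
move=> ha hs i; have hz (j : 'I_p) := er_iter_exact D hw y0 vy (ltn_ord j).
have [zi0 vzi] := hz i; rewrite -(vgeZ vP _ _ zi0) vzi mulrC addrC subrK.
apply: (@distinct_classes k (fun j => a j * iter j w y)) => // j.
have [zj0 vzj] := hz j; rewrite mulf_eq0 negb_or => /andP[aj0 _].
by rewrite (valM vP) // vzj addrK; case: (ha j) => _ []; rewrite ?(negbTE aj0).
Qed.

(* If c is congruent to an integer n, a + b c can vanish modulo the maximal
   ideal, but then (a + b n) + s (a - b n) does not. *)
Lemma exists_theta c : c != 0 -> v c = 0 ->
  exists theta theta' c0 : L, [/\ theta = 1 /\ theta' = 1 \/ theta = 1 + s /\ theta' = 1 - s,
    exists n m : nat, c0 = n%:R + m%:R * s, vge v 1 (c - c0) &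
    forall k a b, tau a = a -> tau b = b ->
      vge v k (a * theta + b * c0 * theta') = vge v k a && vge v k b].
Proof.
move=> c_neq0 vc; have c_ge : vge v 0 c by rewrite vgeE // vc.
have [n [m nmP]] := residue_decomp D c_ge.
have vtd := vge_tau_decomp p_pr p_odd vP hp (dv_tau D) (dv_s_neq0 D) v_s tau_s.
have [pm|pm] := boolP (p %| m)%N.
  have cn : vge v 1 (c - n%:R).
    rewrite (_ : _ - _ = (c - (n%:R + m%:R * s)) + m%:R * s); last by ring.
    apply: (vgeD vP) => //; apply: (vgeMr vP); first exact: (vge_dvdn vP hp).
    by rewrite vgeE ?(dv_s_neq0 D) // v_s.
  have pn : ~~ (p %| n)%N.
    apply/negP => pn; have h : vge v 1 c.
      by rewrite -(subrK n%:R c); apply: (vgeD vP cn); apply: (vge_dvdn vP hp).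
    by move: h; rewrite vgeE // vc.
  have [n0 vn] := val_natr vP p_pr hp pn.
  exists (1 + s), (1 - s), n%:R; split=> //; first by right.
    by exists n, 0%N; rewrite mul0r addr0.
  move=> k a b ta tb.
  rewrite (_ : _ + _ = (a + n%:R * b) + s * (a - n%:R * b)); last by ring.
  rewrite vtd ?rmorphB ?rmorphD ?rmorphM ?rmorph_nat ?ta ?tb //.
  rewrite -(vge_unit vP k b n0 vn); move: (n%:R * b) => b'.
  apply/andP/andP => -[h1 h2]; last by rewrite (vgeD vP) // (vgeB vP).
  rewrite -(vge_2 p_pr p_odd vP hp k a) -(vge_2 p_pr p_odd vP hp k b').
  rewrite (_ : 2%:R * a = (a + b') + (a - b')); last by ring.
  rewrite (_ : 2%:R * b' = (a + b') - (a - b')); last by ring.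
  by rewrite (vgeD vP) // (vgeB vP).
have [m0 vm] := val_natr vP p_pr hp pm.
exists 1, 1, (n%:R + m%:R * s); split=> //; first by left.
  by exists n, m.
move=> k a b ta tb.
rewrite (_ : a * 1 + b * _ * 1 = (a + n%:R * b) + s * (m%:R * b)); last by ring.
rewrite vtd ?rmorphD ?rmorphM ?rmorph_nat ?ta ?tb // (vge_unit vP) //.
apply: andb_id2r => hb; rewrite (vgeDr vP) //.
by apply: (vgeMl vP) => //; apply: (vge_nat vP).
Qed.

Variable u : L -> L.
Hypothesis uD : forall x x', u (x + x') = u x + u x'.
Hypothesis u_s : forall x, u (s * x) = - (s * u x).
Hypotheses (uy0 : u y != 0) (vuy : v (u y) = 1).

(** As [u] changes the sign of [s], moving [theta] across [u] turns it into [theta']. Modulo higher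
    terms the [i]-th pair is [iter i w y] times [a theta + b d theta'], whose valuation controls [a]
    and [b] by the choice of [theta]. *)
Lemma semilinear_basis : exists2 theta, vge v 0 theta &
  forall k (a b : 'I_p -> L), (forall i, base_like (a i)) -> (forall i, base_like (b i)) ->
  vge v k (\sum_i (a i * iter i w (y * theta) + b i * iter i w (u (y * theta)))) ->
  forall i : 'I_p, vge v (k - (1 + i%:Z)) (a i) /\ vge v (k - (1 + i%:Z)) (b i).
Proof.
pose c := u y / y.
have c0 : c != 0 by rewrite mulf_neq0 ?invr_eq0.
have vc : v c = 0 by rewrite (valM vP) ?invr_eq0 // (valV vP) // vuy vy subrr.
have [theta [theta' [d [hth [n [m dE]] cd hd]]]] := exists_theta c0 vc.
(* [u y] equals [d * y] up to one more unit of valuation, and [w] commutes with multiplication by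
   [d]. *)
pose y1 := u y - d * y.
have y1ge : vge v 2 y1.
  rewrite (_ : y1 = y * (c - d)); last by rewrite /y1 /c mulrBr mulrCA divff // mulr1 [d * y]mulrC.
  by rewrite -[2]/(1 + 1); apply: (vgeM vP) => //; rewrite vgeE // vy.
have s_ge : vge v 0 s by rewrite vgeE ?(dv_s_neq0 D) // v_s.
exists theta.
  by case: hth => -[-> _]; rewrite ?(vgeD vP) ?vge_one.
have wth i : iter i w (y * theta) = theta * iter i w y.
  case: hth => -[-> _]; first by rewrite mulr1 mul1r.
  by rewrite mulrDr mulr1 [y * s]mulrC (er_iterD hw) (er_iter_s hw) mulrDl mul1r.
have wuth i : iter i w (u (y * theta)) = theta' * iter i w (u y).
  case: hth => -[-> ->]; first by rewrite mulr1 mul1r.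
  by rewrite mulrDr mulr1 [y * s]mulrC uD u_s (er_iterB hw) (er_iter_s hw) mulrBl mul1r.
have th'_ge : vge v 0 theta'.
  by case: hth => -[_ ->]; rewrite ?(vgeB vP) ?vge_one.
have wuy i : iter i w (u y) = d * iter i w y + iter i w y1.
  rewrite -[u y](subrK (d * y)) -/y1 (er_iterD hw) addrC; congr (_ + _).
  by rewrite dE mulrDl (er_iterD hw) (er_iter_natr hw) -mulrA (er_iter_natr hw) (er_iter_s hw); ring.
move=> k a b ha hb hs.
pose t (i : 'I_p) := a i * iter i w (y * theta) + b i * iter i w (u (y * theta)).
have hz (j : 'I_p) := er_iter_exact D hw y0 vy (ltn_ord j).
have tE i : t i = iter i w y * (a i * theta + b i * d * theta') + b i * theta' * iter i w y1.
  by rewrite /t wth wuth wuy; ring.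
pose e (i : 'I_p) := a i * theta + b i * d * theta'.
have he i l : vge v l (e i) = vge v l (a i) && vge v l (b i).
  by apply: hd; [case: (ha i) | case: (hb i)].
have te0 i : e i = 0 -> t i = 0.
  move=> ei; have : b i = 0.
    by apply: (vge_eq0 (v := v)) => l; have := he i l; rewrite ei vge_zero => /esym/andP[].
  by rewrite tE -/(e i) ei => ->; rewrite mulr0 !mul0r addr0.
have te i : e i != 0 -> t i != 0 /\ v (t i) = (1 + i%:Z) + v (e i).
  move=> ei0; have [zi0 vzi] := hz i; rewrite tE -/(e i).
  have ze0 : iter i w y * e i != 0 by rewrite mulf_neq0.
  rewrite -vzi -(valM vP) //; apply: (val_dom vP) => //.
  have := he i (v (e i)); rewrite vge_refl => /esym/andP[_ hbi].
  rewrite (valM vP) // vzi.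
  rewrite (_ : 1 + i%:Z + v (e i) + 1 = v (e i) + (2 + i%:Z)); last by ring.
  by apply: (vgeM vP); [apply: (vgeMr vP) | apply: (er_iter_ge D hw)].
have pe i : e i != 0 -> (p %| v (e i))%Z.
  move=> ei0; have := he i (v (e i)); rewrite vge_refl => /esym/andP[h1 h2].
  have := he i (v (e i) + 1); rewrite vgeS // => /esym/negbT.
  rewrite negb_and => /orP[] hn.
    by have [a0 <-] := val_eq h1 hn; case: (ha i) => _ []; rewrite ?(negbTE a0).
  by have [b0 <-] := val_eq h2 hn; case: (hb i) => _ []; rewrite ?(negbTE b0).
move=> i; apply/andP; rewrite -he.
have [->|ei0] := eqVneq (e i) 0; first exact: vge_zero.
have [ti0 vti] := te i ei0.
have := @distinct_classes k t _ hs i; rewrite vgeE // vti [in X in _ -> X]vgeE // lerBlDl => h.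
apply: h => j tj0; have ej0 : e j != 0 by apply: contra tj0 => /eqP/te0->.
by rewrite (proj2 (te j ej0)) addrC addKr pe.
Qed.

End Generator.

(** * The skew brace of a Hopf Galois structure *)

Section FixMod.
Import GroupScope.

Lemma perm_fix_mod (T : finType) (q : nat) (s : {perm T}) (S : {set T}) :
  prime q -> s ^+ q = 1 -> (forall x, x \in S -> s x \in S) ->
  #|S| = #|[set x in S | s x == x]| %[mod q].
Proof.
move=> q_pr sq sS.
have qg : q.-group <[s]>.
  by rewrite /pgroup (pnat_dvd _ (pnat_id q_pr)) // -[#|_|]/#[s] order_dvdn sq.
have act : [acts <[s]>, on S | 'P].
  rewrite cycle_subG; apply/astabsP => x /=; rewrite apermE; apply/idP/idP; last exact: sS.
  move=> sx; have -> : x = iter q.-1 s (s x).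
    by rewrite -iterSr prednK ?prime_gt0 // -permX sq perm1.
  by elim: q.-1 => // i IH; rewrite iterS sS.
rewrite (pgroup_fix_mod qg act); congr (_ %% q)%N; apply: eq_card => x.
by rewrite in_setI afix_cycle ?in_setT // [RHS]inE; congr (_ && _); apply/afix1P/eqP.
Qed.

End FixMod.

Section SkewBrace.
Import GroupScope.
Variables (p : nat) (gT : finGroupType) (sg tau : gT).
Hypotheses (p_pr : prime p) (p_odd : odd p).
Hypotheses (sg_order : #[sg] = p) (card_G : #|{: gT}| = (2 * p)%N).
Hypothesis reflection : forall r, r \notin <[sg]> -> r * r = 1 /\ sg ^ r = sg^-1.
Hypothesis tau_notin : tau \notin <[sg]>.

Variable pi : gT -> gT -> gT.
Hypothesis pi1 : forall x, pi 1 x = x.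
Hypothesis piM : forall s t x, pi (s * t) x = pi t (pi s x).
Hypothesis pi_one : forall s, pi s 1 = 1.

(* The second group law of a skew brace with lambda maps [pi]. *)
Definition star (g h : gT) : gT := pi g^-1 h * g.

Hypothesis pi_star : forall s g h, pi s (star g h) = star (pi s g) (pi s h).
Local Notation A := <[sg]>.

Lemma piK s : cancel (pi s) (pi s^-1).
Proof. by move=> x; rewrite -piM mulgV pi1. Qed.

Lemma pi_inj s : injective (pi s).
Proof. exact: can_inj (piK s). Qed.

Lemma star_pi g h : star g (pi g h) = h * g.
Proof. by rewrite /star piK. Qed.

(* Associativity is a formal consequence of the maps pi g being automorphisms. *)
Lemma starA g h k : star g (star h k) = star (star g h) k.
Proof.
have piV_star : pi g^-1 (star h k) = star (pi g^-1 h) (pi g^-1 k) by rewrite pi_star.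
rewrite {1}/star piV_star {1}/star -mulgA; congr (_ * _).
by rewrite /star invMg piM.
Qed.

Lemma star1 g : star g 1 = g.
Proof. by rewrite /star pi_one mul1g. Qed.

Lemma A_index r r' : r \notin A -> r' \notin A -> r^-1 * r' \in A.
Proof.
move=> rA r'A; have [rr _] := reflection rA; have [rr' _] := reflection r'A.
have rV : r^-1 = r by apply/eqP; rewrite eq_invg_mul rr.
have [//|h] := boolP (r^-1 * r' \in A).
have cA : #|A| = p by rewrite -sg_order.
have rcA : r *: A = ~: A.
  apply/eqP; rewrite eqEcard; apply/andP; split.
    apply/subsetP => _ /lcosetP[a aA ->]; rewrite inE; apply: contra rA => ra.
    by rewrite -(mulgK a r) groupM ?groupV.
  have := cardsC A; rewrite card_G card_lcoset cA mul2n -addnn => /addnI ->.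
  by [].
have : r' \in r *: A by rewrite rcA inE.
by rewrite mem_lcoset (negbTE h).
Qed.

Lemma A_conj a r : a \in A -> a ^ r \in A.
Proof.
move=> aA; have [rA|rA] := boolP (r \in A); first by rewrite groupJ.
have [_ e] := reflection rA; case/cycleP: aA => i ->.
by rewrite conjXg e groupX // groupV cycle_id.
Qed.

Lemma pi_iter i s x : pi (s ^+ i) x = iter i (pi s) x.
Proof. by elim: i x => [|i IH] x; rewrite ?pi1 // expgSr piM IH. Qed.

Lemma pi_fix_A x a : pi sg x = x -> a \in A -> pi a x = x.
Proof. by move=> h /cycleP[i ->]; rewrite pi_iter; elim: i => //= i ->. Qed.

Lemma pi_fix_closed g x : pi sg x = x -> pi sg (pi g x) = pi g x.
Proof.
move=> h; rewrite -piM (conjgCV g sg) piM [pi (sg ^ _) x]pi_fix_A //.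
by apply: A_conj; apply: cycle_id.
Qed.

Definition pi_perm s : {perm gT} := perm (@pi_inj s).

Lemma pi_permX s i : s ^+ i = 1 -> pi_perm s ^+ i = 1.
Proof.
move=> si; apply/permP => x; rewrite permX perm1 -[RHS](pi1 x) -si pi_iter.
by apply: eq_iter => z; rewrite permE.
Qed.

Let F := [set x | pi sg x == x].

(** The fixed points form a subgroup, because the group product is [star] twisted by [pi], and their
    number is divisible by [p]. A subgroup of order [p] contains no reflection, hence is [A]. *)
Lemma pi_sg_fix_cases : (forall x, pi sg x = x) \/ F = A.
Proof.
have [/forallP h|] := boolP [forall x, pi sg x == x]; first by left=> x; apply/eqP.
rewrite negb_forall => /existsP[x0 x0N]; right.
have gF : group_set F.
  apply/group_setP; split=> [|h g]; first by rewrite inE pi_one.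
  rewrite !inE => /eqP hh /eqP hg; apply/eqP.
  by rewrite -star_pi pi_star hg pi_fix_closed.
have pF : (p %| #|F|)%N.
  have sgp : pi_perm sg ^+ p = 1 by rewrite pi_permX // -sg_order expg_order.
  have := @perm_fix_mod _ p (pi_perm sg) setT p_pr sgp (fun x _ => in_setT _).
  rewrite cardsT card_G modnMl (_ : [set x in _ | _] = F); last first.
    by apply/setP => x; rewrite !inE permE.
  by move/esym/eqP.
have F_lt : (#|F| < 2 * p)%N.
  rewrite -card_G -cardsT; apply: proper_card; rewrite properT.
  by apply/eqP => FT; move: x0N; have := in_setT x0; rewrite -FT inE => ->.
have F_gt0 : (0 < #|F|)%N by apply/card_gt0P; exists 1; rewrite inE pi_one.
have cF : #|F| = p.
  by case/dvdnP: pF F_lt F_gt0 => -[|[|k]] -> //; rewrite ?mul1n // ltn_mul2r ltnNge andbF.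
apply/eqP; rewrite eqEcard cF -[#|A|]/#[sg] sg_order leqnn andbT.
apply/subsetP => f fF; apply/negPn/negP => fA.
have [ff _] := reflection fA.
have : (#[f] %| gcdn 2 p)%N.
  rewrite dvdn_gcd order_dvdn expgS expg1 ff eqxx /= -cF.
  exact: (@order_dvdG _ (Group gF)).
have -> : gcdn 2 p = 1%N by apply/eqP; rewrite -/(coprime 2 p) coprime2n.
by rewrite dvdn1 order_eq1 => /eqP f1; move: fA; rewrite f1 group1.
Qed.

Lemma pi_sg_A a : a \in A -> pi sg a = a.
Proof. by case: pi_sg_fix_cases => [h _ //|<-]; rewrite inE => /eqP. Qed.

Lemma pi_A_A s a : s \in A -> a \in A -> pi s a = a.
Proof. by move=> sA /pi_sg_A h; apply: pi_fix_A. Qed.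

Lemma pi_A_mul s h a : s \in A -> a \in A -> pi s (h * a) = pi s h * a.
Proof.
move=> sA aA; rewrite -(star_pi a h) pi_star (pi_A_A sA aA) -piM -(star_pi a (pi s h)).
have : commute a s by apply: (centsP (cycle_abelian sg)).
by move=> ->; rewrite piM.
Qed.

Lemma tau_invol : tau * tau = 1.
Proof. by case: (reflection tau_notin). Qed.

Lemma pi_tauK x : pi tau (pi tau x) = x.
Proof. by rewrite -piM tau_invol pi1. Qed.

(** If [sg] acts trivially and [pi tau sg] were a reflection [r], then [pi r = pi tau], so [pi tau]
    would send [sg ^+ k.+1] to [sg ^+ k * r]; at [k = p - 1] this gives [sg ^+ k * r = 1], which
    puts [r] in [A]. *)
Lemma pi_tau_sg : pi tau sg \in A.
Proof.
case: pi_sg_fix_cases => [h|FA]; last first.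
  by rewrite -FA inE pi_fix_closed // pi_sg_A ?cycle_id.
apply/negPn/negP => rA; set r := pi tau sg in rA.
have pi_r x : pi r x = pi tau x.
  by rewrite -[r](mulKVg tau) piM (pi_fix_A (h _) (A_index tau_notin rA)).
have e k : pi tau (sg ^+ k.+1) = sg ^+ k * r.
  by rewrite expgSr -star_pi h pi_star -/r -pi_r star_pi.
have := e p.-1; rewrite prednK ?prime_gt0 // -sg_order expg_order pi_one => /esym/eqP.
rewrite -eq_invg_mul => /eqP re; move: rA; by rewrite -re groupV groupX ?cycle_id.
Qed.

Lemma pi_tau_sgX i : pi tau (sg ^+ i) = pi tau sg ^+ i.
Proof.
elim: i => [|i IH]; first by rewrite !expg0 pi_one.
have sgiA : sg ^+ i \in A by rewrite groupX ?cycle_id.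
rewrite expgS -star_pi (pi_A_A sgiA) ?cycle_id // pi_star IH.
rewrite expgS -(star_pi (pi tau sg ^+ i) (pi tau sg)).
by rewrite (pi_A_A (s := pi tau sg ^+ i)) ?groupX ?pi_tau_sg.
Qed.

(** [pi tau] restricts to an involutive automorphism of the cyclic group [A], so its exponent
    squares to 1 modulo [p]. *)
Lemma pi_tau_sg_pm : pi tau sg = sg \/ pi tau sg = sg^-1.
Proof.
have /cycleP[j jE] := pi_tau_sg.
have := pi_tauK sg; rewrite jE pi_tau_sgX jE -expgM -[X in _ = X]expg1 => /eqP.
rewrite eq_expg_mod_order sg_order => jj.
have p0 := prime_gt0 p_pr.
have : (p %| (j + p.-1) * (j + 1))%N.
  rewrite (_ : ((j + p.-1) * (j + 1) = j * j + p.-1 + j * p)%N); last first.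
    by rewrite -{3}(prednK p0); ring.
  rewrite dvdn_addl ?dvdn_mull // /dvdn -modnDml (eqP jj) modnDml add1n prednK // modnn.
  by [].
rewrite Euclid_dvdM // => /orP[] h; [left|right].
  rewrite -[RHS]expg1; apply/eqP; rewrite eq_expg_mod_order sg_order.
  by rewrite -(eqn_modDr p.-1) add1n prednK // modnn; exact: h.
apply/eqP; rewrite eq_sym eq_invg_mul -expgS -order_dvdn sg_order -addn1; exact: h.
Qed.

(** [pi tau] is an involution on the set of [p] reflections, and [p] is odd. *)
Lemma exists_tau_fixed : exists2 r, r \notin A & pi tau r = r.
Proof.
have sA r : r \in ~: A -> pi_perm tau r \in ~: A.
  rewrite !inE permE; apply: contra => /cycleP[i e].
  rewrite -(pi_tauK r) e pi_tau_sgX groupX // pi_tau_sg //.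
have t2 : pi_perm tau ^+ 2 = 1 by rewrite pi_permX // expgS expg1 tau_invol.
have := @perm_fix_mod _ 2 _ _ isT t2 sA.
have -> : #|~: A| = p.
  have := cardsC A; rewrite card_G -[#|A|]/#[sg] sg_order mul2n -addnn => /addnI //.
rewrite !modn2 p_odd; set S := [set x in _ | _] => oS.
have /card_gt0P[r] : (0 < #|S|)%N by case: #|S| oS.
by rewrite !inE permE => /andP[rA /eqP rr]; exists r.
Qed.

Lemma star_surj g k : exists h, star g h = k.
Proof. by exists (pi g (k * g^-1)); rewrite star_pi mulgKV. Qed.

Theorem skew_brace_structure :
  [/\ forall a, a \in A -> pi sg a = a,
      pi tau sg = sg \/ pi tau sg = sg^-1 &
      exists r m, [/\ r \notin A, pi tau r = r, m != 1 %[mod p] &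
        forall i, pi (sg ^+ i) r = r * sg ^+ (m * i)]].
Proof.
split; [exact: pi_sg_A | exact: pi_tau_sg_pm |].
have [r rA rt] := exists_tau_fixed; have sgA := cycle_id sg.
have srA : pi sg r \notin A.
  by apply: contra rA => h; rewrite -(piK sg r) pi_A_A ?groupV.
have /cycleP[m mE] := A_index rA srA.
have {}mE : pi sg r = r * sg ^+ m by rewrite -mE mulKVg.
exists r, m; split=> // [|i].
  (* For [m = 1], left [star] by [sg] fixes [pi sg r], and cancelling in the second group gives
     [sg = 1]. *)
  apply/eqP => m1.
  have m1' : sg ^+ m = sg.
    by apply/eqP; rewrite -[X in _ == X]expg1 eq_expg_mod_order sg_order m1.
  have e : star sg (pi sg r) = pi sg r by rewrite star_pi mE m1'.
  have [k kE] := star_surj (pi sg r) 1.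
  have : sg = 1 by rewrite -[sg]star1 -kE starA e.
  by move/eqP; rewrite -order_eq1 sg_order => /eqP p1; have := prime_gt1 p_pr; rewrite p1.
rewrite pi_iter; elim: i => [|i IH]; first by rewrite muln0 mulg1.
by rewrite iterS IH pi_A_mul ?groupX // mE -mulgA -expgD mulnS.
Qed.

End SkewBrace.

(** * Square linear systems indexed by finite types *)

Section SquareSystem.
Variables (F : fieldType) (I T : finType) (A : I -> T -> F).

Let MA := \matrix_(a < #|I|, b < #|T|) A (enum_val a) (enum_val b).

Definition rows_free := forall l : I -> F, (forall t, \sum_i l i * A i t = 0) -> forall i, l i = 0.

Lemma rows_free_mx : rows_free -> row_free MA.
Proof.
move=> rf; apply: inj_row_free => u uM; apply/rowP => a; rewrite mxE.
rewrite -[a]enum_valK; apply: (rf (fun i => u 0 (enum_rank i))) => t.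
transitivity ((u *m MA) 0 (enum_rank t)); last by rewrite uM mxE.
rewrite mxE (reindex_onto enum_rank enum_val) => [|i _]; last by rewrite enum_valK.
by apply: eq_big => [i|i _]; rewrite ?enum_rankK ?eqxx // mxE !enum_rankK.
Qed.

Lemma rows_free_leq : rows_free -> (#|I| <= #|T|)%N.
Proof. by move=> /rows_free_mx/eqP <-; apply: rank_leq_col. Qed.

Lemma rows_span_leq : (forall c : T -> F, exists l : I -> F, forall t, c t = \sum_i l i * A i t) ->
  (#|T| <= #|I|)%N.
Proof.
move=> sp; suff /eqP <- : row_full MA by apply: rank_leq_row.
rewrite -sub1mx; apply/row_subP => a.
have [l lE] := sp (fun t => row a 1%:M 0 (enum_rank t)).
apply/submxP; exists (\row_b l (enum_val b)); apply/rowP => b.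
rewrite -[b in LHS]enum_valK lE mxE (reindex_onto enum_rank enum_val) => [|i _]; last by rewrite enum_valK.
by apply: eq_big => [i|i _]; rewrite ?enum_rankK ?eqxx // !mxE !enum_rankK.
Qed.

Hypothesis card_IT : #|I| = #|T|.

Lemma rows_free_solve : rows_free ->
  forall c : T -> F, exists l : I -> F, forall t, c t = \sum_i l i * A i t.
Proof.
move=> rf c; have full : row_full MA.
  by move: (rows_free_mx rf); rewrite /row_free /row_full => /eqP ->; apply/eqP.
have /submxP[D DE] := submx_full (\row_b c (enum_val b)) full.
exists (fun i => D 0 (enum_rank i)) => t.
move/rowP/(_ (enum_rank t)): DE; rewrite !mxE enum_rankK => ->.
rewrite (reindex_onto enum_rank enum_val) => [|i _]; last by rewrite enum_valK.
by apply: eq_big => [i|i _]; rewrite ?enum_rankK ?eqxx // mxE !enum_rankK.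
Qed.

Lemma rows_free_cols : rows_free ->
  forall d : T -> F, (forall i, \sum_t A i t * d t = 0) -> forall t, d t = 0.
Proof.
move=> rf d hd t; have [l lE] := rows_free_solve rf (fun t' => (t' == t)%:R).
have : \sum_t' (t' == t)%:R * d t' = 0.
  under eq_bigr => t' _ do rewrite lE mulr_suml.
  rewrite exchange_big big1 //= => i _.
  by under eq_bigr => t' _ do rewrite -mulrA; rewrite -mulr_sumr hd mulr0.
rewrite (bigD1 t) //= eqxx mul1r big1 ?addr0 // => t' /negbTE->; exact: mul0r.
Qed.

End SquareSystem.

Section LinearOfBasis.
Variables (K : fieldType) (M : vectType K) (m : 'I_(\dim {:M}) -> M).

Definition lin_basis (x : M) : M := \sum_q coord (vbasis {:M}) q x *: m q.

Fact lin_basis_linear : linear lin_basis.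
Proof.
move=> a x y; rewrite /lin_basis scaler_sumr -big_split /=; apply: eq_bigr => q _.
by rewrite linearP scalerDl scalerA.
Qed.

HB.instance Definition _ := GRing.isLinear.Build K M M *:%R lin_basis lin_basis_linear.

Lemma lin_basisE (q : 'I_(\dim {:M})) : linfun lin_basis (tnth (vbasis {:M}) q) = m q.
Proof.
rewrite lfunE /= /lin_basis (bigD1 q) //= (tnth_nth 0) coord_free ?eqxx ?scale1r; last first.
  exact: basis_free (vbasisP _).
rewrite big1 ?addr0 // => r /negbTE rq.
by rewrite coord_free ?(basis_free (vbasisP _)) // eq_sym rq scale0r.
Qed.

Lemma vbasis_expand (x : M) : x = \sum_q coord (vbasis {:M}) q x *: tnth (vbasis {:M}) q.
Proof.
rewrite {1}(coord_vbasis (memvf x)); apply: eq_bigr => q _.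
by rewrite (tnth_nth 0).
Qed.

End LinearOfBasis.

(** * The dimension of the Hopf algebra *)

Section HopfDim.
Variables (K : fieldType) (n : nat) (H : hopf_data K n) (M : fieldExtType K) (act : 'I_n -> 'End(M)).
Hypothesis hgs : hopf_galois_structure H act.

Local Notation d := (\dim {:M}).
Local Notation b := (tnth (vbasis {:M})).

Lemma hopf_inj (c : 'I_d -> 'I_n -> K) :
  (forall y, \sum_e \sum_i c e i *: (b e * act i y) = 0) -> forall e i, c e i = 0.
Proof. by case: hgs => _ [_ [_ [_ [_ [h _]]]]]; apply: h. Qed.

Lemma hopf_surj (f : 'End(M)) : exists c : 'I_d -> 'I_n -> K,
  forall y, f y = \sum_e \sum_i c e i *: (b e * act i y).
Proof. by case: hgs => _ [_ [_ [_ [_ [_ h]]]]]; apply: h. Qed.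

(** Expanding the coefficients on a basis of [M] reduces independence over [M] to injectivity of
    [M (x) H -> End(M)]. *)
Lemma hopf_free (l : 'I_n -> M) :
  (forall x, \sum_i l i * act i x = 0) -> forall i, l i = 0.
Proof.
move=> hl i; rewrite [l i]vbasis_expand big1 // => e _.
rewrite (hopf_inj (c := fun e i => coord (vbasis {:M}) e (l i))) ?scale0r // => x.
rewrite -[RHS](hl x) exchange_big; apply: eq_bigr => j _ /=.
rewrite {2}[l j]vbasis_expand mulr_suml; apply: eq_bigr => q _.
by rewrite scalerAl.
Qed.

(** The two halves of bijectivity compare [d * n] with [d * d]; the rows of [A] are the matrices of
    the endomorphisms attached to a basis of [M (x) H]. *)
Lemma hopf_dim : n = d.
Proof.
pose A (ei : 'I_d * 'I_n) (qr : 'I_d * 'I_d) : K :=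
  coord (vbasis {:M}) qr.2 (b ei.1 * act ei.2 (b qr.1)).
have sumA (c : 'I_d -> 'I_n -> K) qr : \sum_ei c ei.1 ei.2 * A ei qr =
    coord (vbasis {:M}) qr.2 (\sum_e \sum_i c e i *: (b e * act i (b qr.1))).
  rewrite pair_big /= linear_sum; apply: eq_bigr => ei _; by rewrite linearZ.
have d0 : (0 < d)%N by apply: adim_gt0.
have le1 : (#|{: 'I_d * 'I_n}| <= #|{: 'I_d * 'I_d}|)%N.
  apply: (@rows_free_leq _ _ _ A) => l hl [e i].
  apply: (hopf_inj (c := fun e i => l (e, i))) => y.
  have hq q : \sum_e' \sum_i' l (e', i') *: (b e' * act i' (b q)) = 0 :> M.
    rewrite [LHS]vbasis_expand big1 // => r _.
    rewrite -(sumA (fun e i => l (e, i)) (q, r)) /=.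
    rewrite [X in X *: _](_ : _ = 0) ?scale0r // -[RHS](hl (q, r)).
    by apply: eq_bigr => -[].
  rewrite [y]vbasis_expand; under eq_bigr => e' _ do under eq_bigr => i' _ do
    rewrite linear_sum mulr_sumr scaler_sumr.
  under eq_bigr => e' _ do rewrite exchange_big.
  rewrite exchange_big big1 //= => q _.
  transitivity (coord (vbasis {:M}) q y *: \sum_e' \sum_i' l (e', i') *: (b e' * act i' (b q))).
    rewrite scaler_sumr; apply: eq_bigr => e' _; rewrite scaler_sumr; apply: eq_bigr => i' _.
    by rewrite linearZ /= -scalerAr !scalerA mulrC.
  by rewrite hq scaler0.
have le2 : (#|{: 'I_d * 'I_d}| <= #|{: 'I_d * 'I_n}|)%N.
  apply: (@rows_span_leq _ _ _ A) => c.
  have [l lE] := hopf_surj (linfun (lin_basis (fun q => \sum_r c (q, r) *: b r))).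
  exists (fun ei => l ei.1 ei.2) => -[q r]; rewrite sumA /= -lE lin_basisE linear_sum (bigD1 r) //=.
  rewrite linearZ /= (tnth_nth 0) coord_free ?(basis_free (vbasisP _)) // eqxx mulr1.
  rewrite big1 ?addr0 // => r' /negbTE rr.
  by rewrite linearZ /= (tnth_nth 0) coord_free ?(basis_free (vbasisP _)) // rr mulr0.
have /andP := conj le1 le2; rewrite -eqn_leq !card_prod !card_ord eqn_pmul2l //.
by move/eqP.
Qed.

End HopfDim.

(** * Hopf actions in the basis of embeddings, and Galois descent *)

Section HopfCoeff.
Variables (K : fieldType) (n : nat) (H : hopf_data K n).
Variables (M : fieldExtType K) (L : splittingFieldType K) (act : 'I_n -> 'End(M)).
Hypothesis hgs : hopf_galois_structure H act.
Hypothesis galL : galois 1%AS {:L}.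

Variables (T : finType) (iota : M -> L) (eps : T -> M -> L).
Hypothesis card_T : #|T| = \dim {:M}.
Hypothesis iota_lin : forall a x y, iota (a *: x + y) = a *: iota x + iota y.
Hypothesis iotaM : forall x y, iota (x * y) = iota x * iota y.
Hypothesis eps_lin : forall t a x y, eps t (a *: x + y) = a *: eps t x + eps t y.
Hypothesis epsM : forall t x y, eps t (x * y) = eps t x * eps t y.
Hypothesis eps_free : forall c : T -> L,
  (forall x, \sum_t c t * eps t x = 0) -> forall t, c t = 0.
Hypothesis act_free : forall l : 'I_n -> L,
  (forall x, \sum_i l i * iota (act i x) = 0) -> forall i, l i = 0.

Local Notation b := (tnth (vbasis {:M})).

Lemma lin_sum (f : M -> L) (I : Type) (r : seq I) (c : I -> K) (m : I -> M) :
  (forall a x y, f (a *: x + y) = a *: f x + f y) ->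
  f (\sum_(i <- r) c i *: m i) = \sum_(i <- r) c i *: f (m i).
Proof.
move=> hf; have f0 : f 0 = 0.
  have := hf (-1) 0 0; rewrite scaler0 add0r scaleN1r addNr; exact.
by elim: r => [|i r IH]; rewrite ?big_nil // !big_cons hf IH.
Qed.

(** Independent embeddings in number [\dim {:M}] form an [L]-basis of the [K]-linear maps from [M]
    to [L]. The setting covers both [M = L] and [M] of degree [p]. *)
Lemma eps_span (f : M -> L) : (forall a x y, f (a *: x + y) = a *: f x + f y) ->
  exists c : T -> L, forall x, f x = \sum_t c t * eps t x.
Proof.
move=> hf; have card_Td : #|T| = #|'I_(\dim {:M})| by rewrite card_ord.
have rf : rows_free (fun t (q : 'I_(\dim {:M})) => eps t (b q)).
  move=> c hc; apply: eps_free => x; rewrite [x]vbasis_expand.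
  under eq_bigr => t _ do rewrite (lin_sum _ _ _ (eps_lin t)) mulr_sumr.
  rewrite exchange_big big1 //= => q _.
  under eq_bigr => t _ do rewrite -scalerAr.
  by rewrite -scaler_sumr hc scaler0.
have [c cE] := rows_free_solve card_Td rf (fun q => f (b q)).
exists c => x; rewrite [x]vbasis_expand (lin_sum _ _ _ hf).
under [RHS]eq_bigr => t _ do rewrite (lin_sum _ _ _ (eps_lin t)) mulr_sumr.
rewrite exchange_big; apply: eq_bigr => q _ /=; rewrite cE scaler_sumr.
by apply: eq_bigr => t _; rewrite scalerAr.
Qed.

Lemma actH_basis k x : actH act (fun i => (i == k)%:R) x = act k x.
Proof.
rewrite /actH (bigD1 k) //= eqxx scale1r big1 ?addr0 // => i /negbTE->.
exact: scale0r.
Qed.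

Lemma act_mul k x y : act k (x * y) = \sum_i \sum_j hcomul H k i j *: (act i x * act j y).
Proof.
case: hgs => _ [_ [_ [hM _]]]; rewrite -actH_basis hM.
apply: eq_bigr => i _; apply: eq_bigr => j _; congr (_ *: _).
rewrite /comulH (bigD1 k) //= eqxx mul1r big1 ?addr0 // => l /negbTE->.
exact: mul0r.
Qed.

Lemma iota_sum (I : Type) (r : seq I) (c : I -> K) (m : I -> M) :
  iota (\sum_(i <- r) c i *: m i) = \sum_(i <- r) c i *: iota (m i).
Proof. exact: lin_sum iota_lin. Qed.

Section Coefficients.
Variable C : 'I_n -> T -> L.
Hypothesis CE : forall i x, iota (act i x) = \sum_t C i t * eps t x.

Lemma coeff_free : rows_free C.
Proof.
move=> l hl; apply: act_free => x.
under eq_bigr => i _ do rewrite CE mulr_sumr.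
rewrite exchange_big big1 //= => t _.
by under eq_bigr => i _ do rewrite mulrA; rewrite -mulr_suml hl mul0r.
Qed.

Lemma card_nT : #|'I_n| = #|T|.
Proof. by rewrite card_ord card_T (hopf_dim hgs). Qed.

Lemma coeff_cols (d : T -> L) : (forall i, \sum_t C i t * d t = 0) -> forall t, d t = 0.
Proof. exact: (rows_free_cols card_nT coeff_free). Qed.

Lemma coeff_inj t t' : (forall i, C i t = C i t') -> t = t'.
Proof.
move=> h; apply/eqP/negPn/negP => tt'.
have := coeff_cols (d := fun t1 => (t1 == t)%:R - (t1 == t')%:R).
move=> /(_ _ t); rewrite eqxx (negbTE tt') subr0 => hh.
suff /eqP : (1 : L) = 0 by rewrite oner_eq0.
apply: hh => i; under eq_bigr => t1 _ do rewrite mulrBr.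
rewrite sumrB [X in X - _](bigD1 t) //= [X in _ - X](bigD1 t') //= !eqxx !mulr1 h.
rewrite !big1 ?addr0 ?subrr // => t1 /negbTE->; exact: mulr0.
Qed.

(* The columns of C are the algebra homomorphisms from the dual of H to L. *)
Lemma coeff_mul k t t' :
  \sum_i \sum_j hcomul H k i j *: (C i t * C j t') = (t == t')%:R * C k t.
Proof.
apply/eqP; rewrite -subr_eq0; apply/eqP; move: t t'.
pose W t t' := \sum_i \sum_j hcomul H k i j *: (C i t * C j t') - (t == t')%:R * C k t.
suff WE x y : \sum_t' (\sum_t W t t' * eps t x) * eps t' y = 0.
  move=> t t'; apply: (eps_free (c := W^~ t')) => x.
  by apply: (eps_free (c := fun t' => \sum_t W t t' * eps t x)) => y.
have e1 : \sum_t' (\sum_t (\sum_i \sum_j hcomul H k i j *: (C i t * C j t')) * eps t x) * eps t' y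
  = iota (act k (x * y)).
  rewrite act_mul (_ : \sum_i _ = \sum_ij hcomul H k ij.1 ij.2 *: (act ij.1 x * act ij.2 y)); last first.
    by rewrite pair_big.
  rewrite iota_sum.
  under [RHS]eq_bigr => ij _ do rewrite iotaM !CE mulr_sumr scaler_sumr.
  rewrite [RHS]exchange_big; apply: eq_bigr => t' _ /=.
  rewrite mulr_suml; under [LHS]eq_bigr => t _ do rewrite pair_big /= !mulr_suml.
  rewrite [LHS]exchange_big; apply: eq_bigr => ij _ /=.
  rewrite mulr_suml scaler_sumr; apply: eq_bigr => t _.
  by rewrite -!scalerAl; congr (_ *: _); ring.
have e2 : \sum_t' (\sum_t ((t == t')%:R * C k t) * eps t x) * eps t' y = iota (act k (x * y)).
  rewrite CE; apply: eq_bigr => t' _; rewrite (bigD1 t') //= eqxx mul1r big1 => [|t /negbTE->].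
    by rewrite addr0 epsM mulrA.
  by rewrite !mul0r.
rewrite -[RHS](subrr (iota (act k (x * y)))) -{1}e1 -e2 -sumrB; apply: eq_bigr => t' _.
by rewrite -mulrBl -sumrB; congr (_ * _); apply: eq_bigr => t _; rewrite -mulrBl.
Qed.

(** Applying [g] to a column gives another homomorphism, expanded on the columns with coefficients
    [a]. Multiplicativity makes the entries of [a] idempotent and orthogonal down each column, so
    [a] is a permutation matrix. *)
Lemma coeff_gal (g : gal_of {:L}) : exists f : T -> T,
  injective f /\ forall i t, g (C i t) = C i (f t).
Proof.
have /fin_all_exists[a aE] t : exists d : T -> L, forall i, g (C i t) = \sum_t' C i t' * d t'.
  have cT : #|T| = #|'I_n| by rewrite card_nT.
  have rf : rows_free (fun t i => C i t).
    by move=> l hl; apply: coeff_cols => i; rewrite -[RHS](hl i); apply: eq_bigr => t' _; rewrite mulrC.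
  have [d dE] := rows_free_solve cT rf (fun i => g (C i t)).
  by exists d => i; rewrite dE; apply: eq_bigr => t' _; rewrite mulrC.
have orth t1 t2 t' : a t1 t' * a t2 t' = (t1 == t2)%:R * a t1 t'.
  apply/eqP; rewrite -subr_eq0; apply/eqP.
  apply: (coeff_cols (d := fun t' => a t1 t' * a t2 t' - (t1 == t2)%:R * a t1 t')) => k.
  under eq_bigr => t _ do rewrite mulrBr.
  rewrite sumrB; apply/eqP; rewrite subr_eq0; apply/eqP.
  transitivity (g (\sum_i \sum_j hcomul H k i j *: (C i t1 * C j t2))); last first.
    rewrite coeff_mul rmorphM rmorph_nat /= aE mulr_sumr; apply: eq_bigr => t _; ring.
  rewrite pair_big /= rmorph_sum /=.
  have e (ij : 'I_n * 'I_n) : g (hcomul H k ij.1 ij.2 *: (C ij.1 t1 * C ij.2 t2)) =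
    \sum_t \sum_u a t1 t * a t2 u * (hcomul H k ij.1 ij.2 *: (C ij.1 t * C ij.2 u)).
    rewrite linearZ /= rmorphM /= !aE mulr_suml scaler_sumr; apply: eq_bigr => t _.
    rewrite mulr_sumr scaler_sumr; apply: eq_bigr => u _.
    by rewrite -scalerAr; congr (_ *: _); ring.
  under [RHS]eq_bigr => ij _ do rewrite e.
  rewrite [RHS]exchange_big; apply: eq_bigr => t _ /=.
  rewrite [RHS]exchange_big /= (bigD1 t) //= [X in _ = _ + X]big1 => [|u ut].
    rewrite addr0 -mulr_sumr -(pair_big xpredT xpredT (fun i j => hcomul H k i j *: (C i t * C j t))) /=.
    by rewrite coeff_mul eqxx mul1r mulrC.
  rewrite -mulr_sumr -(pair_big xpredT xpredT (fun i j => hcomul H k i j *: (C i t * C j u))) /=.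
  by rewrite coeff_mul eq_sym (negbTE ut) mul0r mulr0.
have /fin_all_exists[f fE] t : exists t', a t t' != 0.
  apply: NNPP => none.
  have a0 t' : a t t' = 0 by apply/eqP/negPn/negP => h; apply: none; exists t'.
  have C0 i : C i t = 0.
    have : g (C i t) = 0 by rewrite aE big1 // => t' _; rewrite a0 mulr0.
    by move/eqP; rewrite fmorph_eq0 => /eqP.
  have := coeff_cols (d := fun t' => (t' == t)%:R) _ t; rewrite eqxx => h.
  suff /eqP : (1 : L) = 0 by rewrite oner_eq0.
  apply: h => i; rewrite big1 // => t' _; case: eqP => [->|]; by rewrite ?C0 ?mul0r ?mulr0.
have f1 t : a t (f t) = 1.
  by apply: (mulfI (fE t)); rewrite orth eqxx mul1r mulr1.
have f_inj : injective f.
  move=> t1 t2 ft; apply/eqP/negPn/negP => t12.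
  have := orth t1 t2 (f t1); rewrite {2}ft !f1 (negbTE t12) mul0r mulr1 => /eqP.
  by rewrite oner_eq0.
exists f; split=> // i t; rewrite aE (bigD1 (f t)) //= f1 mulr1 big1 ?addr0 // => t' t'N.
have [f' fK f'K] := injF_bij f_inj.
have h1 := f1 (f' t'); rewrite f'K in h1.
have := orth t (f' t') t'; rewrite h1 mulr1.
have /negbTE -> : t != f' t' by apply: contra t'N => /eqP->; rewrite f'K.
by rewrite mul0r => ->; rewrite mulr0.
Qed.

(** The coordinates of [c] on the rows of [C] are unique and equivariance makes them Galois
    invariant, hence in [K]. This is how elements of the Hopf algebra are produced. *)
Lemma coeff_descent (pi : gal_of {:L} -> T -> T) :
  (forall g, injective (pi g)) -> (forall (g : gal_of {:L}) i t, g (C i t) = C i (pi g t)) ->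
  forall c : T -> L, (forall (g : gal_of {:L}) t, g (c t) = c (pi g t)) ->
  exists a : 'I_n -> K, forall t, c t = \sum_i (a i)%:A * C i t.
Proof.
move=> pi_inj piE c cE; have [l lE] := rows_free_solve card_nT coeff_free c.
have lg i (g : gal_of {:L}) : g (l i) = l i.
  apply/eqP; rewrite -subr_eq0; apply/eqP.
  apply: (coeff_free (l := fun i => g (l i) - l i)) => t.
  have [f fK f'K] := injF_bij (pi_inj g); rewrite -(f'K t).
  under eq_bigr => j _ do rewrite mulrBl.
  rewrite sumrB -lE -cE lE rmorph_sum /=; apply/eqP; rewrite subr_eq0; apply/eqP.
  by apply: eq_bigr => j _; rewrite rmorphM /= piE.
have /fin_all_exists[a aE] i : exists a : K, l i = a%:A by apply: (gal_fixed_alg galL) => g.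
by exists a => t; rewrite lE; apply: eq_bigr => i _; rewrite aE.
Qed.

Lemma iota_actH (a : 'I_n -> K) x :
  iota (actH act a x) = \sum_t (\sum_i (a i)%:A * C i t) * eps t x.
Proof.
rewrite /actH iota_sum; under [RHS]eq_bigr => t _ do rewrite mulr_suml.
rewrite exchange_big; apply: eq_bigr => i _ /=.
rewrite CE scaler_sumr; apply: eq_bigr => t _.
by rewrite -mulrA mulr_algl.
Qed.

Lemma coeff_pi_mul (pi : gal_of {:L} -> T -> T) :
  (forall (g : gal_of {:L}) i t, g (C i t) = C i (pi g t)) ->
  (forall t, pi 1%g t = t) /\ forall g h t, pi (g * h)%g t = pi h (pi g t).
Proof.
move=> piE; split=> [t|g h t]; apply: coeff_inj => i; rewrite -!piE ?gal_id //.
by rewrite galM ?memvf.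
Qed.

(** The unit of [H] acts as the identity, so its coefficient function is the indicator of [t0]. Its
    coordinates lie in [K], so conjugating by [g] forces the value 1 at [pi g t0] too. *)
Lemma coeff_pi_unit (pi : gal_of {:L} -> T -> T) t0 :
  (forall (g : gal_of {:L}) i t, g (C i t) = C i (pi g t)) -> (forall x, eps t0 x = iota x) ->
  forall g, pi g t0 = t0.
Proof.
move=> piE e0 g.
have uE t : \sum_i (hunit H i)%:A * C i t = (t == t0)%:R.
  apply/eqP; rewrite -subr_eq0; apply/eqP.
  apply: (eps_free (c := fun t => \sum_i (hunit H i)%:A * C i t - (t == t0)%:R)) => x.
  under eq_bigr => t1 _ do rewrite mulrBl.
  rewrite sumrB -iota_actH; case: hgs => _ [_ [-> _]].
  rewrite (bigD1 t0) //= eqxx mul1r e0 big1 ?addr0 ?subrr // => t1 /negbTE->; exact: mul0r.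
have := congr1 (g : L -> L) (uE t0); rewrite rmorph_sum /= eqxx rmorph1.
under eq_bigr => i _ do rewrite rmorphM /= gal_alg piE.
rewrite uE; case: eqP => // _ /eqP; by rewrite eq_sym oner_eq0.
Qed.

End Coefficients.

Lemma hopf_coeffs : exists (C : 'I_n -> T -> L) (pi : gal_of {:L} -> T -> T),
  [/\ forall i x, iota (act i x) = \sum_t C i t * eps t x,
      forall g, injective (pi g) & forall (g : gal_of {:L}) i t, g (C i t) = C i (pi g t)].
Proof.
have /fin_all_exists[C CE] i : exists c : T -> L, forall x, iota (act i x) = \sum_t c t * eps t x.
  by apply: eps_span => a x y; rewrite linearP iota_lin.
have /fin_all_exists[pi piP] (g : gal_of {:L}) : exists f : T -> T,
    injective f /\ forall i t, g (C i t) = C i (f t) by apply: coeff_gal.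
by exists C, pi; split=> // [g|g i t]; case: (piP g).
Qed.

End HopfCoeff.

(** * Freeness over the associated order *)

Section FreenessCriterion.
Variables (K : fieldType) (abs : K -> rat) (n : nat) (H : hopf_data K n).
Variables (M : fieldExtType K) (act : 'I_n -> 'End(M)).
Hypothesis hgs : hopf_galois_structure H act.
Hypotheses (int0 : integral abs (0 : M))
  (intD : forall x y : M, integral abs x -> integral abs y -> integral abs (x + y)).

Variables (J : finType) (w : J -> 'I_n -> K) (x0 : M).
Hypothesis card_J : #|J| = n.

Lemma actH_comb (c : J -> K) z :
  actH act (fun i => \sum_j c j * w j i) z = \sum_j c j *: actH act (w j) z.
Proof.
rewrite /actH; under eq_bigr => i _ do rewrite scaler_suml.
rewrite exchange_big; apply: eq_bigr => j _ /=; rewrite scaler_sumr.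
by apply: eq_bigr => i _; rewrite scalerA.
Qed.

Lemma eq_actH (a a' : 'I_n -> K) z : (forall i, a i = a' i) -> actH act a z = actH act a' z.
Proof. by move=> e; apply: eq_bigr => i _; rewrite e. Qed.

Hypothesis x0_int : integral abs x0.
Hypothesis indep : forall c : J -> K,
  \sum_j c j *: actH act (w j) x0 = 0 -> forall j, c j = 0.
Hypothesis in_order : forall c : J -> K, integral abs (\sum_j c j *: actH act (w j) x0) ->
  forall j z, integral abs z -> integral abs (c j *: actH act (w j) z).

(** The images of [x0] under the [w j] form a basis of [M], so any [y] comes from a single element
    of [H]; for integral [y], [in_order] puts that element in the associated order term by term. *)
Lemma free_by_basis : free_over_assoc_order act abs.
Proof.
have card_d : #|J| = #|'I_(\dim {:M})| by rewrite card_J card_ord (hopf_dim hgs).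
have rf1 : rows_free (fun j (q : 'I_(\dim {:M})) => coord (vbasis {:M}) q (actH act (w j) x0)).
  move=> c hc; apply: indep; rewrite [LHS]vbasis_expand big1 // => q _.
  rewrite linear_sum (_ : \sum_j _ = 0) ?scale0r // -[RHS](hc q).
  by apply: eq_bigr => j _; rewrite linearZ.
have span y : exists c : J -> K, y = \sum_j c j *: actH act (w j) x0.
  have [c cE] := rows_free_solve card_d rf1 (fun q => coord (vbasis {:M}) q y).
  exists c; rewrite [LHS]vbasis_expand [RHS]vbasis_expand; apply: eq_bigr => q _.
  by congr (_ *: _); rewrite linear_sum cE; apply: eq_bigr => j _; rewrite linearZ.
have rf2 : rows_free w.
  move=> c hc; apply: indep; rewrite -actH_comb /actH big1 // => i _.
  by rewrite hc scale0r.
have card_n : #|J| = #|'I_n| by rewrite card_J card_ord.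
exists 1%N, (fun _ => x0); split=> //.
  move=> y y_int; have [c cE] := span y.
  exists (fun _ i => \sum_j c j * w j i); split=> [_ z z_int|]; last first.
    by rewrite big_ord1 actH_comb.
  rewrite actH_comb; elim/big_ind: _ => // j _.
  by apply: in_order => //; rewrite -cE.
move=> hs _; rewrite big_ord1 => h0 j i; rewrite (ord1 j).
have [c cE] := rows_free_solve card_n rf2 (hs ord0).
rewrite cE big1 // => j' _; rewrite indep ?mul0r //.
by rewrite -actH_comb -[RHS]h0; apply: eq_actH => i'; rewrite cE.
Qed.

End FreenessCriterion.

Section DihedralGroup.
Import GroupScope.

Lemma dihedral_generators (gT : finGroupType) (G : {group gT}) (p : nat) :
  prime p -> odd p -> G \isog 'D_(2 * p) ->
  exists sg : gT, [/\ sg \in G, #[sg] = p, #|G| = (2 * p)%N,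
    exists2 r, r \in G & r \notin <[sg]> &
    forall r, r \in G -> r \notin <[sg]> -> r * r = 1 /\ sg ^ r = sg^-1].
Proof.
move=> p_pr p_odd; have p_gt1 := prime_gt1 p_pr.
rewrite mul2n => /(isoGrpP _ (Grp_dihedral p_gt1)).
rewrite card_dihedral // -mul2n => -[oG] /existsP[[x y]] /=.
case/eqP=> defG xp y2 xy.
have {}defG : <[x]> * <[y]> = G.
  by rewrite -norm_joinEr // norms_cycle xy groupV cycle_id.
have yx : y \notin <[x]>.
  apply/negP => yx; have : (#|G| <= p)%N.
    rewrite -defG mulGSid ?cycle_subG // dvdn_leq ?prime_gt0 // order_dvdn xp //.
  by rewrite oG leqNgt mul2n -addnn -{1}[p]addn0 ltn_add2l prime_gt0.
have ox : #[x] = p.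
  have : (#[x] %| p)%N by rewrite order_dvdn xp.
  case/primeP: p_pr => _ pP /pP/orP[|/eqP//]; rewrite order_eq1 => /eqP x1.
  have : (#|G| <= 2)%N.
    by rewrite -defG x1 cycle1 mul1g dvdn_leq // -[#|_|]/#[y] order_dvdn y2.
  by rewrite oG -{2}[2%N]muln1 leq_mul2l leqNgt p_gt1.
have xG : x \in G by rewrite -defG -[x in x \in _]mulg1 mem_mulg ?cycle_id ?group1.
have yG : y \in G by rewrite -defG -[y in y \in _]mul1g mem_mulg ?cycle_id ?group1.
exists x; split=> //; first by exists y.
move=> r; rewrite -defG => /mulsgP[_ _ /cycleP[i ->] /cycleP[j ->] ->].
have -> : y ^+ j = y ^+ (j %% 2).
  by rewrite {1}(divn_eq j 2) expgD mulnC expgM y2 expg1n mul1g.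
rewrite modn2; case: (odd j) => /=; last by rewrite mulg1 groupX ?cycle_id.
rewrite expg1 => _; have yV : y^-1 = y by apply/eqP; rewrite eq_invg_mul -[y * y]/(y ^+ 2) y2.
split; last by rewrite conjgM -xy (_ : x ^ (x ^+ i) = x) // conjgE -expgS expgSr mulKg.
have e : y * x ^+ i * y = x ^- i by rewrite -{1}yV -mulgA -conjgE conjXg xy expgVn.
by rewrite -!mulgA (mulgA y) e mulgV.
Qed.

End DihedralGroup.

(** * The valuation of the given extension and its dihedral action *)

Section LocalDihedral.
Variables (p : nat) (K : fieldType) (abs : K -> rat).
Hypotheses (p_pr : prime p) (p_odd : odd p) (KQp : is_Qp p abs).
Variable L : splittingFieldType K.
Hypothesis galL : galois 1%AS {:L}.

Local Notation G := (gal_of {:L}).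
Variable sg : G.
Hypotheses (sg_order : #[sg]%g = p) (card_G : #|{: G}| = (2 * p)%N).
Hypothesis reflection : forall r : G, (r \notin <[sg]> -> r * r = 1 /\ sg ^ r = sg^-1)%g.
Hypothesis ntr : not_totally_ramified abs L.

Local Notation vk := (vK p_pr KQp).
Let vkP : is_valuation vk := vK_valuation p_pr KQp.
Let v1 : L -> int := vL vk (L := L).
Let v1P : is_valuation v1 := vL_valuation vkP (@vK_complete p K abs p_pr KQp) galL.

Definition local_val : L -> int := half_val v1.
Local Notation v := local_val.

Lemma v1_alg (c : K) : c != 0 -> v1 c%:A = (2 * p)%N%:Z * vk c.
Proof. by move=> c0; rewrite /v1 (vL_alg vkP galL c0) card_G -mulr_natl natz. Qed.

Lemma vge_v1_alg (c : K) : vge vk 1 c -> vge v1 1 c%:A.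
Proof.
have [->|c0] := eqVneq c 0; first by move=> _; rewrite scale0r vge_zero.
have cA0 : c%:A != 0 :> L by rewrite scaler_eq0 negb_or oner_eq0 c0.
rewrite (vgeE _ _ c0) (vgeE _ _ cA0) v1_alg // => k1; apply: (le_trans k1); have k0 : 0 <= vk c by apply: le_trans k1.
rewrite ler_peMl //.
by move: (prime_gt0 p_pr); clear; lia.
Qed.

Lemma p_alg : p%:R = (p%:R : K)%:A :> L.
Proof. by rewrite scaler_nat. Qed.

Lemma v1_p : v1 p%:R = (2 * p)%N.
Proof. by rewrite p_alg v1_alg ?(p_neq0 p_pr KQp) // vK_p mulr1. Qed.

Lemma p_neq0L : p%:R != 0 :> L.
Proof. by rewrite p_alg scaler_eq0 negb_or oner_eq0 andbT (p_neq0 p_pr KQp). Qed.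

Lemma vge_v1_p : vge v1 1 p%:R.
Proof. by rewrite vgeE ?p_neq0L // v1_p; have := prime_gt0 p_pr; lia. Qed.

Lemma galX (g : G) i x : (g ^+ i)%g x = iter i g x.
Proof. by elim: i x => [|i IH] x; rewrite ?gal_id // expgS galM ?memvf // IH -iterSr. Qed.

Lemma sg_p x : iter p sg x = x.
Proof. by rewrite -galX -sg_order expg_order gal_id. Qed.

Variable r : G.
Hypothesis rN : r \notin <[sg]>%g.

Lemma gal_gen (P : G -> Prop) : P sg -> P r -> (forall g h, P g -> P h -> P (g * h)%g) ->
  forall g, P g.
Proof.
move=> Psg Pr PM; have [rr _] := reflection rN.
have P1 : P 1%g by rewrite -rr; apply: PM.
have PA a : a \in <[sg]>%g -> P a.
  by case/cycleP=> i ->; elim: i => // i IH; rewrite expgS; apply: PM.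
move=> g; have [gA|gA] := boolP (g \in <[sg]>%g); first exact: PA.
rewrite -(mulKVg r g); apply: PM => //; apply: PA.
exact: (A_index sg_order card_G reflection rN gA).
Qed.

Lemma r2 x : r (r x) = x.
Proof. by rewrite -galM ?memvf // (proj1 (reflection rN)) gal_id. Qed.

Lemma sg_r_sg x : sg (r (sg x)) = r x.
Proof.
have [_ e] := reflection rN.
by rewrite -!galM ?memvf // mulgA (conjgC sg r) e mulgKV.
Qed.

Lemma fixed_alg x : sg x = x -> r x = x -> exists c : K, x = c%:A.
Proof.
move=> sx rx; apply: (gal_fixed_alg galL); apply: gal_gen => // g h gx hx.
by rewrite galM ?memvf // gx hx.
Qed.

Lemma fixed_residue_v1 x : sg x = x -> r x = x -> vge v1 0 x ->
  exists n : nat, vge v1 1 (x - n%:R).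
Proof.
move=> sx rx; have [c ->] := fixed_alg sx rx.
rewrite (vge_alg0 vkP galL) => /residue_nat[n nP]; exists n.
have -> : c%:A - n%:R = (c - n%:R)%:A :> L by rewrite scalerBl scaler_nat.
exact: vge_v1_alg.
Qed.

Lemma fixed_val_v1 x : sg x = x -> r x = x -> x != 0 ->
  exists k : int, v1 x = (2 * p)%N%:Z * k.
Proof.
move=> sx rx; have [c ->] := fixed_alg sx rx.
rewrite scaler_eq0 negb_or => /andP[c0 _]; exists (vk c); exact: v1_alg.
Qed.

Lemma v1_integral x : integral abs x <-> vge v1 0 x.
Proof.
by apply: (vL_integral vkP (@vK_complete p K abs p_pr KQp) galL) => c; apply: abs_vge0.
Qed.

Lemma residue_ext_v1 : exists2 x, vge v1 0 x & forall n : nat, ~~ vge v1 1 (x - n%:R).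
Proof.
case: ntr => x [/v1_integral x0 hx]; exists x => // n; apply/negP => xn.
apply: (hx n%:R); first by rewrite (abs_vge0 p_pr KQp) (vge_nat vkP).
rewrite scaler_nat; split; first by apply/v1_integral; apply: vgeW xn.
case=> y0 /v1_integral; rewrite vgeE ?invr_eq0 // (valV v1P) //.
by move: xn; rewrite vgeE //; move: (v1 _) => k; lia.
Qed.

Theorem local_dihedral : exists s, dihedral_valuation p v sg r s.
Proof.
have v_sg x : v1 (sg x) = v1 x by apply: vL_gal.
have v_r x : v1 (r x) = v1 x by apply: vL_gal.
have [s [s0 vs ss ts]] := anti_invariant_unit p_pr p_odd v1P vge_v1_p v_sg sg_p v_r r2 sg_r_sg
  fixed_residue_v1 residue_ext_v1.
have vE x : x != 0 -> v1 x = 2 * v x.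
  exact: (half_valE p_pr p_odd v1P vge_v1_p v_sg sg_p v_r r2 sg_r_sg s0 vs ts fixed_val_v1).
have vge1 x : vge v 1 x = vge v1 1 x.
  exact: (vge_half1 p_pr p_odd v1P vge_v1_p v_sg sg_p v_r r2 sg_r_sg s0 vs ts fixed_val_v1).
have vge0 x : vge v 0 x = vge v1 0 x.
  exact: (vge_half p_pr p_odd v1P vge_v1_p v_sg sg_p v_r r2 sg_r_sg s0 vs ts fixed_val_v1).
exists s; split=> //.
- exact: (half_valuation p_pr p_odd v1P vge_v1_p v_sg sg_p v_r r2 sg_r_sg s0 vs ts fixed_val_v1).
- exact: p_neq0L.
- by apply: (mulfI (isT : 2 != 0 :> int)); rewrite -(vE _ p_neq0L) v1_p PoszM.
- by move=> x; rewrite /local_val /half_val v_sg.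
- exact: sg_p.
- have sgN1 : sg != 1%g by rewrite -order_eq1 sg_order gtn_eqF ?prime_gt1.
  have : ~ forall x, sg x = x.
    by move=> h; move/negP: sgN1; apply; apply/gal_eqP => x _; rewrite gal_id h.
  by move=> h; apply: NNPP => none; apply: h => x; apply/eqP/negPn/negP => h; apply: none; exists x.
- by move=> x; rewrite /local_val /half_val v_r.
- exact: r2.
- exact: sg_r_sg.
- by apply: (mulfI (isT : 2 != 0 :> int)); rewrite -(vE _ s0) vs mulr0.
- move=> x; rewrite vge0 vge1.
  exact: (sigma_residue p_pr p_odd v1P vge_v1_p v_sg sg_p v_r r2 sg_r_sg fixed_residue_v1).
- move=> x; rewrite vge0 vge1 => x0 tx.
  have [n nP] := residue_integer p_pr p_odd v1P vge_v1_p v_sg sg_p v_r r2 sg_r_sg fixed_residue_v1 x0 tx.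
  by exists n; rewrite vge1.
Qed.

Lemma local_integral x : integral abs x <-> vge v 0 x.
Proof.
rewrite v1_integral /vge /local_val /half_val; case: eqVneq => //= _.
by rewrite lez_divRL // mul0r.
Qed.

Lemma local_base_like (c : K) : base_like p v r c%:A.
Proof.
split; first exact: gal_alg.
have [->|c0] := eqVneq c 0; [left; rewrite scale0r // | right].
by rewrite /local_val /half_val v1_alg // PoszM -mulrA mulKz // dvdz_mulr.
Qed.

End LocalDihedral.

(** The valuation of [c] is a multiple of [p] not below [-(1 + i)], hence nonnegative unless
    [i = p - 1]; there it may be [-p], which [er_iter_top] makes up for. *)
Lemma base_like_order (p : nat) (L : fieldType) (v : L -> int) (sigma tau : {rmorphism L -> L})
  (s : L) (w : L -> L) (c z : L) i : dihedral_valuation p v sigma tau s -> exact_raising p v s w ->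
  base_like p v tau c -> (i < p)%N -> vge v (0 - (1 + i%:Z)) c -> vge v 0 z ->
  vge v 0 (c * iter i w z).
Proof.
move=> D hw [_ hc] ip ci z0; have vP := dv_val D.
have [->|c0] := eqVneq c 0; first by rewrite mul0r vge_zero.
case: hc => [|/dvdzP[k vc]]; first by rewrite (negbTE c0).
have p0 := prime_gt0 (dv_prime D).
rewrite vgeE // vc in ci; have [ip'|ip'] := ltnP i.+1 p.
  apply: (vgeMl vP); last exact: (er_iter_ge0 D hw).
  rewrite vgeE // vc mulr_ge0 //; rewrite leNgt; apply/negP => k0.
  have : k * p%:Z <= (-1) * p%:Z by apply: ler_wpM2r => //; move: k0; clear; lia.
  by move: ci ip'; move: (k * p%:Z) => kp; clear; lia.
have iE : i = p.-1 by move: ip ip' p0; clear; lia.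
rewrite -[0](addNr p%:Z); apply: (vgeM vP); last by rewrite iE; apply: (er_iter_top D hw).
rewrite vgeE // vc; move: ci; rewrite iE; move: p0; move: (k * p%:Z) => kp; clear; lia.
Qed.

(** * Subextensions of degree p *)

Section PrimeDegree.
Variables (p : nat) (K : fieldType) (abs : K -> rat) (L : splittingFieldType K).
Hypothesis galL : galois 1%AS {:L}.
Variables (sg r : gal_of {:L}) (v : L -> int) (s : L).
Hypothesis sg_order : #[sg]%g = p.
Hypothesis gen : forall P : gal_of {:L} -> Prop,
  P sg -> P r -> (forall g h, P g -> P h -> P (g * h)%g) -> forall g, P g.
Hypothesis D : dihedral_valuation p v sg r s.
Hypothesis int_v : forall x : L, integral abs x <-> vge v 0 x.
Hypothesis base_v : forall c : K, base_like p v r c%:A.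
Variable E : {subfield L}.
Hypothesis dim_E : \dim E = p.
Hypothesis mem_E : forall x, (x \in E) = (r x == x).

Local Notation M := (subvs_of E).

Let p_pr : prime p := dv_prime D.
Let vP : is_valuation v := dv_val D.
Let sgp : forall x, iter p sg x = x := dv_sigma_p D.

Lemma r_vsval (x : M) : r (vsval x) = vsval x.
Proof. by apply/eqP; rewrite -mem_E subvsP. Qed.

Lemma r_subvs (x : L) : r x = x -> exists y : M, vsval y = x.
Proof. by move=> rx; exists (vsproj E x); rewrite vsprojK // mem_E rx. Qed.

Lemma integral_subvs (x : M) : integral abs x <-> vge v 0 (vsval x).
Proof.
rewrite -int_v.
have e (P : {poly K}) : vsval (map_poly (in_alg M) P).[x] = (map_poly (in_alg L) P).[vsval x].
  rewrite -horner_map /= -map_poly_comp /=; congr (_.[_]).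
  by apply: eq_map_poly => c /=; rewrite algid1.
split=> -[P [Pm Pi Px]]; exists P; split=> //; first by rewrite -e Px.
by apply: subvs_inj; rewrite linear0 e.
Qed.

Let eps (t : 'I_p) (x : M) : L := iter t sg (vsval x).

Lemma iter_sg_lin i a x y : iter i sg (a *: x + y) = a *: iter i sg x + iter i sg y.
Proof. by elim: i => //= i ->; rewrite linearP. Qed.

Lemma sg_iter_s i : iter i sg s = s.
Proof. by elim: i => //= i ->; rewrite (dv_sigma_s D). Qed.

Lemma iter_sg_mod i : iter (i %% p) sg =1 iter i sg.
Proof. by move=> x; apply: (iter_sigma_mod D); rewrite modn_mod. Qed.

Lemma r_decomp x : exists a b : M, x = vsval a + s * vsval b.
Proof.
have [a [b [ra rb ->]]] := tau_decomp p_pr (dv_odd D) vP (vge_p1 D) (dv_tau2 D)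
  (dv_s_neq0 D) (dv_tau_s D) x.
by have [a' <-] := r_subvs ra; have [b' <-] := r_subvs rb; exists a', b'.
Qed.

Lemma r_direct (a b : M) : vsval a + s * vsval b = 0 -> a = 0 /\ b = 0.
Proof.
move=> ab0; have h k : vge v k (vsval a) && vge v k (vsval b).
  have := vge_tau_decomp p_pr (dv_odd D) vP (vge_p1 D) (dv_tau D) (dv_s_neq0 D) (dv_s D)
    (dv_tau_s D) k (r_vsval a) (r_vsval b).
  by rewrite ab0 vge_zero => <-.
have z (x : M) : (forall k, vge v k (vsval x)) -> x = 0.
  by move=> hx; apply: subvs_inj; rewrite linear0; apply: (vge_eq0 (v := v)) => k.
by split; apply: z => k; case/andP: (h k).
Qed.

(** Rotations fix [s] and [L = E + s E], so a relation on [E] extends to all of [L], where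
    independence of automorphisms applies. *)
Lemma eps_free_subvs (c : 'I_p -> L) : (forall x, \sum_t c t * eps t x = 0) -> forall t, c t = 0.
Proof.
move=> hc; have hL z : \sum_t c t * iter t sg z = 0.
  have [a [b ->]] := r_decomp z.
  under eq_bigr => t _ do rewrite iter_mor_add iter_mor_mul sg_iter_s mulrDr mulrCA.
  by rewrite big_split -mulr_sumr /= !hc mulr0 addr0.
(* Distinct indices give distinct powers of [sg], so each fibre sum at a rotation is a single
   coefficient. *)
pose c' (g : gal_of {:L}) := \sum_(t < p | g == (sg ^+ t)%g) c t.
have hc' : forall g, c' g = 0.
  move=> g; apply: (@gal_independent _ _ {:L}%AS xpredT c') => // z _.
  rewrite -[RHS](hL z) /c'.
  under eq_bigr => h _ do rewrite mulr_suml big_mkcond.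
  rewrite exchange_big; apply: eq_bigr => t _ /=.
  by rewrite -big_mkcond /= (big_pred1 (sg ^+ t)%g) ?galX.
move=> t; rewrite -[RHS](hc' (sg ^+ t)%g) /c' (big_pred1 t) // => u /=.
by rewrite eq_expg_mod_order sg_order !modn_small ?ltn_ord // eq_sym.
Qed.

Section Structure.
Variables (n : nat) (H : hopf_data K n) (act : 'I_n -> 'End(M)).
Hypothesis hgs : hopf_galois_structure H act.

(** Coefficients in [L] split along [1, s] into two families in [M], to which [hopf_free]
    applies. *)
Lemma act_free_subvs (l : 'I_n -> L) :
  (forall x, \sum_i l i * vsval (act i x) = 0) -> forall i, l i = 0.
Proof.
have /fin_all_exists[a aE] i : exists a : M, exists b : M, l i = vsval a + s * vsval b.
  exact: r_decomp.
have /fin_all_exists[b lE] i := aE i.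
move=> hl; have hab x : \sum_i a i * act i x = 0 /\ \sum_i b i * act i x = 0.
  apply: r_direct; rewrite -[RHS](hl x) !linear_sum /= mulr_sumr -big_split /=.
  by apply: eq_bigr => i _; rewrite lE mulrDl -mulrA.
have a0 := hopf_free hgs (fun x => proj1 (hab x)).
have b0 := hopf_free hgs (fun x => proj2 (hab x)).
by move=> i; rewrite lE a0 b0 linear0 mulr0 addr0.
Qed.

Lemma dim_subvs : \dim {: M} = p.
Proof. by rewrite dimvf /= /dim /=; exact: dim_E. Qed.

Lemma sg_iter_coeff (C : 'I_n -> 'I_p -> L) (f : 'I_p -> 'I_p) :
  (forall i t, sg (C i t) = C i (f t)) -> forall j i t, iter j sg (C i t) = C i (iter j f t).
Proof. by move=> h; elim=> // j IH i t; rewrite !iterS IH h. Qed.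

Let omega (x : L) : L := s * (sg x - (sg^-1)%g x).

Let omega_raising : exact_raising p v s omega.
Proof.
have sgK (x : L) : sg ((sg^-1)%g x) = x by rewrite -galM ?memvf // mulVg gal_id.
exact: (@exact_raising_skew _ _ _ _ _ _ D (gal_repr (sg^-1)%g)).
Qed.

(* The rotations act trivially on the p embeddings because they fix one of
   them, and a p-group acting on p points fixes a multiple of p points. *)
Lemma exists_omega_subvs : exists a : 'I_n -> K, forall x : M, vsval (actH act a x) = omega (vsval x).
Proof.
have p0 := prime_gt0 p_pr; have p2 := p_gt2 D.
have card_T : #|'I_p| = \dim {: M} by rewrite card_ord dim_subvs.
have iota_lin (a : K) (x y : M) : vsval (a *: x + y) = a *: vsval x + vsval y by rewrite linearP.
have iotaM (x y : M) : vsval (x * y) = vsval x * vsval y by [].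
have eps_lin t (a : K) x y : eps t (a *: x + y) = a *: eps t x + eps t y.
  by rewrite /eps iota_lin iter_sg_lin.
have epsM t x y : eps t (x * y) = eps t x * eps t y by rewrite /eps iotaM iter_mor_mul.
have [C [pi [CE pi_inj piE]]] :=
  hopf_coeffs hgs card_T iota_lin iotaM eps_lin epsM eps_free_subvs act_free_subvs.
have C_inj := coeff_inj hgs card_T act_free_subvs CE.
have [pi1 piM] := coeff_pi_mul hgs card_T act_free_subvs CE piE.
have unit0 := coeff_pi_unit hgs iota_lin eps_free_subvs CE (t0 := Ordinal p0) piE (fun x => erefl).
have pi_sg t : pi sg t = t.
  have sp : (perm (pi_inj sg) ^+ p = 1)%g.
    apply/permP => u; rewrite permX perm1; apply: C_inj => i.
    rewrite (eq_iter (permE (pi_inj sg))) -(sg_iter_coeff (fun i t => piE sg i t)).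
    exact: sgp.
  have := perm_fix_mod (S := setT) p_pr sp (fun x _ => in_setT _).
  rewrite cardsT card_ord modnn; set F := [set x in _ | _] => /esym/eqP pF.
  have F0 : (0 < #|F|)%N.
    by apply/card_gt0P; exists (Ordinal p0); rewrite !inE permE unit0 eqxx.
  have FT : F = setT.
    apply/eqP; rewrite eqEcard subsetT cardsT card_ord; exact: dvdn_leq.
  by have := in_setT t; rewrite -FT inE permE => /andP[_ /eqP].
(* Negation of indices modulo [p]: [r] inverts rotations and fixes [E], so it sends the embedding
   [t] to [- t]. *)
pose neg (t : 'I_p) : 'I_p := Ordinal (ltn_pmod (p - t) p0).
have neg_inv : involutive neg.
  move=> t; apply/val_inj => /=; have [->|t0] := posnP t; first by rewrite subn0 modnn subn0 modnn.
  rewrite (modn_small (m := p - t)); last by rewrite ltn_subrL t0 p0.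
  by rewrite subKn ?modn_small // ltnW.
have r_eps t x : r (eps t x) = eps (neg t) x.
  rewrite /eps (tau_iter sgp (dv_sts D)) ?(ltnW (ltn_ord t)) //= r_vsval.
  by rewrite iter_sg_mod.
(* The action takes values in [E], which [r] fixes; comparing coefficients before and after [r]
   identifies [pi r]. *)
have pi_r t : pi r t = neg t.
  suff e u : pi r (neg u) = u by rewrite -{1}(neg_inv t) e.
  apply: C_inj => i; rewrite -piE; apply/eqP; rewrite -subr_eq0; apply/eqP.
  move: u; apply: (eps_free_subvs (c := fun u => r (C i (neg u)) - C i u)) => x.
  under eq_bigr => u _ do rewrite mulrBl.
  rewrite sumrB -CE; apply/eqP; rewrite subr_eq0; apply/eqP.
  rewrite -[RHS]r_vsval CE rmorph_sum (reindex_inj (inv_inj neg_inv)) /=.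
  by apply: eq_bigr => u _; rewrite neg_inv rmorphM /= r_eps.
pose t1 : 'I_p := Ordinal (ltn_trans (ltnSn 1) p2).
have nt1 : neg t1 != t1.
  rewrite -val_eqE /= modn_small; last by rewrite ltn_subrL p0.
  by rewrite gtn_eqF // ltn_subRL.
(* The coefficients of [s (sigma - sigma^-1)]: [r] exchanges the two indices and negates [s], which
   makes [c] equivariant. *)
pose c (t : 'I_p) : L := if t == t1 then s else if t == neg t1 then - s else 0.
have cE (g : gal_of {:L}) t : g (c t) = c (pi g t).
  move: g t; apply: gen => [t|t|g h hg hh t].
  - rewrite pi_sg /c; case: ifP => _; first exact: (dv_sigma_s D).
    case: ifP => _; last exact: rmorph0.
    by rewrite rmorphN /= (dv_sigma_s D).
  - rewrite pi_r /c -(inj_eq (inv_inj neg_inv) t (neg t1)) neg_inv.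
    rewrite -(inj_eq (inv_inj neg_inv) t t1).
    have [->|_] := eqVneq (neg t) (neg t1); last first.
      by case: ifP => _; rewrite ?rmorph0 ?rmorphN /= ?(dv_tau_s D) ?opprK.
    by rewrite (negbTE nt1) (dv_tau_s D).
  - by rewrite galM ?memvf // hg hh piM.
have [a aE] := coeff_descent hgs galL card_T act_free_subvs CE pi_inj piE cE.
exists a => x; rewrite (iota_actH iota_lin CE).
under eq_bigr => t _ do rewrite -aE.
rewrite (bigD1 t1) //= (bigD1 (neg t1)) //= big1 ?addr0 => [|t /andP[ta tb]]; last first.
  by rewrite /c (negbTE ta) (negbTE tb) mul0r.
rewrite /c !eqxx (negbTE nt1) /eps /= iter_sg_mod /omega mulrBr mulNr; congr (_ - s * _).
by rewrite subn1 -galX -{1}sg_order -[(#[sg])%g.-1]/((#[sg])%g.-1) -invg_expg.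
Qed.

Theorem prime_degree_free : free_over_assoc_order act abs.
Proof.
have [a aE] := exists_omega_subvs.
have [y [y0 vy ry]] := exists_uniformizer D; have [x0 x0E] := r_subvs ry.
have nE : n = p by rewrite (hopf_dim hgs) dim_subvs.
pose w (j : 'I_p) : 'I_n -> K := iter j (mulH H a) (hunit H).
have wE j z : vsval (actH act (w j) z) = iter j omega (vsval z).
  rewrite /w; case: hgs => _ [hM [h1 _]]; elim: (j : nat) => [|i IH]; first by rewrite h1.
  by rewrite !iterS hM aE IH.
have sumE (c : 'I_p -> K) z :
    vsval (\sum_j c j *: actH act (w j) z) = \sum_j (c j)%:A * iter j omega (vsval z).
  by rewrite linear_sum; apply: eq_bigr => j _; rewrite linearZ /= wE mulr_algl.
apply: (@free_by_basis K abs n H _ act hgs _ _ _ w x0).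
- by apply/integral_subvs; rewrite linear0 vge_zero.
- by move=> x z /integral_subvs hx /integral_subvs hz; apply/integral_subvs; rewrite linearD (vgeD vP).
- by rewrite card_ord.
- by apply/integral_subvs; rewrite x0E vgeE // vy.
- move=> c /(congr1 vsval); rewrite sumE linear0 x0E => hc j.
  have : (c j)%:A = 0 :> L.
    apply: (vge_eq0 (v := v)) => k.
    have := raising_basis D omega_raising y0 vy (k := k%:Z + (1 + j%:Z)) (fun j => base_v (c j)).
    by rewrite hc vge_zero => /(_ isT j); rewrite addrK.
  by move/eqP; rewrite scaler_eq0 oner_eq0 orbF => /eqP.
move=> c /integral_subvs; rewrite sumE x0E => hc j z /integral_subvs hz.
apply/integral_subvs; rewrite linearZ /= wE -mulr_algl.
apply: (base_like_order D omega_raising) => //.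
exact: (raising_basis D omega_raising y0 vy (fun j => base_v (c j)) hc).
Qed.

End Structure.
End PrimeDegree.

(** * The full extension of degree 2p *)

Section DihedralDegree.
Variables (p : nat) (K : fieldType) (abs : K -> rat) (L : splittingFieldType K).
Hypothesis galL : galois 1%AS {:L}.
Local Notation G := (gal_of {:L}).
Variables (sg r : G) (v : L -> int) (s : L).
Hypotheses (sg_order : #[sg]%g = p) (card_G : #|{: G}| = (2 * p)%N).
Hypothesis reflection : forall r : G, (r \notin <[sg]> -> r * r = 1 /\ sg ^ r = sg^-1)%g.
Hypothesis rN : r \notin <[sg]>%g.
Hypothesis gen : forall P : G -> Prop,
  P sg -> P r -> (forall g h, P g -> P h -> P (g * h)%g) -> forall g, P g.
Hypothesis D : dihedral_valuation p v sg r s.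
Hypothesis int_v : forall x : L, integral abs x <-> vge v 0 x.
Hypothesis base_v : forall c : K, base_like p v r c%:A.
Hypothesis v_gal : forall (g : G) x, v (g x) = v x.
Variables (n : nat) (H : hopf_data K n) (act : 'I_n -> 'End(L)).
Hypothesis hgs : hopf_galois_structure H act.

Let p_pr : prime p := dv_prime D.
Let vP : is_valuation v := dv_val D.
Let sgp : forall x, iter p sg x = x := dv_sigma_p D.

Let eps (g : G) (x : L) : L := g x.

Lemma card_gal_dim : #|{: G}| = \dim {:L}.
Proof.
rewrite -[RHS]divn1 -[X in (_ %/ X)%N](dimv1 L) (galois_dim galL).
by apply: eq_card => g; rewrite gal_full.
Qed.

Lemma eps_free_gal (c : G -> L) : (forall x, \sum_g c g * eps g x = 0) -> forall g, c g = 0.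
Proof. by move=> h g; apply: (@gal_independent _ _ {:L}%AS xpredT c) => // x _; apply: h. Qed.

Let iota_lin (a : K) (x y : L) : (a *: x + y) = a *: x + y. Proof. by []. Qed.
Let iotaM (x y : L) : x * y = x * y. Proof. by []. Qed.
Let eps_lin (g : G) (a : K) x y : eps g (a *: x + y) = a *: eps g x + eps g y.
Proof. by rewrite /eps linearP. Qed.
Let epsM g x y : eps g (x * y) = eps g x * eps g y.
Proof. by rewrite /eps rmorphM. Qed.

Section Brace.
Variables (C : 'I_n -> G -> L) (pi : G -> G -> G).
Hypothesis CE : forall i x, act i x = \sum_g C i g * eps g x.
Hypothesis pi_inj : forall g, injective (pi g).
Hypothesis piE : forall (g : G) i t, g (C i t) = C i (pi g t).

Let piM : (forall t, pi 1%g t = t) /\ forall g h t, pi (g * h)%g t = pi h (pi g t).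
Proof. exact: (coeff_pi_mul (iota := id) hgs card_gal_dim (hopf_free hgs) CE piE). Qed.

Lemma gal_pi_unit g : pi g 1%g = 1%g.
Proof.
apply: (coeff_pi_unit (iota := id) hgs iota_lin eps_free_gal CE piE) => x; exact: gal_id.
Qed.

(** Composing two actions yields terms [C i g * g (C j h)] at the automorphism [h * g]. Rewriting
    [g (C j h)] as [C j (pi g h)] and renaming [pi g h] to [h] turns [h * g] into [star pi g h]. *)
Lemma coeff_prod i j k : \sum_g \sum_h (star pi g h == k)%:R * (C i g * C j h) =
  \sum_l (hmul H i j l)%:A * C l k.
Proof.
apply/eqP; rewrite -subr_eq0; apply/eqP; move: k.
pose W k := \sum_g \sum_h (star pi g h == k)%:R * (C i g * C j h) - \sum_l (hmul H i j l)%:A * C l k.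
apply: (eps_free_gal (c := W)) => x; rewrite /W.
under eq_bigr => k _ do rewrite mulrBl; rewrite sumrB.
have -> : \sum_k (\sum_l (hmul H i j l)%:A * C l k) * eps k x = act i (act j x).
  rewrite -(iota_actH (iota := id) iota_lin CE (fun l => hmul H i j l)).
  have [_ [hM _]] := hgs; rewrite -(actH_basis act i) -(actH_basis act j) -hM.
  apply: eq_actH => k; rewrite /mulH (bigD1 i) //= (bigD1 j) //= !eqxx !mul1r.
  rewrite big1 ?addr0 => [|j' /negbTE->]; last by rewrite mulr0 mul0r.
  rewrite big1 ?addr0 // => i' /negbTE->; rewrite big1 // => j' _; by rewrite !mul0r.
apply/eqP; rewrite subr_eq0; apply/eqP; symmetry.
rewrite CE; under eq_bigr => g _ do rewrite CE /eps rmorph_sum mulr_sumr.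
under eq_bigr => g _ do under eq_bigr => h _ do rewrite rmorphM /= piE -galM ?memvf //.
under [RHS]eq_bigr => k _ do (rewrite mulr_suml; under eq_bigr => g _ do rewrite mulr_suml).
rewrite [RHS]exchange_big; apply: eq_bigr => g _ /=.
rewrite [RHS]exchange_big /= [LHS](reindex_inj (@pi_inj (g^-1)%g)) /=; apply: eq_bigr => h _.
rewrite (bigD1 (star pi g h)) //= eqxx mul1r big1 ?addr0 => [|k /negbTE kN]; last first.
  by rewrite eq_sym kN !mul0r.
by rewrite -(proj2 piM) mulVg (proj1 piM) mulrA /eps.
Qed.

Lemma coeff2_free (W : G -> G -> L) :
  (forall i j, \sum_g \sum_h W g h * (C i g * C j h) = 0) -> forall g h, W g h = 0.
Proof.
have cols := coeff_cols (iota := id) hgs card_gal_dim (hopf_free hgs) CE.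
move=> hW g h; move: h; apply: (cols (fun h => W g h)) => j; move: g.
apply: (cols (fun g => \sum_h C j h * W g h)) => i.
rewrite -[RHS](hW i j); apply: eq_bigr => g _; rewrite mulr_sumr.
by apply: eq_bigr => h _; ring.
Qed.

(** Applying [t] to [coeff_prod] leaves the structure constants in [K] unchanged. As the products
    [C i g * C j h] separate functions of [(g, h)], the relation [star pi g h = k] is transported by
    [pi t]. *)
Lemma gal_pi_star t g h : pi t (star pi g h) = star pi (pi t g) (pi t h).
Proof.
apply/eqP/negPn/negP => /negbTE ne.
pose k := star pi g h.
have key (i j : 'I_n) : \sum_g \sum_h ((star pi g h == k)%:R - (star pi (pi t g) (pi t h) == pi t k)%:R)
    * (C i (pi t g) * C j (pi t h)) = 0.
  have e1 : t (\sum_l (hmul H i j l)%:A * C l k) = \sum_l (hmul H i j l)%:A * C l (pi t k).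
    by rewrite rmorph_sum; apply: eq_bigr => l _; rewrite rmorphM /= gal_alg piE.
  rewrite -!coeff_prod in e1.
  under eq_bigr => g1 _ do under eq_bigr => h1 _ do rewrite mulrBl.
  under eq_bigr => g1 _ do rewrite sumrB.
  rewrite sumrB; apply/eqP; rewrite subr_eq0; apply/eqP.
  transitivity (t (\sum_g \sum_h (star pi g h == k)%:R * (C i g * C j h))).
    rewrite rmorph_sum; apply: eq_bigr => g1 _; rewrite rmorph_sum; apply: eq_bigr => h1 _.
    by rewrite !rmorphM rmorph_nat /= !piE.
  rewrite e1 (reindex_inj (@pi_inj t)) /=; apply: eq_bigr => g1 _.
  by rewrite (reindex_inj (@pi_inj t)).
have [f fK f'K] := injF_bij (@pi_inj t).
pose W g h : L := (star pi (f g) (f h) == k)%:R - (star pi g h == pi t k)%:R.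
have := coeff2_free (W := W) _ (pi t g) (pi t h).
rewrite /W !fK eqxx eq_sym ne subr0 => h1.
suff /eqP : (1 : L) = 0 by rewrite oner_eq0.
apply: h1 => i j; rewrite -[RHS](key i j) (reindex_inj (@pi_inj t)) /=; apply: eq_bigr => g1 _.
by rewrite (reindex_inj (@pi_inj t)) /=; apply: eq_bigr => h1 _; rewrite !fK.
Qed.

Lemma gal_brace : [/\ forall a, a \in <[sg]>%g -> pi sg a = a,
      pi r sg = sg \/ pi r sg = sg^-1%g &
      exists r0 m, [/\ r0 \notin <[sg]>%g, pi r r0 = r0, m != 1 %[mod p] &
        forall i, pi (sg ^+ i)%g r0 = (r0 * sg ^+ (m * i))%g]].
Proof.
exact: (skew_brace_structure p_pr (dv_odd D) sg_order card_G reflection rN (proj1 piM) (proj2 piM)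
  gal_pi_unit gal_pi_star).
Qed.

End Brace.

Lemma sum_delta (g : G) (z : G -> L) : \sum_t (t == g)%:R * z t = z g.
Proof.
rewrite (bigD1 g) //= eqxx mul1r big1 ?addr0 // => t /negbTE->; exact: mul0r.
Qed.

(** Galois descent with equivariance tested on two generators only. *)
Definition realizes (pi : G -> G -> G) : Prop := forall c : G -> L,
  (forall t, sg (c t) = c (pi sg t)) -> (forall t, r (c t) = c (pi r t)) ->
  exists a : 'I_n -> K, forall x, actH act a x = \sum_t c t * t x.

Lemma exists_brace : exists pi : G -> G -> G,
  [/\ forall g, injective (pi g), forall g h t, pi (g * h)%g t = pi h (pi g t) /\ pi 1%g t = t,
      pi sg 1%g = 1%g /\ pi r 1%g = 1%g, realizes pi &
  [/\ forall a, a \in <[sg]>%g -> pi sg a = a,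
      pi r sg = sg \/ pi r sg = sg^-1%g &
      exists r0 m, [/\ r0 \notin <[sg]>%g, pi r r0 = r0, m != 1 %[mod p] &
        forall i, pi (sg ^+ i)%g r0 = (r0 * sg ^+ (m * i))%g]]].
Proof.
have [C [pi [CE pi_inj piE]]] := hopf_coeffs (iota := id) hgs card_gal_dim iota_lin iotaM eps_lin
  epsM eps_free_gal (hopf_free hgs).
have [pi1 piM] := coeff_pi_mul (iota := id) hgs card_gal_dim (hopf_free hgs) CE piE.
exists pi; split=> //; last exact: gal_brace CE pi_inj piE.
  by split; apply: (gal_pi_unit CE piE).
move=> c csg cr; have cE (g : G) t : g (c t) = c (pi g t).
  move: g t; apply: gen => // g h hg hh t.
  by rewrite galM ?memvf // hg hh piM.
have [a aE] := coeff_descent (iota := id) hgs galL card_gal_dim (hopf_free hgs) CE pi_inj piE cE.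
exists a => x; rewrite (iota_actH (iota := id) iota_lin CE).
by apply: eq_bigr => t _; rewrite -aE.
Qed.

Section Operators.
Variable pi : G -> G -> G.
Hypothesis pi_inj : forall g, injective (pi g).
Hypothesis piM : forall g h t, pi (g * h)%g t = pi h (pi g t) /\ pi 1%g t = t.
Hypothesis pi_one : pi sg 1%g = 1%g /\ pi r 1%g = 1%g.
Hypothesis real : realizes pi.
Hypothesis pi_sg : forall a, a \in <[sg]>%g -> pi sg a = a.

(** If [pi r] fixes [sg], the difference of the indicators of [sg] and 1 is equivariant. If it
    inverts [sg], the indicators of [sg] and its inverse are swapped, a sign absorbed by [s]. *)
Lemma exists_omega : pi r sg = sg \/ pi r sg = sg^-1%g ->
  exists (a : 'I_n -> K) (w : L -> L), exact_raising p v s w /\ forall x, actH act a x = w x.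
Proof.
have sgA : sg \in <[sg]>%g by apply: cycle_id.
case=> rsg.
  have [t|t|a aE] := real (c := fun t => (t == sg)%:R - (t == 1%g)%:R).
  - rewrite rmorphB !rmorph_nat -(inj_eq (@pi_inj sg) t sg) -(inj_eq (@pi_inj sg) t 1%g).
    by rewrite (proj1 pi_one) (pi_sg sgA).
  - rewrite rmorphB !rmorph_nat -(inj_eq (@pi_inj r) t sg) -(inj_eq (@pi_inj r) t 1%g).
    by rewrite (proj2 pi_one) rsg.
  exists a, (fun x => sg x - x); split; first exact: (exact_raising_delta D).
  move=> x; rewrite aE; under eq_bigr => t _ do rewrite mulrBl.
  by rewrite sumrB !(sum_delta _ (fun t : G => t x)) gal_id.
have rsgV : pi r (sg^-1)%g = sg.
  by rewrite -rsg -(proj1 (piM _ _ _)) (proj1 (reflection rN)) (proj2 (piM 1%g 1%g _)).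
have [t|t|a aE] := real (c := fun t => s * ((t == sg)%:R - (t == sg^-1%g)%:R)).
- rewrite rmorphM rmorphB !rmorph_nat /= (dv_sigma_s D).
  rewrite -(inj_eq (@pi_inj sg) t sg) -(inj_eq (@pi_inj sg) t (sg^-1)%g).
  by rewrite (pi_sg sgA) (pi_sg (groupVr sgA)).
- rewrite rmorphM rmorphB !rmorph_nat /= (dv_tau_s D).
  rewrite -(inj_eq (@pi_inj r) t sg) -(inj_eq (@pi_inj r) t (sg^-1)%g).
  by rewrite rsg rsgV mulNr -mulrN opprB.
exists a, (fun x => s * (sg x - (sg^-1)%g x)); split.
  have sgK (x : L) : sg ((sg^-1)%g x) = x by rewrite -galM ?memvf // mulVg gal_id.
  exact: (@exact_raising_skew _ _ _ _ _ _ D (gal_repr (sg^-1)%g)).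
move=> x; rewrite aE; under eq_bigr => t _ do rewrite -mulrA mulrBl.
by rewrite -mulr_sumr sumrB !(sum_delta _ (fun t : G => t x)).
Qed.

(** The coefficient function is carried by the orbit of [r0] under the rotations, with weights
    [sg^i y / p]; it is equivariant for [r] because [r] fixes [y] and [pi r] fixes [r0]. The factor
    [1/p] offsets the gain of [p] in twisted sums. *)
Lemma exists_twisted_trace y r0 m : r y = y -> pi r r0 = r0 ->
  (forall i, pi (sg ^+ i)%g r0 = (r0 * sg ^+ (m * i))%g) ->
  exists a : 'I_n -> K, forall x, actH act a x = p%:R^-1 * twisted_sum sg m p y (r0 x).
Proof.
move=> ry rr0 sr0; have sgpg : (sg ^+ p = 1)%g by rewrite -sg_order expg_order.
pose F (t : G) (i : nat) := (pi (sg ^+ i)%g r0 == t)%:R * iter i sg y.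
have pV g : (gal_repr g : 'AEnd(L)) (p%:R^-1 : L) = p%:R^-1.
  by rewrite fmorphV rmorph_nat.
have [t|t|a aE] := real (c := fun t => p%:R^-1 * \sum_(i < p) F t i).
- rewrite rmorphM /= pV rmorph_sum; congr (_ * _).
  rewrite -(sum_nat_shift (F := F (pi sg t))); last first.
    by rewrite /F sgpg expg0 sgp.
  apply: eq_bigr => i _; rewrite /F rmorphM rmorph_nat /=; congr (_%:R * _).
  by rewrite expgSr (proj1 (piM _ _ _)) (inj_eq (@pi_inj sg)).
- rewrite rmorphM /= pV rmorph_sum; congr (_ * _).
  have shift : F (pi r t) p = F (pi r t) 0%N by rewrite /F sgpg expg0 sgp.
  (* [r] inverts the rotations, so the index is reversed after a cyclic shift. *)
  rewrite -(sum_nat_shift shift) [RHS](reindex_inj rev_ord_inj) /=.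
  apply: eq_bigr => i _; rewrite /F rmorphM rmorph_nat /= subnSK //.
  rewrite (tau_iter sgp (dv_sts D)) ?(ltnW (ltn_ord i)) //= ry; congr (_%:R * _); last by rewrite -iterS subnSK.
  have e : (sg ^+ i * r = r * sg ^+ (p - i))%g.
    have [_ er] := reflection rN.
    rewrite (conjgC (sg ^+ i) r) conjXg er expgVn; congr (_ * _)%g.
    apply/eqP; rewrite eq_invg_mul -expgD subnKC ?sgpg //; exact: ltnW.
  rewrite -(inj_eq (@pi_inj r) (pi (sg ^+ i)%g r0) t) -(proj1 (piM _ _ _)) e.
  by rewrite (proj1 (piM _ _ _)) rr0.
exists a => x; rewrite aE; under eq_bigr => t _ do rewrite -mulrA.
rewrite -mulr_sumr; congr (_ * _).
under eq_bigr => t _ do rewrite mulr_suml.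
rewrite exchange_big /twisted_sum; apply: eq_bigr => i _ /=.
under eq_bigr => t _ do rewrite /F eq_sym -mulrA.
rewrite (sum_delta _ (fun t : G => iter i sg y * t x)) sr0; congr (_ * _).
by rewrite galM ?memvf // galX iter_rho mulnC.
Qed.

End Operators.

Theorem dihedral_degree_free : free_over_assoc_order act abs.
Proof.
have [pi [pi_inj piM pi_one real [pi_sg pi_r [r0 [m [r0N rr0 m1 sr0]]]]]] := exists_brace.
have [a [w [hw aE]]] := exists_omega pi_inj piM pi_one real pi_sg pi_r.
have [y [y0 vy ry]] := exists_uniformizer D.
have [b bE] := exists_twisted_trace pi_inj piM real ry rr0 sr0.
pose u x := p%:R^-1 * twisted_sum sg m p y (r0 x).
have p0 := prime_gt0 p_pr.
have pN := dv_p_neq0 D.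
have pVN : (p%:R^-1 : L) != 0 by rewrite invr_eq0.
have vpV : v (p%:R^-1) = - p%:Z by rewrite (valV vP) // (dv_p D).
(* [r0] differs from [r] by a rotation, and rotations fix [s]. *)
have r0s : r0 s = - s.
  have rA : (r^-1 * r0)%g \in <[sg]>%g by apply: (A_index sg_order card_G reflection rN r0N).
  rewrite -(mulKVg r r0) galM ?memvf // (dv_tau_s D) rmorphN /=; congr (- _).
  case/cycleP: rA => i ->; rewrite galX; elim: i => //= i ->; exact: (dv_sigma_s D).
have sgi_Ns i : iter i sg (- s) = - s.
  by elim: i => //= i ->; rewrite rmorphN /= (dv_sigma_s D).
have uD x x' : u (x + x') = u x + u x'.
  rewrite /u rmorphD -mulrDr /twisted_sum -big_split; congr (_ * _); apply: eq_bigr => i _ /=.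
  by rewrite !iter_rho iter_mor_add mulrDr.
have u_s x : u (s * x) = - (s * u x).
  rewrite /u rmorphM /= r0s /twisted_sum !mulr_sumr -sumrN; apply: eq_bigr => i _.
  have e z : iter i (iter m sg) (- s * z) = - (s * iter i (iter m sg) z).
    by rewrite !iter_rho iter_mor_mul sgi_Ns mulNr.
  by rewrite e; ring.
have vr0y : v (r0 y) = 1 by rewrite v_gal.
have r0y0 : r0 y != 0 by rewrite fmorph_eq0.
have [t0 vt] := twisted_sum_exact D m1 y0 vy r0y0 vr0y.
have uy0 : u y != 0 by rewrite mulf_neq0.
have vuy : v (u y) = 1 by rewrite /u (valM vP) // vt vpV addKr.
have y1 : vge v 1 y by rewrite vgeE // vy.
(* The twisted sum gains [1 + (p - 1)] on integers, exactly what division by [p] costs. *)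
have u_ge0 z : vge v 0 z -> vge v 0 (u z).
  move=> z0; rewrite -[0](addNr p%:Z); apply: (vgeM vP); first by rewrite vgeE // vpV.
  have z0' : vge v 0 (r0 z) by rewrite (vge_mor (v_gal r0)).
  have := twisted_sum_ge D m y1 z0'.
  by rewrite addr0 -PoszD add1n prednK.
have [theta th0 hth] := semilinear_basis D hw y0 vy uD u_s uy0 vuy.
have nE : n = (2 * p)%N by rewrite (hopf_dim hgs) -card_gal_dim.
pose wi (j : 'I_p) : 'I_n -> K := iter j (mulH H a) (hunit H).
pose W (jb : 'I_p * bool) : 'I_n -> K := if jb.2 then mulH H (wi jb.1) b else wi jb.1.
have wiE j z : actH act (wi j) z = iter j w z.
  rewrite /wi; case: hgs => _ [hM [h1 _]]; elim: (j : nat) => [|i IH]; first by rewrite h1.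
  by rewrite !iterS hM aE IH.
have WE j (bb : bool) z : actH act (W (j, bb)) z = iter j w (if bb then u z else z).
  rewrite /W; case: bb => /=; last exact: wiE.
  by case: hgs => _ [-> _]; rewrite wiE bE.
have sumE (c : 'I_p * bool -> K) z : \sum_jb c jb *: actH act (W jb) z =
    \sum_j ((c (j, false))%:A * iter j w z + (c (j, true))%:A * iter j w (u z)).
  transitivity (\sum_(jb : 'I_p * bool) c (jb.1, jb.2) *: actH act (W (jb.1, jb.2)) z).
    by apply: eq_bigr => -[].
  rewrite -(pair_bigA _ (fun j bb => c (j, bb) *: actH act (W (j, bb)) z)) /=.
  by apply: eq_bigr => j _; rewrite big_bool !WE /= addrC !mulr_algl.
have y_int : vge v 0 y by apply: vgeW y1.
apply: (@free_by_basis K abs n H _ act hgs _ _ _ W (y * theta)).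
- by apply/int_v; apply: vge_zero.
- by move=> x z /int_v hx /int_v hz; apply/int_v; rewrite (vgeD vP).
- by rewrite card_prod card_ord card_bool nE mulnC.
- by apply/int_v; apply: (vgeMl vP).
- move=> c; rewrite sumE => hc.
  have h k := hth k _ _ (fun j => base_v (c (j, false))) (fun j => base_v (c (j, true))).
  have c0 j bb : (c (j, bb))%:A = 0 :> L.
    apply: (vge_eq0 (v := v)) => k.
    have := h (k%:Z + (1 + j%:Z)); rewrite hc vge_zero => /(_ isT j); rewrite addrK.
    by case: bb => -[].
  by case=> j bb; have /eqP := c0 j bb; rewrite scaler_eq0 oner_eq0 orbF => /eqP.
move=> c /int_v; rewrite sumE => hc [j bb] z /int_v hz; apply/int_v.
have [h1 h2] := hth 0 _ _ (fun j => base_v (c (j, false))) (fun j => base_v (c (j, true))) hc j.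
rewrite WE -mulr_algl; apply: (base_like_order D hw) => //.
  by case: bb.
by case: bb => //; apply: u_ge0.
Qed.

End DihedralDegree.

(** [L] has degree 2 over [E], so ['Gal({:L} / E)] has order 2; its generator is no rotation because
    [p] is odd. *)
Lemma reflection_of_subfield (p : nat) (K : fieldType) (L : splittingFieldType K)
  (sg : gal_of {:L}) (E : {subfield L}) : odd p -> galois 1%AS {:L} ->
  #[sg]%g = p -> \dim {:L} = (2 * p)%N -> \dim E = p ->
  exists2 r : gal_of {:L}, r \notin <[sg]>%g & forall x, (x \in E) = (r x == x).
Proof.
move=> p_odd galL osg dimL dimE.
have galE : galois E {:L} by apply: galoisS galL; rewrite sub1v subvf.
have p0 : (0 < p)%N by case: (p) p_odd.
have cE : #|'Gal({:L} / E)%g| = 2 by rewrite -(galois_dim galE) dimL dimE mulnK.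
have : ~~ ('Gal({:L} / E)%g \subset [set 1%g]).
  by apply/negP => /subset_leq_card; rewrite cE cards1.
case/subsetPn => r rE; rewrite inE => r1; exists r => [|x].
  apply/negP => rA; have : (#[r]%g %| gcdn 2 p)%N.
    by have := order_dvdG rE; have := order_dvdG rA; rewrite cE -[#|_|]/(#[sg]%g) osg dvdn_gcd => -> ->.
  have -> : gcdn 2 p = 1%N by apply/eqP; rewrite -/(coprime 2 p) coprime2n.
  by rewrite dvdn1 order_eq1 (negbTE r1).
apply/idP/eqP => [|rx]; first exact: (fixed_gal (subvf E) rE).
rewrite -(elimT galois_fixedField galE); apply/fixedFieldP; rewrite ?memvf // => g gE.
have GE : [set 1%g; r] = 'Gal({:L} / E)%g.
  apply/eqP; rewrite eqEcard cE cards2 eq_sym r1 leqnn andbT.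
  by apply/subsetP => h /set2P[]->; rewrite ?group1.
by move: gE; rewrite -GE => /set2P[]->; rewrite ?gal_id.
Qed.

Theorem mainTheorem8 (p : nat) (K : fieldType) (abs : K -> rat)
  (p_prime : prime p) (p_odd : odd p) (KQp : is_Qp p abs)
  (L : splittingFieldType K)
  (L_galois : galois 1%AS {:L})
  (L_dihedral : ('Gal({:L} / 1%AS) \isog 'D_(2 * p))%g)
  (L_ntr : not_totally_ramified abs L) :
  (forall E : {subfield L}, \dim E = p ->
     forall (n : nat) (H : hopf_data K n) (act : 'I_n -> 'End(subvs_of E)),
       hopf_galois_structure H act ->
       free_over_assoc_order act abs) /\
  (forall (n : nat) (H : hopf_data K n) (act : 'I_n -> 'End(L)),
       hopf_galois_structure H act ->
       free_over_assoc_order act abs).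
Proof.
have [sg [_ osg oG [r _ rN] refl]] := dihedral_generators p_prime p_odd L_dihedral.
have full (g : gal_of {:L}) : g \in 'Gal({:L} / 1%AS)%g by apply: gal_full.
have card_G : #|{: gal_of {:L}}| = (2 * p)%N.
  by rewrite -oG; apply: eq_card => g; rewrite full.
have {}refl (g : gal_of {:L}) (gN : g \notin <[sg]>%g) := refl g (full g) gN.
have int_v := local_integral p_prime KQp L_galois.
have base_v := local_base_like p_prime KQp L_galois card_G.
split=> [E dimE n H act hgs|n H act hgs].
  have dimL : \dim {:L} = (2 * p)%N by rewrite -(card_gal_dim L_galois).
  have [r' r'N mem_E] := reflection_of_subfield p_odd L_galois osg dimL dimE.
  (* The dihedral valuation is taken with the reflection fixing [E], so that the uniformizer fixed
     by it lies in [E]. *)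
  have [s D] := local_dihedral p_prime p_odd KQp L_galois osg card_G refl L_ntr r'N.
  exact: (prime_degree_free L_galois osg (gal_gen osg card_G refl r'N) D int_v (base_v r')
    dimE mem_E hgs).
have [s D] := local_dihedral p_prime p_odd KQp L_galois osg card_G refl L_ntr rN.
have v_gal (g : gal_of {:L}) x : local_val p_prime KQp (g x) = local_val p_prime KQp x.
  by rewrite /local_val /half_val vL_gal.
exact: (dihedral_degree_free L_galois osg card_G refl rN (gal_gen osg card_G refl rN) D int_v
  (base_v r) v_gal hgs).
Qed.
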